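(* Let $m,p$ be integers, $m\neq0$, $1\le p\le n-1$, $$a=\begin{pmatrix}i(n-p)mI_p&0\\0&-ipmI_{n-p}\end{pmatrix}\in su(n),$$ $\psi=e^{((1-\lambda)x+(1+\lambda-\lambda^2)u-v)a}$ the extended solution, and $J_0=e^{-(x+y)a}$ the associated Ward map. Choose $(j_{2k-1},l_{2k-1})\in\mathbb{Z}^2$, $1\le k\le N$, such that $$\left(j_{2k-1}-\tfrac{nm}{2}\right)^2+\left(l_{2k-1}-\tfrac{nm}{2}\right)^2<\left(\tfrac{nm}{2}\right)^2,\qquad \tfrac{nm}{2}<l_{2k-1},$$ and $(j_{2k-1},l_{2k-1})\neq(j_{2h-1},l_{2h-1})$ for $1\le k<h\le N$. Let $(j_{2k},l_{2k})=(j_{2k-1},nm-l_{2k-1})$, and for $s=1,\dots,2N$ let $z_s=\sqrt{\frac{nm-j_s}{j_s}}\,e^{i\theta_s}$ with $$\cos\theta_s=\mathrm{sgn}(m)\frac{l_s-nm/2}{\sqrt{j_s(nm-j_s)}},\qquad \sin\theta_s=\mathrm{sgn}(m)\sqrt{1-\cos^2\theta_s}.$$ Let $\pi_s(x,y,t)$ be the Hermitian projection of $\mathbb{C}^n$ onto $\mathbb{C}(1,\dots,1,f_s(w_s),\dots,f_s(w_s))^T$, where $1$ is repeated $p$ times, $f_s(w_s)=e^{i(nm-j_s-nmz_s)w_s}$ is repeated $n-p$ times, and $w_s=x+z_su+z_s^{-1}v$. Let $$J_{2N}(x,y,t)=h_{z_{2N},\pi_{2N}}*(\cdots*(h_{z_1,\pi_1}*J_0(x,y,t))\cdots)$$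 be the Ward map obtained by applying $2N$ Bäcklund transformations to $J_0$. Then $J_{2N}:T^2\times\mathbb{R}\to SU(n)$ is a homoclinic Ward map. Moreover, $J_{2N}\to(-1)^NJ_0$ as $t\to\pm\infty$.
   Context: A Ward map is a solution $J:\mathbb{R}^{2,1}\to SU(n)$ (coordinates $x,y,t$) of the Ward equation $(J^{-1}J_t)_t-(J^{-1}J_x)_x-(J^{-1}J_y)_y-[J^{-1}J_t,J^{-1}J_y]=0$. A Ward map from $T^2\times\mathbb{R}$ is one that is $2\pi$-periodic in $x$ and in $y$. Set $u=\frac{t+y}{2}$, $v=\frac{t-y}{2}$. An extended Ward map (extended solution) is a map $\psi(x,y,t,\lambda)\in GL(n,\mathbb{C})$ such that $(\lambda\psi_x-\psi_u)\psi^{-1}$ and $(\lambda\psi_v-\psi_x)\psi^{-1}$ are independent of $\lambda$ and $\psi(x,y,t,\bar\lambda)^*\psi(x,y,t,\lambda)=I$; the associated Ward map is $\psi(\cdot,0)^{-1}$, up to a constant normalizing the determinant to $1$. For a Hermitian projection $\pi$ write $\pi^\perp=I-\pi$ and $h_{z,\pi}(\lambda)=\pi^\perp+\frac{\lambda-z}{\lambda-\bar z}\pi$. Bäcklund transformation: let $\psi$ be an extended solution with associated Ward map $J$, holomorphic and non-degenerate at $\lambda=z\in\mathbb{C}\setminus\mathbb{R}$, and let $\pi(x,y,t)$ be the Hermitian projection onto the line spanned by $q(w)$, where $q$ is meromorphic in $w=x+zu+z^{-1}v$. Let $\tilde\pi(x,y,t)$ be the Hermitian projection onto $\psi(x,y,t,z)\,\mathrm{Im}(\pi(x,y,t))$.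 Then $h_{z,\pi}*\psi:=h_{z,\tilde\pi}\psi$ is a new extended solution, and the new Ward map is $h_{z,\pi}*J:=\left(\frac{z}{\bar z}\right)^{1/n}J\left(\frac{\bar z}{z}\tilde\pi+\tilde\pi^\perp\right)$, where $\left(\frac{z}{\bar z}\right)^{1/n}$ is a constant normalizing the determinant to $1$. The transformations are iterated on the extended solutions, starting from $\psi$. A solution of the Ward equation on $T^2\times\mathbb{R}$ is homoclinic if it tends to the same stationary ($t$-independent) solution $u_0$ as $t\to\pm\infty$, is tangent to a stable linear mode of $u_0$ as $t\to+\infty$, and is tangent to an unstable linear mode of $u_0$ as $t\to-\infty$. Here the linear modes of $u_0$ are the Fourier-mode solutions, with time factor $e^{\gamma t}$, of the linearization of the Ward equation at $u_0$ (written for $\eta=J^{-1}\delta J$); a mode is stable if $\mathrm{Re}\,\gamma<0$ and unstable if $\mathrm{Re}\,\gamma>0$.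
   Formalization: (-1)^N J_0 is not in SU(n) for nN odd; proved: J_{2N} → ωJ_0 with ω the product of the chosen constants (z_s/z̄_s)^{1/n}, ω^n=1, and ω=(-1)^N for a suitable choice if nN is even. A linear mode is a skew-Hermitian finite sum of Fourier modes with one common γ; N ≥ 1. *)

(* Defs.v *)
From HB Require Import structures.
From mathcomp Require Import all_boot all_order all_algebra.
From mathcomp Require Import all_classical all_reals all_analysis.
From mathcomp Require Import spectral complex.
Import Order.TTheory GRing.Theory Num.Theory.
Import numFieldNormedType.Exports.

Set Implicit Arguments.
Unset Strict Implicit.
Unset Printing Implicit Defensive.

Open Scope complex_scope.
Open Scope sesquilinear_scope.
Open Scope classical_set_scope.
Open Scope ring_scope.

Section Calculus.
Context {R : realType}.

Definition cexp (z : R[i]) : R[i] :=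
  (expR (complex.Re z) * cos (complex.Im z))
  +i* (expR (complex.Re z) * sin (complex.Im z)).

(* e^D for the diagonal matrix D = diag_mx d *)
Definition exp_diag n (d : 'rV[R[i]]_n) : 'M[R[i]]_n := diag_mx (map_mx cexp d).

(* Real fields are curried functions of (x, y, t). *)
Definition rDx (f : R -> R -> R -> R) x y t : R := derive1 (fun s => f s y t) x.
Definition rDy (f : R -> R -> R -> R) x y t : R := derive1 (fun s => f x s t) y.
Definition rDt (f : R -> R -> R -> R) x y t : R := derive1 (fun s => f x y s) t.

Fixpoint Ck (k : nat) (f : R -> R -> R -> R) : Prop :=
  continuous (fun P : R * R * R => f P.1.1 P.1.2 P.2) /\
  (if k is k'.+1 then
     [/\ forall x y t, [/\ derivable (fun s => f s y t) x 1,
                           derivable (fun s => f x s t) y 1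
                         & derivable (fun s => f x y s) t 1],
         Ck k' (rDx f), Ck k' (rDy f) & Ck k' (rDt f)]
   else True).

Context {n : nat}.
Implicit Types F G : R -> R -> R -> 'M[R[i]]_n.

Definition smooth F : Prop := forall (i j : 'I_n) (k : nat),
  Ck k (fun x y t => complex.Re (F x y t i j)) /\
  Ck k (fun x y t => complex.Im (F x y t i j)).

Definition Dx F x y t : 'M[R[i]]_n := \matrix_(i, j)
  (rDx (fun x y t => complex.Re (F x y t i j)) x y t
   +i* rDx (fun x y t => complex.Im (F x y t i j)) x y t).
Definition Dy F x y t : 'M[R[i]]_n := \matrix_(i, j)
  (rDy (fun x y t => complex.Re (F x y t i j)) x y t
   +i* rDy (fun x y t => complex.Im (F x y t i j)) x y t).
Definition Dt F x y t : 'M[R[i]]_n := \matrix_(i, j)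
  (rDt (fun x y t => complex.Re (F x y t i j)) x y t
   +i* rDt (fun x y t => complex.Im (F x y t i j)) x y t).

Definition comm (A B : 'M[R[i]]_n) : 'M[R[i]]_n := A *m B - B *m A.

(* The logarithmic derivatives J^{-1} J_x, J^{-1} J_y, J^{-1} J_t. *)
Definition Ax F x y t := invmx (F x y t) *m Dx F x y t.
Definition Ay F x y t := invmx (F x y t) *m Dy F x y t.
Definition At F x y t := invmx (F x y t) *m Dt F x y t.

End Calculus.

Section Ward.
Context {R : realType} {n : nat}.
Implicit Types J eta : R -> R -> R -> 'M[R[i]]_n.

Definition in_SU (A : 'M[R[i]]_n) : Prop := A \is unitarymx /\ \det A = 1.

Definition ward_map J : Prop :=
  [/\ smooth J, (forall x y t, in_SU (J x y t))
    & forall x y t,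
        Dt (At J) x y t - Dx (Ax J) x y t - Dy (Ay J) x y t
        - comm (At J x y t) (Ay J x y t) = 0].

Definition ward_map_T2 J : Prop :=
  ward_map J /\
  forall x y t, J (x + 2 * pi) y t = J x y t /\ J x (y + 2 * pi) t = J x y t.

Definition stationary (u0 : R -> R -> 'M[R[i]]_n) : R -> R -> R -> 'M[R[i]]_n :=
  fun x y _ => u0 x y.

(* Linearization of the Ward equation at J: a variation of J with
   J^{-1} dJ = eta changes each J^{-1} J_s by eta_s + [J^{-1} J_s, eta]. *)
Definition linearized_ward J eta : Prop :=
  let Bx x y t := Dx eta x y t + comm (Ax J x y t) (eta x y t) in
  let By x y t := Dy eta x y t + comm (Ay J x y t) (eta x y t) in
  let Bt x y t := Dt eta x y t + comm (At J x y t) (eta x y t) in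
  forall x y t,
    Dt Bt x y t - Dx Bx x y t - Dy By x y t
    - comm (Bt x y t) (Ay J x y t) - comm (At J x y t) (By x y t) = 0.

Definition fourier_mode (gamma : R[i]) (k : int * int) (C : 'M[R[i]]_n) :
    R -> R -> R -> 'M[R[i]]_n :=
  fun x y t => cexp ('i%C * (k.1%:~R * x + k.2%:~R * y)%:C + gamma * t%:C) *: C.

(* A linear mode is a nonzero su(n)-valued solution zeta - zeta^* of the
   linearized equation, where zeta is a finite superposition of Fourier-mode
   solutions sharing the time factor e^{gamma t}. *)
Definition linear_mode (u0 : R -> R -> 'M[R[i]]_n) (gamma : R[i]) eta : Prop :=
  exists (S : seq (int * int)) (C : int * int -> 'M[R[i]]_n),
  let zeta x y t := \sum_(k <- S) fourier_mode gamma k (C k) x y t in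
  [/\ forall k, k \in S ->
        \tr (C k) = 0 /\
        linearized_ward (stationary u0) (fourier_mode gamma k (C k)),
      forall x y t, eta x y t = zeta x y t - (zeta x y t)^t*
    & exists x y t, eta x y t != 0].

(* Limits in t are uniform in (x, y). *)
Definition tends_to (F : set_system R) J (u0 : R -> R -> 'M[R[i]]_n) : Prop :=
  forall e : R, 0 < e ->
    \forall t \near F, forall x y i j, `|(J x y t - u0 x y) i j| < e%:C.

(* u0^{-1} J = I + eta + o(e^{Re(gamma) t}) along F *)
Definition tangent_to (F : set_system R) J (u0 : R -> R -> 'M[R[i]]_n)
    (gamma : R[i]) eta : Prop :=
  forall e : R, 0 < e ->
    \forall t \near F, forall x y i j,
      `|(invmx (u0 x y) *m J x y t - 1%:M - eta x y t) i j|
        <= (e * expR (complex.Re gamma * t))%:C.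

Definition homoclinic J : Prop :=
  ward_map_T2 J /\
  exists u0 : R -> R -> 'M[R[i]]_n,
    [/\ ward_map_T2 (stationary u0),
        tends_to +oo J u0, tends_to -oo J u0,
        (exists (gamma : R[i]) eta,
           [/\ complex.Re gamma < 0, linear_mode u0 gamma eta
             & tangent_to +oo J u0 gamma eta])
      & (exists (gamma : R[i]) eta,
           [/\ 0 < complex.Re gamma, linear_mode u0 gamma eta
             & tangent_to -oo J u0 gamma eta])].

End Ward.

Section Backlund.
Context {R : realType} {n : nat}.
Implicit Types (psi : R -> R -> R -> R[i] -> 'M[R[i]]_n)
  (J : R -> R -> R -> 'M[R[i]]_n) (q : R -> R -> R -> 'cV[R[i]]_n).

(* Hermitian projection v (v^* v)^{-1} v^* onto the line spanned by v != 0 *)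
Definition line_proj (v : 'cV[R[i]]_n) : 'M[R[i]]_n :=
  ((v^t* *m v) 0 0)^-1 *: (v *m v^t*).

Definition h_factor (z : R[i]) (P : 'M[R[i]]_n) (lambda : R[i]) : 'M[R[i]]_n :=
  (1%:M - P) + ((lambda - z) / (lambda - z^*)) *: P.

(* With P the projection onto the line C q, psi(z) (Im P) is the line
   spanned by psi(z) q. *)
Definition proj_tilde z q psi x y t := line_proj (psi x y t z *m q x y t).

Definition backlund_ext z q psi : R -> R -> R -> R[i] -> 'M[R[i]]_n :=
  fun x y t lambda =>
    h_factor z (proj_tilde z q psi x y t) lambda *m psi x y t lambda.

(* c is the constant (z / z^* )^{1/n} normalizing the determinant. *)
Definition backlund_ward (c : R[i]) z q psi J : R -> R -> R -> 'M[R[i]]_n :=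
  fun x y t =>
    c *: (J x y t *m ((z^* / z) *: proj_tilde z q psi x y t
                      + (1%:M - proj_tilde z q psi x y t))).

(* Step s = 1, 2, ... uses the constants c s, z s and the line spanned by q s. *)
Fixpoint backlund_iter (c z : nat -> R[i])
    (q : nat -> R -> R -> R -> 'cV[R[i]]_n) psi J (k : nat) :=
  if k is s.+1 then
    let prev := backlund_iter c z q psi J s in
    (backlund_ext (z s.+1) (q s.+1) prev.1,
     backlund_ward (c s.+1) (z s.+1) (q s.+1) prev.1 prev.2)
  else (psi, J).

End Backlund.

Section Data.
Context {R : realType} (n p : nat) (m : int).

Definition a_diag : 'rV[R[i]]_n :=
  \row_(i < n) (if (i < p)%N then 'i%C * ((n - p)%:R * m%:~R)
                else - ('i%C * (p%:R * m%:~R))).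

Definition ucoord (y t : R) : R := (t + y) / 2.
Definition vcoord (y t : R) : R := (t - y) / 2.

Definition psi0 (x y t : R) (lambda : R[i]) : 'M[R[i]]_n :=
  exp_diag (((1 - lambda) * x%:C
             + (1 + lambda - lambda ^+ 2) * (ucoord y t)%:C
             - (vcoord y t)%:C) *: a_diag).

Definition J0 (x y : R) : 'M[R[i]]_n := exp_diag (- (x + y)%:C *: a_diag).

Definition nmR : R := n%:R * m%:~R.

Definition in_disc (j l : int) : Prop :=
  (j%:~R - nmR / 2) ^+ 2 + (l%:~R - nmR / 2) ^+ 2 < (nmR / 2) ^+ 2.

Definition cos_theta (j l : int) : R :=
  Num.sg m%:~R * ((l%:~R - nmR / 2) / Num.sqrt (j%:~R * (nmR - j%:~R))).
Definition sin_theta (j l : int) : R :=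
  Num.sg m%:~R * Num.sqrt (1 - cos_theta j l ^+ 2).

Definition zpar (j l : int) : R[i] :=
  (Num.sqrt ((nmR - j%:~R) / j%:~R))%:C * (cos_theta j l +i* sin_theta j l).

Definition wcoord (z : R[i]) (x y t : R) : R[i] :=
  x%:C + z * (ucoord y t)%:C + z^-1 * (vcoord y t)%:C.

Definition fpar (j l : int) (w : R[i]) : R[i] :=
  cexp ('i%C * ((nmR - j%:~R)%:C - nmR%:C * zpar j l) * w).

Definition qvec (j l : int) (x y t : R) : 'cV[R[i]]_n :=
  \col_(i < n) (if (i < p)%N then 1 else fpar j l (wcoord (zpar j l) x y t)).

(* The map J_{2N} built with the normalizing constants c 1, ..., c (2N) *)
Definition J2N (N : nat) (j l : nat -> int) (c : nat -> R[i]) :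
    R -> R -> R -> 'M[R[i]]_n :=
  (backlund_iter c (fun s => zpar (j s) (l s)) (fun s => qvec (j s) (l s))
     psi0 (stationary J0) (2 * N)).2.

(* c s is some n-th root of z_s / z_s^* for each 1 <= s <= 2N. *)
Definition normalizing (N : nat) (j l : nat -> int) (c : nat -> R[i]) : Prop :=
  forall s : nat, (1 <= s <= 2 * N)%N ->
    c s ^+ n = zpar (j s) (l s) / (zpar (j s) (l s))^*.

End Data.

(* Main.v *)
Require Import Defs.
From HB Require Import structures.
From mathcomp Require Import all_boot all_order all_algebra.
From mathcomp Require Import all_classical all_reals all_analysis.
From mathcomp Require Import spectral complex.
From mathcomp Require Import ring lra.
Import Order.TTheory GRing.Theory Num.Theory.
Import numFieldNormedType.Exports.
Set Implicit Arguments.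
Unset Strict Implicit.
Unset Printing Implicit Defensive.
Local Open Scope complex_scope.
Local Open Scope sesquilinear_scope.
Local Open Scope classical_set_scope.
Local Open Scope ring_scope.

(** The Bäcklund transformation with parameter z replaces A = J^-1 J_u and
    B = J^-1 J_x by A + (z^* - z) P_x and B + (z^* - z) P_v, where P is the
    projection onto the line spanned by psi(z) q: with L = z d_x - d_u, L P =
    [A, P] + (z - z^* ) P P_x follows by differentiating P psi(z) q = psi(z) q
    and taking adjoints.  The Ward equation A_v = B_x is therefore preserved,
    because mixed derivatives of P commute.

    After 2N steps J = omega J_0 Phi(0)^*, where Phi(lambda) is the product of
    the 2N rational factors.  Everything happens in the plane spanned by the
    indicators of the two blocks, where step s starts from a line through
    (delta_s, 1) with delta_s a Fourier mode decaying like e^{-tau_s |t|} as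
    t -> +oo or t -> -oo (after exchanging the two axes).  Clearing the poles
    of Phi gives a polynomial matrix which annihilates (delta_s, 1) at z_s and
    (1, -delta_s^* ) at z_s^*.  Lagrange interpolation at these nodes turns the
    mere convergence of the factors into the expansion Phi(0)^* = I + zeta -
    zeta^* + o(e^{-tau |t|}), in which zeta is a combination of the modes with
    the smallest rate tau, with nonzero coefficients.  The convergence
    Phi(0) -> I uses z_{2k} = - z_{2k-1}^*, which gives prod z_s = prod z_s^*. *)

(** The obstacle is the tangency. The line of step s depends on all earlier factors at z_s, so a
    first order expansion of the recursion would have to follow nested projections. Interpolation
    avoids this: each node value carries an exact factor delta_s, and for what multiplies it a limit
    without any rate is enough.

    Mirror indices 2k-1 and 2k have the same j and the same tau, so the slowest mode is always a
    superposition. That it does not vanish identically rests on the frequencies (j_s, l_s) being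
    pairwise distinct, hence on nm/2 < l at odd indices, and on the independence of characters.

    The sign (-1)^N is a matter of normalization. The constants [c s] are fixed only up to n-th
    roots of unity, so in general the limit is [omega *: J0] with [omega ^+ n = 1]; the value (-1)^N
    can be arranged exactly when it is itself an n-th root of unity, that is, when nN is even. *)

Section Adjoint.
Context {R : realType}.
Notation C := R[i].

Lemma adjM m n p (A : 'M[C]_(m, n)) (B : 'M[C]_(n, p)) :
  (A *m B)^t* = B^t* *m A^t*.
Proof. by rewrite trmx_mul map_mxM. Qed.

Lemma adjD m n (A B : 'M[C]_(m, n)) : (A + B)^t* = A^t* + B^t*.
Proof. by rewrite linearD map_mxD. Qed.

Lemma adjN m n (A : 'M[C]_(m, n)) : (- A)^t* = - A^t*.
Proof. by rewrite linearN map_mxN. Qed.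

Lemma adjZ m n (c : C) (A : 'M[C]_(m, n)) : (c *: A)^t* = c^* *: A^t*.
Proof. by rewrite linearZ map_mxZ. Qed.

Lemma adj1 n : (1%:M : 'M[C]_n)^t* = 1%:M.
Proof. by rewrite trmx1 map_mx1. Qed.

Lemma adjK m n (A : 'M[C]_(m, n)) : A^t*^t* = A.
Proof. by apply/matrixP => i j; rewrite !mxE conjCK. Qed.

End Adjoint.

(** * Hermitian projections onto lines *)

Section LineProjection.
Context {R : realType} {n : nat}.
Notation C := R[i].
Implicit Types v : 'cV[C]_n.

Definition sqn v : C := (v^t* *m v) 0 0.

Lemma sqnE v : sqn v = \sum_i `|v i 0| ^+ 2.
Proof.
rewrite /sqn mxE; apply: eq_bigr => i _.
by rewrite !mxE mulrC -normCK.
Qed.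

Lemma sqn_eq0 v : (sqn v == 0) = (v == 0).
Proof.
rewrite sqnE; apply/eqP/eqP => [s0|->]; last first.
  by apply: big1 => i _; rewrite mxE normr0 expr0n.
apply/matrixP => i j; rewrite ord1 [RHS]mxE.
have /eqP : `|v i 0| ^+ 2 = 0.
  by apply: (psumr_eq0P _ s0) => // k _; rewrite exprn_ge0.
by rewrite sqrf_eq0 normr_eq0 => /eqP.
Qed.

Lemma sqn_conj v : (sqn v)^* = sqn v.
Proof. by rewrite sqnE rmorph_sum; apply: eq_bigr => i _; rewrite rmorphXn /= conj_normC. Qed.

Lemma sqnZ (c : C) v : sqn (c *: v) = c^* * c * sqn v.
Proof. by rewrite /sqn adjZ -scalemxAl -scalemxAr !mxE mulrA. Qed.

Lemma sqnM v : v^t* *m v = (sqn v)%:M.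
Proof. by rewrite [LHS]mx11_scalar. Qed.

Lemma line_projE v : line_proj v = v *m ((sqn v)^-1 *: v^t*).
Proof. by rewrite /line_proj -scalemxAr. Qed.

Lemma line_proj_adj v : (line_proj v)^t* = line_proj v.
Proof. by rewrite /line_proj adjZ adjM adjK fmorphV /= sqn_conj. Qed.

Lemma line_proj_id v : line_proj v *m v = v.
Proof.
have [->|v0] := eqVneq v 0; first by rewrite mulmx0.
rewrite line_projE -mulmxA -scalemxAl sqnM.
by rewrite -scalemx1 scalerA mulVf ?sqn_eq0 // scale1r mulmx1.
Qed.

Lemma line_proj_idem v : line_proj v *m line_proj v = line_proj v.
Proof. by rewrite {2}line_projE mulmxA line_proj_id -line_projE. Qed.

Lemma line_projZ (c : C) v : c != 0 -> line_proj (c *: v) = line_proj v.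
Proof.
move=> c0; rewrite /line_proj -!/(sqn _) sqnZ adjZ -scalemxAl -scalemxAr !scalerA.
congr (_ *: _); rewrite !invfM.
have /= cs0 : c^* != 0 by rewrite conjC_eq0.
have [->|s0] := eqVneq (sqn v) 0; first by rewrite invr0 mulr0 !mul0r.
by field; rewrite s0 cs0 c0.
Qed.

Lemma line_proj_isom d (E : 'M[C]_(d, n)) v : E^t* *m E = 1%:M ->
  line_proj (E *m v) = E *m line_proj v *m E^t*.
Proof.
move=> EE; rewrite /line_proj -scalemxAr -scalemxAl adjM !mulmxA.
by rewrite -[v^t* *m _ *m E]mulmxA EE mulmx1.
Qed.

End LineProjection.

Lemma det_1_rank1 (F : comUnitRingType) n (u : 'cV[F]_n) (w : 'rV[F]_n) :
  \det (1%:M + u *m w) = 1 + (w *m u) 0 0.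
Proof.
(* Eliminating either off-diagonal block of [M] factors it into triangular matrices; the two
   factorizations compute the same determinant. *)
pose M := block_mx (1%:M : 'M[F]_1) (- w) u (1%:M : 'M[F]_n).
have d1 : \det M = \det (1%:M + u *m w).
  have -> : M = block_mx 1%:M 0 u (1%:M : 'M[F]_n)
      *m block_mx 1%:M (- w) 0 (1%:M + u *m w).
    rewrite mulmx_block !(mul1mx, mulmx1, mul0mx, mulmx0, addr0, add0r).
    by rewrite mulmxN addrCA addNr addr0.
  by rewrite det_mulmx det_lblock det_ublock !det1 !mul1r.
have <- : \det M = 1 + (w *m u) 0 0; last by rewrite d1.
have -> : M = block_mx (1%:M + w *m u) (- w) 0 1%:M
    *m block_mx 1%:M 0 u (1%:M : 'M[F]_n).
  rewrite mulmx_block !(mul1mx, mulmx1, mul0mx, mulmx0, addr0, add0r).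
  by rewrite mulNmx addrK.
by rewrite det_mulmx det_lblock det_ublock !det1 !mulr1 det_mx11 !mxE.
Qed.

(** * Dressing factors, their products and their restriction to a subspace *)

Section Dressing.
Context {R : realType}.
Notation C := R[i].

Lemma det_line_proj n (c : C) (v : 'cV[C]_n) : v != 0 ->
  \det (1%:M + c *: line_proj v) = 1 + c.
Proof.
move=> v0; rewrite line_projE scalemxAr det_1_rank1 -!scalemxAl sqnM.
by rewrite !mxE eqxx mulr1n mulVf ?sqn_eq0 // mulr1.
Qed.

Lemma h_factorE n z (P : 'M[C]_n) lam : lam != z^* ->
  h_factor z P lam = 1%:M + ((z^* - z) / (lam - z^*)) *: P.
Proof.
move=> lz; rewrite /h_factor -addrA; congr (_ + _).
rewrite -scaleN1r -scalerDl; congr (_ *: _).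
by rewrite -subr_eq0 in lz; field.
Qed.

(** On the image of [P] the scalar at [lam] and the conjugate of the scalar at [lam^*] are inverse
    to each other. The condition [lam != z] keeps [lam^*] away from the pole [z^*]. *)
Lemma h_factor_unitary n z (P : 'M[C]_n) lam : P *m P = P -> P^t* = P ->
  lam != z -> lam != z^* -> (h_factor z P lam^*)^t* *m h_factor z P lam = 1%:M.
Proof.
move=> PP Ph lz lzs; rewrite /h_factor adjD adjZ adjD adjN adj1 Ph.
rewrite fmorph_div /= !rmorphB /= !conjCK.
have QP : (1%:M - P) *m P = 0 by rewrite mulmxBl mul1mx PP subrr.
have PQ : P *m (1%:M - P) = 0 by rewrite mulmxBr mulmx1 PP subrr.
have QQ : (1%:M - P) *m (1%:M - P) = 1%:M - P by rewrite mulmxBr mulmx1 QP subr0.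
rewrite (mulmxDl (1%:M - P)) !(mulmxDr _ (1%:M - P)) -!scalemxAl -!scalemxAr PP QQ QP PQ !scaler0 addr0 add0r.
rewrite scalerA (_ : _ * _ = 1) ?scale1r ?subrK //.
by move: lz lzs; rewrite -!(subr_eq0 lam) => ? ?; field; apply/andP.
Qed.

(* The accumulated factor h_{z_k} ... h_{z_1} with 1-based indices; [v s] spans
   the line of step [s] before the earlier factors are applied. *)
Fixpoint dress n (z : nat -> C) (v : nat -> 'cV[C]_n) (k : nat) (lam : C) : 'M[C]_n :=
  if k is s.+1 then
    h_factor (z k) (line_proj (dress z v s (z k) *m v k)) lam *m dress z v s lam
  else 1%:M.

Definition dproj n (z : nat -> C) (v : nat -> 'cV[C]_n) (k : nat) : 'M[C]_n :=
  line_proj (dress z v k.-1 (z k) *m v k).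

Lemma dressS n z (v : nat -> 'cV[C]_n) k lam :
  dress z v k.+1 lam = h_factor (z k.+1) (dproj z v k.+1) lam *m dress z v k lam.
Proof. by []. Qed.

Lemma dress_unitary n z (v : nat -> 'cV[C]_n) k lam :
  (forall s, (1 <= s <= k)%N -> lam != z s /\ lam != (z s)^*) ->
  (dress z v k lam^*)^t* *m dress z v k lam = 1%:M.
Proof.
elim: k => [|k IH] h /=; first by rewrite adj1 mul1mx.
rewrite adjM mulmxA -[_ *m _ *m h_factor _ _ _]mulmxA.
have [h1 h2] : lam != z k.+1 /\ lam != (z k.+1)^* by apply: h; rewrite ltnS leqnn.
rewrite h_factor_unitary ?line_proj_idem ?line_proj_adj // mulmx1 IH // => s /andP[s1 sk].
by apply: h; rewrite s1 ltnW.
Qed.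

(** Only the lines matter, so representatives may be rescaled. The hypothesis can use the factors of
    [v] on both sides because, by induction, those of [w] already agree with them when step s is
    reached. *)
Lemma eq_dress n z (v w : nat -> 'cV[C]_n) k lam :
  (forall s, (1 <= s <= k)%N -> line_proj (dress z v s.-1 (z s) *m v s) =
     line_proj (dress z v s.-1 (z s) *m w s)) ->
  dress z v k lam = dress z w k lam.
Proof.
elim: k lam => [|k IH] lam h //=.
have IH' mu : dress z v k mu = dress z w k mu.
  by apply: IH => s /andP[s1 sk]; apply: h; rewrite s1 ltnW.
have /= -> : line_proj (dress z v k.+1.-1 (z k.+1) *m v k.+1)
  = line_proj (dress z v k.+1.-1 (z k.+1) *m w k.+1) by apply: h; rewrite ltnS leqnn.
by rewrite !IH'.
Qed.

(** If all vectors lie in the image of an isometry, every factor is the identity on the orthogonal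
    complement of that image. This reduces the iteration to the plane of the two block
    indicators. *)
Lemma dress_isom n d (E : 'M[C]_(d, n)) z (v : nat -> 'cV[C]_n) k lam :
  E^t* *m E = 1%:M ->
  dress z (fun s => E *m v s) k lam
    = 1%:M + E *m (dress z v k lam - 1%:M) *m E^t*.
Proof.
move=> EE; elim: k lam => [|k IH] lam /=.
  by rewrite subrr mulmx0 mul0mx addr0.
(* The large factor intertwines with the small one through [E], so the next line is again in the
   image of [E]. *)
have DE mu (w : 'cV_n) : (1%:M + E *m (dress z v k mu - 1%:M) *m E^t*) *m (E *m w)
    = E *m (dress z v k mu *m w).
  rewrite mulmxDl mul1mx mulmxA -[E *m _ *m _ *m E]mulmxA EE mulmx1.
  by rewrite mulmxBr mulmx1 mulmxBl !mulmxA addrC subrK.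
rewrite !IH DE line_proj_isom //.
rewrite /h_factor; set c := _ / _.
move: (line_proj _) (dress z v k lam) c => P D c.
have -> : 1%:M - E *m P *m E^t* + c *: (E *m P *m E^t*)
    = 1%:M + E *m ((1%:M - P + c *: P) - 1%:M) *m E^t*.
  rewrite -addrA; congr (_ + _).
  have -> : 1%:M - P + c *: P - 1%:M = - P + c *: P.
    by rewrite addrAC [1%:M - P]addrC addrK.
  by rewrite mulmxDr mulmxDl mulmxN mulNmx -scalemxAr -scalemxAl.
set H := 1%:M - P + c *: P.
rewrite mulmxDl mul1mx mulmxDr mulmx1 -addrA; congr (_ + _).
rewrite !mulmxA -[E *m (H - _) *m E^t* *m E]mulmxA EE mulmx1.
rewrite -mulmxDl -!mulmxDl.
have -> : E *m (D - 1%:M) + (E *m (H - 1%:M) + E *m (H - 1%:M) *m (D - 1%:M))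
  = E *m (H *m D - 1%:M); last by [].
rewrite -mulmxA -!mulmxDr; congr (_ *m _).
rewrite mulmxBr mulmx1 mulmxBl mul1mx.
by rewrite [X in _ + X]addrC subrK addrC addrA subrK.
Qed.

End Dressing.

(** * Smooth real fields with commuting partial derivatives *)

Section RealFields.
Context {R : realType}.
Implicit Types f g : R -> R -> R -> R.

(** A single index for the three variables, so that each rule of differentiation is proved once. *)
Inductive dir := dX | dY | dT.

Definition along (d : dir) (f : R -> R -> R -> R) (x y t : R) : R -> R :=
  match d with
  | dX => fun s => f s y t
  | dY => fun s => f x s t
  | dT => fun s => f x y s
  end.

Definition coordinate (d : dir) (x y t : R) : R :=
  match d with dX => x | dY => y | dT => t end.

Definition rD (d : dir) : (R -> R -> R -> R) -> R -> R -> R -> R :=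
  match d with dX => rDx | dY => rDy | dT => rDt end.

Variant derivable_along f : Prop :=
  DerivableAlong of forall d x y t,
    derivable (along d f x y t) (coordinate d x y t) 1.

Definition joint_continuous f :=
  continuous (fun P : R * R * R => f P.1.1 P.1.2 P.2).

Lemma rDE d f x y t :
  rD d f x y t = derive1 (along d f x y t) (coordinate d x y t).
Proof. by case: d. Qed.

Lemma along_coordinate d f x y t :
  along d f x y t (coordinate d x y t) = f x y t.
Proof. by case: d. Qed.

Lemma Ck0 f : joint_continuous f -> Ck 0 f.
Proof. by []. Qed.

Lemma CkS k f : joint_continuous f -> derivable_along f ->
  (forall d, Ck k (rD d f)) -> Ck k.+1 f.
Proof.
move=> cf [df] Cf; split=> //; split; [|exact: (Cf dX)|exact: (Cf dY)|exact: (Cf dT)].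
by move=> x y t; split; [exact: (df dX)|exact: (df dY)|exact: (df dT)].
Qed.

Lemma Ck_cont k f : Ck k f -> joint_continuous f.
Proof. by case: k => [|k] []. Qed.

Lemma CkS_derivable k f : Ck k.+1 f -> derivable_along f.
Proof. case=> _ [df _ _ _]; split=> d x y t; have [hx hy ht] := df x y t.
by case: d; [exact: hx|exact: hy|exact: ht]. Qed.

Lemma CkS_rD k f d : Ck k.+1 f -> Ck k (rD d f).
Proof. case=> _ [_ hx hy ht].
by case: d; [exact: hx|exact: hy|exact: ht]. Qed.

Lemma CkW k f : Ck k.+1 f -> Ck k f.
Proof.
elim: k f => [|k IH] f Cf; first by apply: Ck0; apply: Ck_cont Cf.
apply: CkS; [exact: Ck_cont Cf|exact: CkS_derivable Cf|].
by move=> d; apply: IH; apply: CkS_rD.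
Qed.

Lemma rD_is_derive f g d x y t :
  is_derive (coordinate d x y t) 1 (along d f x y t) (g x y t) ->
  rD d f x y t = g x y t.
Proof. by move=> H; rewrite rDE derive1E; apply: derive_val. Qed.

Lemma derivable_alongP f d x y t : derivable_along f ->
  is_derive (coordinate d x y t) 1 (along d f x y t) (rD d f x y t).
Proof. by case=> df; rewrite rDE derive1E; apply/derivableP/df. Qed.

(** The pointwise operations get names so that the derivative of a compound field is again a
    compound field, ready to be differentiated further. *)
Definition fadd f g x y t := f x y t + g x y t.
Definition fmul f g x y t := f x y t * g x y t.
Definition finv f x y t := (f x y t)^-1.
Definition fcst (c : R) := fun _ _ _ : R => c.

Lemma is_derive_fadd f g d x y t : derivable_along f -> derivable_along g ->
  is_derive (coordinate d x y t) 1 (along d (fadd f g) x y t)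
    (fadd (rD d f) (rD d g) x y t).
Proof.
move=> df dg.
have -> : along d (fadd f g) x y t = along d f x y t + along d g x y t by case: d.
by apply: is_deriveD; apply: derivable_alongP.
Qed.

Lemma is_derive_fmul f g d x y t : derivable_along f -> derivable_along g ->
  is_derive (coordinate d x y t) 1 (along d (fmul f g) x y t)
    (fadd (fmul f (rD d g)) (fmul (rD d f) g) x y t).
Proof.
move=> df dg.
have -> : along d (fmul f g) x y t = along d f x y t * along d g x y t by case: d.
apply: is_derive_eq.
  by apply: is_deriveM; apply: derivable_alongP.
by rewrite !along_coordinate /fadd /fmul /GRing.scale /= [X in _ + X]mulrC.
Qed.

Lemma is_derive_finv f d x y t : (forall x y t, f x y t != 0) ->
  derivable_along f ->
  is_derive (coordinate d x y t) 1 (along d (finv f) x y t)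
    (fmul (fcst (-1)) (fmul (fmul (finv f) (finv f)) (rD d f)) x y t).
Proof.
move=> f0 df.
have -> : along d (finv f) x y t = (fun s => (along d f x y t s)^-1) by case: d.
apply: is_derive_eq.
  by apply: is_deriveV; [by case: d; apply: f0|apply: derivable_alongP].
by rewrite along_coordinate /fmul /fcst /finv /GRing.scale /= expr2 invfM; ring.
Qed.

Lemma is_derive_fcst c d x y t :
  is_derive (coordinate d x y t) 1 (along d (fcst c) x y t) (fcst 0 x y t).
Proof. by case: d; apply: is_derive_cst. Qed.

Lemma joint_continuousD f g :
  joint_continuous f -> joint_continuous g -> joint_continuous (fadd f g).
Proof. by move=> cf cg P; apply: cvgD; [apply: cf|apply: cg]. Qed.

Lemma joint_continuousM f g :
  joint_continuous f -> joint_continuous g -> joint_continuous (fmul f g).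
Proof. by move=> cf cg P; apply: cvgM; [apply: cf|apply: cg]. Qed.

Lemma joint_continuousV f : (forall x y t, f x y t != 0) ->
  joint_continuous f -> joint_continuous (finv f).
Proof. by move=> f0 cf P; apply: cvgV; [apply: f0|apply: cf]. Qed.

Lemma joint_continuous_cst c : joint_continuous (fcst c).
Proof. by move=> P; apply: cvg_cst. Qed.

(** Reduces each closure property of [Ck] to naming the partial derivatives and finding them in
    [Ck k]. *)
Lemma Ck_intro k f (g : dir -> R -> R -> R -> R) : joint_continuous f ->
  (forall d x y t, is_derive (coordinate d x y t) 1 (along d f x y t) (g d x y t)) ->
  (forall d, Ck k (g d)) -> Ck k.+1 f.
Proof.
move=> cf df Cg; apply: CkS; [exact: cf|by split=> d x y t; case: (df d x y t)|].
move=> d; suff -> : rD d f = g d by exact: Cg.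
by apply/funext => x; apply/funext => y; apply/funext => t; apply: rD_is_derive.
Qed.

Lemma Ck_cst k c : Ck k (fcst c).
Proof.
elim: k c => [|k IH] c; first exact/Ck0/joint_continuous_cst.
apply: (@Ck_intro _ _ (fun=> fcst 0)) => //; first exact: joint_continuous_cst.
by move=> d x y t; apply: is_derive_fcst.
Qed.

Lemma CkD k f g : Ck k f -> Ck k g -> Ck k (fadd f g).
Proof.
elim: k f g => [|k IH] f g Cf Cg.
  by apply: Ck0; apply: joint_continuousD; [apply: Ck_cont Cf|apply: Ck_cont Cg].
apply: (@Ck_intro _ _ (fun d => fadd (rD d f) (rD d g))).
- by apply: joint_continuousD; [apply: Ck_cont Cf|apply: Ck_cont Cg].
- by move=> d x y t; apply: is_derive_fadd;
    [apply: CkS_derivable Cf|apply: CkS_derivable Cg].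
- by move=> d; apply: IH; apply: CkS_rD.
Qed.

Lemma CkM k f g : Ck k f -> Ck k g -> Ck k (fmul f g).
Proof.
elim: k f g => [|k IH] f g Cf Cg.
  by apply: Ck0; apply: joint_continuousM; [apply: Ck_cont Cf|apply: Ck_cont Cg].
apply: (@Ck_intro _ _ (fun d => fadd (fmul f (rD d g)) (fmul (rD d f) g))).
- by apply: joint_continuousM; [apply: Ck_cont Cf|apply: Ck_cont Cg].
- by move=> d x y t; apply: is_derive_fmul;
    [apply: CkS_derivable Cf|apply: CkS_derivable Cg].
- by move=> d; apply: CkD; apply: IH; first [exact: CkW | exact: CkS_rD].
Qed.

Lemma CkV k f : (forall x y t, f x y t != 0) -> Ck k f -> Ck k (finv f).
Proof.
move=> f0; elim: k => [|k IH] Cf.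
  by apply: Ck0; apply: joint_continuousV => //; apply: Ck_cont Cf.
apply: (@Ck_intro _ _
  (fun d => fmul (fcst (-1)) (fmul (fmul (finv f) (finv f)) (rD d f)))).
- by apply: joint_continuousV => //; apply: Ck_cont Cf.
- by move=> d x y t; apply: is_derive_finv => //; apply: CkS_derivable Cf.
- move=> d; have Cv : Ck k (finv f) by apply: IH; apply: CkW.
  by do !apply: CkM => //; [exact: Ck_cst|exact: CkS_rD].
Qed.

(* Smooth fields whose second order partial derivatives commute; asking for
   the latter here replaces Schwarz's theorem. *)
Definition rgood f :=
  (forall k, Ck k f) /\ (forall d d', rD d (rD d' f) = rD d' (rD d f)).

Lemma rgood_derivable f : rgood f -> derivable_along f.
Proof. by case=> /(_ 1%N) /CkS_derivable. Qed.

Lemma rgood_derivable2 f d : rgood f -> derivable_along (rD d f).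
Proof. by case=> /(_ 2%N) /(@CkS_rD _ _ d) /CkS_derivable. Qed.

Lemma funext3 (T : Type) (f g : R -> R -> R -> T) :
  (forall x y t, f x y t = g x y t) -> f = g.
Proof. by move=> fg; apply/funext=> x; apply/funext=> y; apply/funext=> t. Qed.

Lemma rD_fadd d f g : derivable_along f -> derivable_along g ->
  rD d (fadd f g) = fadd (rD d f) (rD d g).
Proof. by move=> df dg; apply: funext3 => x y t; apply/rD_is_derive/is_derive_fadd. Qed.

Lemma rD_fmul d f g : derivable_along f -> derivable_along g ->
  rD d (fmul f g) = fadd (fmul f (rD d g)) (fmul (rD d f) g).
Proof. by move=> df dg; apply: funext3 => x y t; apply/rD_is_derive/is_derive_fmul. Qed.

Lemma rD_finv d f : (forall x y t, f x y t != 0) -> derivable_along f ->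
  rD d (finv f) = fmul (fcst (-1)) (fmul (fmul (finv f) (finv f)) (rD d f)).
Proof. by move=> f0 df; apply: funext3 => x y t; apply/rD_is_derive/is_derive_finv. Qed.

Lemma rD_fcst d c : rD d (fcst c) = fcst 0.
Proof. by apply: funext3 => x y t; apply/rD_is_derive/is_derive_fcst. Qed.

Lemma derivable_alongD f g : derivable_along f -> derivable_along g ->
  derivable_along (fadd f g).
Proof. by move=> df dg; split=> d x y t; case: (is_derive_fadd d x y t df dg). Qed.

Lemma derivable_alongM f g : derivable_along f -> derivable_along g ->
  derivable_along (fmul f g).
Proof. by move=> df dg; split=> d x y t; case: (is_derive_fmul d x y t df dg). Qed.

Lemma derivable_alongV f : (forall x y t, f x y t != 0) -> derivable_along f ->
  derivable_along (finv f).
Proof. by move=> f0 df; split=> d x y t; case: (is_derive_finv d x y t f0 df). Qed.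

Lemma derivable_along_cst c : derivable_along (fcst c).
Proof. by split=> d x y t; case: (is_derive_fcst c d x y t). Qed.

Lemma rgood_cst c : rgood (fcst c).
Proof. by split=> [k|d d']; [exact: Ck_cst|rewrite !rD_fcst]. Qed.

Lemma rgoodD f g : rgood f -> rgood g -> rgood (fadd f g).
Proof.
move=> Gf Gg; split=> [k|d d']; first by apply: CkD; [case: Gf|case: Gg].
have [df dg] := (rgood_derivable Gf, rgood_derivable Gg).
have [df2 dg2] := (fun e => @rgood_derivable2 f e Gf, fun e => @rgood_derivable2 g e Gg).
by rewrite !(rD_fadd _ df dg) !(rD_fadd _ (df2 _) (dg2 _)) (proj2 Gf d) (proj2 Gg d).
Qed.

Lemma rgoodM f g : rgood f -> rgood g -> rgood (fmul f g).
Proof.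
move=> Gf Gg; split=> [k|d d']; first by apply: CkM; [case: Gf|case: Gg].
have [df dg] := (rgood_derivable Gf, rgood_derivable Gg).
have [df2 dg2] := (fun e => @rgood_derivable2 f e Gf, fun e => @rgood_derivable2 g e Gg).
have E d1 d2 : rD d1 (rD d2 (fmul f g)) =
    fadd (fadd (fmul f (rD d1 (rD d2 g))) (fmul (rD d1 f) (rD d2 g)))
         (fadd (fmul (rD d2 f) (rD d1 g)) (fmul (rD d1 (rD d2 f)) g)).
  rewrite (rD_fmul _ df dg) rD_fadd ?(rD_fmul _ df (dg2 _)) ?(rD_fmul _ (df2 _) dg) //.
    exact: derivable_alongM.
  exact: derivable_alongM.
rewrite !E (proj2 Gf d) (proj2 Gg d); apply: funext3 => x y t.
by rewrite /fadd /fmul; ring.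
Qed.

Lemma rgoodV f : (forall x y t, f x y t != 0) -> rgood f -> rgood (finv f).
Proof.
move=> f0 Gf; split=> [k|d d']; first by apply: CkV => //; case: Gf.
have [df df2] := (rgood_derivable Gf, fun e => @rgood_derivable2 f e Gf).
have dv := derivable_alongV f0 df.
have dvv := derivable_alongM dv dv.
have E d1 d2 : rD d1 (rD d2 (finv f)) =
    fadd (fmul (fcst (-1)) (fadd (fmul (fmul (finv f) (finv f)) (rD d1 (rD d2 f)))
      (fmul (fadd (fmul (finv f) (rD d1 (finv f))) (fmul (rD d1 (finv f)) (finv f)))
        (rD d2 f)))) (fmul (fcst 0) (fmul (fmul (finv f) (finv f)) (rD d2 f))).
  rewrite (rD_finv d2 f0 df).
  rewrite (rD_fmul _ (derivable_along_cst _) (derivable_alongM dvv (df2 d2))) rD_fcst.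
  by rewrite (rD_fmul _ dvv (df2 d2)) (rD_fmul _ dv dv).
rewrite !E !(rD_finv _ f0 df) (proj2 Gf d); apply: funext3 => x y t.
by rewrite /fadd /fmul /fcst; ring.
Qed.

Definition rlin (a b c : R) : R -> R -> R -> R :=
  fun x y t => a * x + b * y + c * t.

Definition rcoef (a b c : R) (d : dir) : R :=
  match d with dX => a | dY => b | dT => c end.

Lemma is_derive_rlin a b c d x y t :
  is_derive (coordinate d x y t) 1 (along d (rlin a b c) x y t) (rcoef a b c d).
Proof.
pose f : R -> R := rcoef a b c d \*: id.
pose g : R -> R := cst (rlin a b c x y t - rcoef a b c d * coordinate d x y t).
have -> : along d (rlin a b c) x y t = f + g.
  apply/funext => s; rewrite fctE /f /g /rlin.
  by case: d {f g} => /=; rewrite /GRing.scale /=; ring.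
by apply: is_derive_eq; rewrite /GRing.scale /= mulr1 addr0.
Qed.

Lemma is_derive_comp_rlin (h h' : R -> R) a b c d x y t :
  (forall s : R, is_derive s (1 : R) h (h' s)) ->
  is_derive (coordinate d x y t) 1
    (along d (fun x y t => h (rlin a b c x y t)) x y t)
    (fmul (fcst (rcoef a b c d)) (fun x y t => h' (rlin a b c x y t)) x y t).
Proof.
move=> dh.
have -> : along d (fun x y t => h (rlin a b c x y t)) x y t =
  h \o along d (rlin a b c) x y t by case: d.
have := is_derive1_comp (dh _) (is_derive_rlin a b c d x y t).
by rewrite along_coordinate mulrC.
Qed.

Lemma joint_continuous_comp_rlin (h : R -> R) a b c : continuous h ->
  joint_continuous (fun x y t => h (rlin a b c x y t)).
Proof.
move=> ch P; apply: (@continuous_comp _ _ _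
  (fun P : R * R * R => rlin a b c P.1.1 P.1.2 P.2) h); last exact: ch.
apply: cvgD; first apply: cvgD; apply: cvgM; try exact: cvg_cst.
- by apply: (@continuous_comp _ _ _ (@fst (R * R) R) fst); apply: cvg_fst.
- by apply: (@continuous_comp _ _ _ (@fst (R * R) R) snd);
    [apply: cvg_fst|apply: cvg_snd].
- exact: cvg_snd.
Qed.

(* [h n] stands for the n-th derivative of [h 0]. *)
Lemma rgood_comp_rlin (h : nat -> R -> R) a b c :
  (forall n, continuous (h n)) ->
  (forall n (s : R), is_derive s (1 : R) (h n) (h n.+1 s)) ->
  rgood (fun x y t => h 0%N (rlin a b c x y t)).
Proof.
move=> ch dh.
have DE n d : rD d (fun x y t => h n (rlin a b c x y t)) =
    fmul (fcst (rcoef a b c d)) (fun x y t => h n.+1 (rlin a b c x y t)).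
  by apply: funext3 => x y t; apply/rD_is_derive/is_derive_comp_rlin.
have dA n : derivable_along (fun x y t => h n (rlin a b c x y t)).
  by split=> d x y t; case: (is_derive_comp_rlin a b c d x y t (dh n)).
split=> [k|d d'].
  move: 0%N; elim: k => [|k IH] n.
    by apply: Ck0; apply: joint_continuous_comp_rlin.
  apply: CkS; [exact: joint_continuous_comp_rlin|exact: dA|].
  by move=> d; rewrite DE; apply: CkM; [exact: Ck_cst|exact: IH].
rewrite !DE !(rD_fmul _ (derivable_along_cst _) (dA _)) !rD_fcst !DE.
by apply: funext3 => x y t; rewrite /fadd /fmul /fcst; ring.
Qed.

Lemma rgood_expR_rlin a b c : rgood (fun x y t => expR (rlin a b c x y t)).
Proof.
by apply: (@rgood_comp_rlin (fun=> expR)) => n s; exact: continuous_expR.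
Qed.

Lemma rgood_trig_rlin (u v : R) a b c :
  rgood (fun x y t => u * cos (rlin a b c x y t) + v * sin (rlin a b c x y t)).
Proof.
(* Differentiation acts on the coefficients of u cos + v sin by a quarter turn, so the n-th
   derivative is given by the n-th iterate of [st]. *)
pose st (w : R * R) := (w.2, - w.1).
pose h n s := (iter n st (u, v)).1 * cos s + (iter n st (u, v)).2 * sin s.
apply: (@rgood_comp_rlin h) => n s.
  by apply: cvgD; apply: cvgM;
    [exact: cvg_cst|exact: continuous_cos|exact: cvg_cst|exact: continuous_sin].
rewrite /h /=; case: (iter n st (u, v)) => /= a' b'.
pose f : R -> R := a' \*: cos; pose g : R -> R := b' \*: sin.
have -> : (fun s => a' * cos s + b' * sin s) = f + g by [].
by apply: is_derive_eq; rewrite /GRing.scale /=; ring.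
Qed.

End RealFields.

(** * Complex fields, differentiated through their real and imaginary parts *)

Section ComplexFields.
Context {R : realType}.
Notation C := R[i].
Implicit Types f g : R -> R -> R -> C.

Definition reF f x y t := complex.Re (f x y t).
Definition imF f x y t := complex.Im (f x y t).

Definition cD (d : dir) f x y t : C :=
  rD d (reF f) x y t +i* rD d (imF f) x y t.

Definition cdiff f := derivable_along (reF f) /\ derivable_along (imF f).
Definition cgood f := rgood (reF f) /\ rgood (imF f).

Lemma cgood_diff f : cgood f -> cdiff f.
Proof. by case=> ? ?; split; apply: rgood_derivable. Qed.

Lemma cgood_diffD f d : cgood f -> cdiff (cD d f).
Proof. by case=> ? ?; split; apply: rgood_derivable2. Qed.

Lemma cD_comm f d d' : cgood f -> cD d (cD d' f) = cD d' (cD d f).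
Proof.
case=> [[_ hr] [_ hi]]; apply: funext3 => x y t.
by congr (_ +i* _); [have := hr d d'|have := hi d d'] => /(congr1 (fun k => k x y t)).
Qed.

Definition cadd f g x y t := f x y t + g x y t.
Definition cmul f g x y t := f x y t * g x y t.
Definition ccst (c : C) := fun _ _ _ : R => c.
Definition cconj f x y t := (f x y t)^*.
Definition cinv f x y t := (f x y t)^-1.

Lemma reF_add f g : reF (cadd f g) = fadd (reF f) (reF g).
Proof. by apply: funext3 => x y t; rewrite /reF /cadd raddfD. Qed.

Lemma imF_add f g : imF (cadd f g) = fadd (imF f) (imF g).
Proof. by apply: funext3 => x y t; rewrite /imF /cadd raddfD. Qed.

Lemma reF_mul f g : reF (cmul f g) =
  fadd (fmul (reF f) (reF g)) (fmul (fcst (-1)) (fmul (imF f) (imF g))).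
Proof.
apply: funext3 => x y t; rewrite /reF /imF /cmul /fadd /fmul /fcst.
by case: (f _ _ _) => a b; case: (g _ _ _) => c d /=; ring.
Qed.

Lemma imF_mul f g : imF (cmul f g) =
  fadd (fmul (reF f) (imF g)) (fmul (imF f) (reF g)).
Proof.
apply: funext3 => x y t; rewrite /reF /imF /cmul /fadd /fmul.
by case: (f _ _ _) => a b; case: (g _ _ _) => c d /=; ring.
Qed.

Lemma reF_cst c : reF (ccst c) = fcst (complex.Re c). Proof. by []. Qed.
Lemma imF_cst c : imF (ccst c) = fcst (complex.Im c). Proof. by []. Qed.

Lemma reF_conj f : reF (cconj f) = reF f.
Proof. by apply: funext3 => x y t; rewrite /reF /cconj; case: (f _ _ _). Qed.

Lemma imF_conj f : imF (cconj f) = fmul (fcst (-1)) (imF f).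
Proof.
apply: funext3 => x y t; rewrite /imF /cconj /fmul /fcst mulN1r.
by case: (f _ _ _).
Qed.

Lemma reF_inv f : reF (cinv f) = fmul (reF f)
  (finv (fadd (fmul (reF f) (reF f)) (fmul (imF f) (imF f)))).
Proof.
apply: funext3 => x y t; rewrite /reF /imF /cinv /fadd /fmul /finv -!expr2.
by case: (f _ _ _).
Qed.

Lemma imF_inv f : imF (cinv f) = fmul (fmul (fcst (-1)) (imF f))
  (finv (fadd (fmul (reF f) (reF f)) (fmul (imF f) (imF f)))).
Proof.
apply: funext3 => x y t; rewrite /reF /imF /cinv /fadd /fmul /finv /fcst -!expr2 mulN1r mulNr.
by case: (f _ _ _).
Qed.

Lemma cgood_cst c : cgood (ccst c).
Proof. by split; rewrite ?reF_cst ?imF_cst; apply: rgood_cst. Qed.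

Lemma cgood_add f g : cgood f -> cgood g -> cgood (cadd f g).
Proof. by move=> [? ?] [? ?]; split; rewrite ?reF_add ?imF_add; apply: rgoodD. Qed.

Lemma cgood_mul f g : cgood f -> cgood g -> cgood (cmul f g).
Proof.
move=> [? ?] [? ?]; split; rewrite ?reF_mul ?imF_mul; apply: rgoodD; apply: rgoodM => //.
- exact: rgood_cst.
- exact: rgoodM.
Qed.

Lemma cgood_conj f : cgood f -> cgood (cconj f).
Proof.
move=> [? ?]; split; rewrite ?reF_conj ?imF_conj //.
by apply: rgoodM => //; apply: rgood_cst.
Qed.

Lemma cgood_inv f : (forall x y t, f x y t != 0) -> cgood f -> cgood (cinv f).
Proof.
move=> f0 [gr gi].
have gn : rgood (finv (fadd (fmul (reF f) (reF f)) (fmul (imF f) (imF f)))).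
  apply: rgoodV; last by apply: rgoodD; apply: rgoodM.
  move=> x y t; have := f0 x y t; rewrite /fadd /fmul /reF /imF.
  case: (f x y t) => a b; rewrite eq_complex /= -!expr2 paddr_eq0 ?sqr_ge0 //.
  by rewrite !sqrf_eq0.
split; rewrite ?reF_inv ?imF_inv; first exact: rgoodM.
by apply: rgoodM => //; apply: rgoodM => //; apply: rgood_cst.
Qed.

Lemma cdiff_cst c : cdiff (ccst c).
Proof. exact/cgood_diff/cgood_cst. Qed.

Lemma cdiff_add f g : cdiff f -> cdiff g -> cdiff (cadd f g).
Proof. by move=> [? ?] [? ?]; split; rewrite ?reF_add ?imF_add; apply: derivable_alongD. Qed.

Lemma cdiff_mul f g : cdiff f -> cdiff g -> cdiff (cmul f g).
Proof.
move=> [? ?] [? ?]; split; rewrite ?reF_mul ?imF_mul; apply: derivable_alongD;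
  apply: derivable_alongM => //.
- exact: derivable_along_cst.
- exact: derivable_alongM.
Qed.

Lemma cdiff_conj f : cdiff f -> cdiff (cconj f).
Proof.
move=> [? ?]; split; rewrite ?reF_conj ?imF_conj //.
by apply: derivable_alongM => //; apply: derivable_along_cst.
Qed.

Lemma cD_cst d c x y t : cD d (ccst c) x y t = 0.
Proof. by rewrite /cD reF_cst imF_cst !rD_fcst. Qed.

Lemma cD_add d f g x y t : cdiff f -> cdiff g ->
  cD d (cadd f g) x y t = cD d f x y t + cD d g x y t.
Proof. by move=> [? ?] [? ?]; rewrite /cD reF_add imF_add !rD_fadd. Qed.

Lemma cD_mul d f g x y t : cdiff f -> cdiff g ->
  cD d (cmul f g) x y t = cD d f x y t * g x y t + f x y t * cD d g x y t.
Proof.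
move=> [fr fi] [gr gi]; have cN := derivable_along_cst (-1 : R).
have fg := derivable_alongM fi gi.
rewrite /cD reF_mul imF_mul (rD_fadd _ (derivable_alongM fr gr) (derivable_alongM cN fg)).
rewrite (rD_fadd _ (derivable_alongM fr gi) (derivable_alongM fi gr)).
rewrite !rD_fmul // rD_fcst /fadd /fmul /fcst /reF /imF.
case: (f x y t) (g x y t) => a b [c e] /=; apply/eqP.
by rewrite eq_complex /=; apply/andP; split; apply/eqP; ring.
Qed.

Lemma cD_conj d f x y t : cdiff f -> cD d (cconj f) x y t = (cD d f x y t)^*.
Proof.
move=> [fr fi]; rewrite /cD reF_conj imF_conj rD_fmul //; last exact: derivable_along_cst.
by rewrite rD_fcst /fadd /fmul /fcst mul0r addr0 mulN1r.
Qed.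

Definition clin (a b c : C) : R -> R -> R -> C :=
  fun x y t => a * x%:C + b * y%:C + c * t%:C.

Definition ccoef (a b c : C) (d : dir) : C :=
  match d with dX => a | dY => b | dT => c end.

Definition cexplin a b c : R -> R -> R -> C := fun x y t => cexp (clin a b c x y t).

Let expre (a b c : C) : R -> R -> R -> R :=
  fun x y t => expR (rlin (complex.Re a) (complex.Re b) (complex.Re c) x y t).
Let trig (u v : R) (a b c : C) : R -> R -> R -> R := fun x y t =>
  u * cos (rlin (complex.Im a) (complex.Im b) (complex.Im c) x y t)
  + v * sin (rlin (complex.Im a) (complex.Im b) (complex.Im c) x y t).

Lemma clinE a b c x y t : clin a b c x y t =
  rlin (complex.Re a) (complex.Re b) (complex.Re c) x y t
  +i* rlin (complex.Im a) (complex.Im b) (complex.Im c) x y t.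
Proof.
rewrite /clin /rlin; case: a b c => [a a'] [b b'] [c c'] /=.
by apply/eqP; rewrite eq_complex /=; apply/andP; split; apply/eqP; ring.
Qed.

Lemma reF_cexplin a b c : reF (cexplin a b c) = fmul (expre a b c) (trig 1 0 a b c).
Proof.
apply: funext3 => x y t.
by rewrite /reF /cexplin clinE /cexp /= /fmul /trig mul1r mul0r addr0.
Qed.

Lemma imF_cexplin a b c : imF (cexplin a b c) = fmul (expre a b c) (trig 0 1 a b c).
Proof.
apply: funext3 => x y t.
by rewrite /imF /cexplin clinE /cexp /= /fmul /trig mul1r mul0r add0r.
Qed.

Lemma cgood_cexplin a b c : cgood (cexplin a b c).
Proof.
by split; rewrite ?reF_cexplin ?imF_cexplin; apply: rgoodM;
  first [exact: rgood_expR_rlin | exact: rgood_trig_rlin].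
Qed.

Lemma rD_expre d a b c : rD d (expre a b c) =
  fmul (fcst (complex.Re (ccoef a b c d))) (expre a b c).
Proof.
apply: funext3 => x y t; apply: rD_is_derive.
have := is_derive_comp_rlin (complex.Re a) (complex.Re b) (complex.Re c) d x y t
  (@is_derive_expR R).
by case: (d).
Qed.

Lemma rD_trig d u v a b c : rD d (trig u v a b c) =
  fmul (fcst (complex.Im (ccoef a b c d))) (trig v (- u) a b c).
Proof.
apply: funext3 => x y t; apply: rD_is_derive.
have dh (s : R) : is_derive s (1 : R) (fun s => u * cos s + v * sin s)
    (v * cos s + - u * sin s).
  pose f : R -> R := u \*: cos; pose g : R -> R := v \*: sin.
  have -> : (fun s => u * cos s + v * sin s) = f + g by [].
  by apply: is_derive_eq; rewrite /GRing.scale /=; ring.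
have := is_derive_comp_rlin (complex.Im a) (complex.Im b) (complex.Im c) d x y t dh.
by case: (d).
Qed.

Lemma cD_cexplin d a b c x y t :
  cD d (cexplin a b c) x y t = ccoef a b c d * cexplin a b c x y t.
Proof.
have dE : derivable_along (expre a b c) by apply/rgood_derivable/rgood_expR_rlin.
have dT u v : derivable_along (trig u v a b c) by apply/rgood_derivable/rgood_trig_rlin.
rewrite /cD reF_cexplin imF_cexplin !rD_fmul // !rD_expre !rD_trig.
have -> : cexplin a b c x y t = reF (cexplin a b c) x y t +i* imF (cexplin a b c) x y t.
  by rewrite /reF /imF; case: (cexplin _ _ _ _ _ _).
rewrite reF_cexplin imF_cexplin /fadd /fmul /fcst /trig /expre.
case: (ccoef a b c d) => k k' /=.
by apply/eqP; rewrite eq_complex /=; apply/andP; split; apply/eqP; ring.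
Qed.

End ComplexFields.

(** * Matrix fields and directional derivatives *)

Section MatrixFields.
Context {R : realType}.
Notation C := R[i].

(** The direction has complex coefficients because the operators z d_x - d_u and z d_v - d_x do. *)
Definition vD (xi : dir -> C) (f : R -> R -> R -> C) x y t : C :=
  xi dX * cD dX f x y t + xi dY * cD dY f x y t + xi dT * cD dT f x y t.

Section Ops.
Variable xi : dir -> C.
Implicit Types f g : R -> R -> R -> C.

Lemma vD_cst c x y t : vD xi (ccst c) x y t = 0.
Proof. by rewrite /vD !cD_cst; ring. Qed.

Lemma vD_add f g x y t : cdiff f -> cdiff g ->
  vD xi (cadd f g) x y t = vD xi f x y t + vD xi g x y t.
Proof.
move=> df dg; rewrite /vD !(cD_add _ _ _ _ df dg).
by move: (cD dX f x y t) (cD dX g x y t) (cD dY f x y t) (cD dY g x y t)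
  (cD dT f x y t) (cD dT g x y t) => *; ring.
Qed.

Lemma vD_mul f g x y t : cdiff f -> cdiff g ->
  vD xi (cmul f g) x y t = vD xi f x y t * g x y t + f x y t * vD xi g x y t.
Proof.
move=> df dg; rewrite /vD !(cD_mul _ _ _ _ df dg).
by move: (cD dX f x y t) (cD dX g x y t) (cD dY f x y t) (cD dY g x y t)
  (cD dT f x y t) (cD dT g x y t) => *; ring.
Qed.

Lemma vD_conj f x y t : cdiff f ->
  vD xi (cconj f) x y t = (vD (fun d => (xi d)^*) f x y t)^*.
Proof. 
move=> df; rewrite /vD !(cD_conj _ _ _ _ df).
move: (cD dX f x y t) (cD dY f x y t) (cD dT f x y t) => a b c.
by rewrite !rmorphD !rmorphM /= !conjCK.
 Qed.

Lemma cdiff_sum (I : Type) (r : seq I) (f : I -> R -> R -> R -> C) :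
  (forall i, cdiff (f i)) -> cdiff (fun x y t => \sum_(i <- r) f i x y t).
Proof.
move=> df; elim: r => [|i r IH].
  suff -> : (fun x y t => \sum_(i <- [::]) f i x y t) = ccst 0 by exact: cdiff_cst.
  by apply: funext3 => x y t; rewrite big_nil.
suff -> : (fun x y t => \sum_(j <- i :: r) f j x y t) =
  cadd (f i) (fun x y t => \sum_(j <- r) f j x y t) by exact: cdiff_add.
by apply: funext3 => x y t; rewrite big_cons.
Qed.

Lemma cgood_sum (I : Type) (r : seq I) (f : I -> R -> R -> R -> C) :
  (forall i, cgood (f i)) -> cgood (fun x y t => \sum_(i <- r) f i x y t).
Proof.
move=> df; elim: r => [|i r IH].
  suff -> : (fun x y t => \sum_(i <- [::]) f i x y t) = ccst 0 by exact: cgood_cst.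
  by apply: funext3 => x y t; rewrite big_nil.
suff -> : (fun x y t => \sum_(j <- i :: r) f j x y t) =
  cadd (f i) (fun x y t => \sum_(j <- r) f j x y t) by exact: cgood_add.
by apply: funext3 => x y t; rewrite big_cons.
Qed.

Lemma vD_sum (I : Type) (r : seq I) (f : I -> R -> R -> R -> C) x y t :
  (forall i, cdiff (f i)) ->
  vD xi (fun x y t => \sum_(i <- r) f i x y t) x y t = \sum_(i <- r) vD xi (f i) x y t.
Proof.
move=> df; elim: r => [|i r IH].
  rewrite big_nil; suff -> : (fun x y t => \sum_(i <- [::]) f i x y t) = ccst 0.
    exact: vD_cst.
  by apply: funext3 => x' y' t'; rewrite big_nil.
rewrite big_cons -IH -vD_add //; last exact: cdiff_sum.
congr (vD xi _ x y t).
by apply: funext3 => x' y' t'; rewrite big_cons.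
Qed.

End Ops.

Definition ent m n (F : R -> R -> R -> 'M[C]_(m, n)) i j : R -> R -> R -> C :=
  fun x y t => F x y t i j.

Definition mD m n (xi : dir -> C) (F : R -> R -> R -> 'M[C]_(m, n)) x y t : 'M[C]_(m, n) :=
  \matrix_(i, j) vD xi (ent F i j) x y t.

Definition mdiff m n (F : R -> R -> R -> 'M[C]_(m, n)) := forall i j, cdiff (ent F i j).
Definition mgood m n (F : R -> R -> R -> 'M[C]_(m, n)) := forall i j, cgood (ent F i j).

Definition madd m n (F G : R -> R -> R -> 'M[C]_(m, n)) x y t := F x y t + G x y t.
Definition mmul m n p (F : R -> R -> R -> 'M[C]_(m, n)) (G : R -> R -> R -> 'M[C]_(n, p))
  x y t := F x y t *m G x y t.
Definition mscale m n (f : R -> R -> R -> C) (G : R -> R -> R -> 'M[C]_(m, n))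
  x y t := f x y t *: G x y t.
Definition madj m n (F : R -> R -> R -> 'M[C]_(m, n)) x y t := (F x y t)^t*.
Definition mcst m n (A : 'M[C]_(m, n)) := fun _ _ _ : R => A.

Section MOps.
Variables m n : nat.
Implicit Types F G : R -> R -> R -> 'M[C]_(m, n).

Lemma ent_add F G i j : ent (madd F G) i j = cadd (ent F i j) (ent G i j).
Proof. by apply: funext3 => x y t; rewrite /ent /madd mxE. Qed.

Lemma ent_scale f F i j : ent (mscale f F) i j = cmul f (ent F i j).
Proof. by apply: funext3 => x y t; rewrite /ent /mscale mxE. Qed.

Lemma ent_adj F i j : ent (madj F) i j = cconj (ent F j i).
Proof. by apply: funext3 => x y t; rewrite /ent /madj !mxE. Qed.

Lemma ent_cst (A : 'M[C]_(m, n)) i j : ent (mcst A) i j = ccst (A i j).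
Proof. by []. Qed.

Lemma ent_mul p F (G : R -> R -> R -> 'M[C]_(n, p)) i j :
  ent (mmul F G) i j =
  (fun x y t => \sum_k cmul (ent F i k) (ent G k j) x y t).
Proof. by apply: funext3 => x y t; rewrite /ent /mmul mxE. Qed.

Lemma mgood_diff F : mgood F -> mdiff F.
Proof. by move=> gF i j; apply: cgood_diff. Qed.

Lemma mgood_cst (A : 'M[C]_(m, n)) : mgood (mcst A).
Proof. by move=> i j; rewrite ent_cst; apply: cgood_cst. Qed.
Lemma mgood_add F G : mgood F -> mgood G -> mgood (madd F G).
Proof. by move=> dF dG i j; rewrite ent_add; apply: cgood_add. Qed.
Lemma mgood_scale f F : cgood f -> mgood F -> mgood (mscale f F).
Proof. by move=> df dF i j; rewrite ent_scale; apply: cgood_mul. Qed.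
Lemma mgood_adj F : mgood F -> mgood (madj F).
Proof. by move=> dF i j; rewrite ent_adj; apply: cgood_conj. Qed.
Lemma mgood_mul p F (G : R -> R -> R -> 'M[C]_(n, p)) :
  mgood F -> mgood G -> mgood (mmul F G).
Proof. by move=> dF dG i j; rewrite ent_mul; apply: cgood_sum => k; apply: cgood_mul. Qed.

Lemma mdiff_add F G : mdiff F -> mdiff G -> mdiff (madd F G).
Proof. by move=> dF dG i j; rewrite ent_add; apply: cdiff_add. Qed.
Lemma mdiff_scale f F : cdiff f -> mdiff F -> mdiff (mscale f F).
Proof. by move=> df dF i j; rewrite ent_scale; apply: cdiff_mul. Qed.
Lemma mdiff_adj F : mdiff F -> mdiff (madj F).
Proof. by move=> dF i j; rewrite ent_adj; apply: cdiff_conj. Qed.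
Lemma mdiff_mul p F (G : R -> R -> R -> 'M[C]_(n, p)) :
  mdiff F -> mdiff G -> mdiff (mmul F G).
Proof. by move=> dF dG i j; rewrite ent_mul; apply: cdiff_sum => k; apply: cdiff_mul. Qed.

Lemma mD_cst xi (A : 'M[C]_(m, n)) x y t : mD xi (mcst A) x y t = 0.
Proof. by apply/matrixP => i j; rewrite !mxE ent_cst vD_cst. Qed.

Lemma mD_add xi F G x y t : mdiff F -> mdiff G ->
  mD xi (madd F G) x y t = mD xi F x y t + mD xi G x y t.
Proof. by move=> dF dG; apply/matrixP => i j; rewrite !mxE ent_add vD_add. Qed.

Lemma mD_scale xi f F x y t : cdiff f -> mdiff F ->
  mD xi (mscale f F) x y t = vD xi f x y t *: F x y t + f x y t *: mD xi F x y t.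
Proof. by move=> df dF; apply/matrixP => i j; rewrite !mxE ent_scale vD_mul. Qed.

(** The direction is conjugated along with the field; this is the origin of the terms in z - z^*
    below. *)
Lemma mD_adj xi F x y t : mdiff F ->
  mD xi (madj F) x y t = (mD (fun d => (xi d)^*) F x y t)^t*.
Proof. by move=> dF; apply/matrixP => i j; rewrite !mxE ent_adj vD_conj. Qed.

Lemma mD_mul xi p F (G : R -> R -> R -> 'M[C]_(n, p)) x y t : mdiff F -> mdiff G ->
  mD xi (mmul F G) x y t = mD xi F x y t *m G x y t + F x y t *m mD xi G x y t.
Proof.
move=> dF dG; apply/matrixP => i j; rewrite !mxE ent_mul vD_sum; last first.
  by move=> k; apply: cdiff_mul.
by rewrite -big_split; apply: eq_bigr => k _ /=; rewrite vD_mul // !mxE.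
Qed.

Lemma mdiff_mD xi F : mgood F -> mdiff (mD xi F).
Proof.
move=> gF i j.
suff -> : ent (mD xi F) i j = cadd (cadd (cmul (ccst (xi dX)) (cD dX (ent F i j)))
    (cmul (ccst (xi dY)) (cD dY (ent F i j)))) (cmul (ccst (xi dT)) (cD dT (ent F i j))).
  by do ?apply: cdiff_add; apply: cdiff_mul; first [exact: cdiff_cst|exact: cgood_diffD].
by apply: funext3 => x y t; rewrite /ent /mD mxE.
Qed.

(** Both directions are constant, so the claim reduces to the commuting partial derivatives
    contained in [cgood]. *)
Lemma mD_comm xi eta F : mgood F -> mD xi (mD eta F) = mD eta (mD xi F).
Proof.
move=> gF; apply: funext3 => x y t; apply/matrixP => i j; rewrite !mxE.
have cE (b c e : C) (f g h : R -> R -> R -> C) d : cdiff f -> cdiff g -> cdiff h ->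
    cD d (fun x y t => b * f x y t + c * g x y t + e * h x y t) x y t =
    b * cD d f x y t + c * cD d g x y t + e * cD d h x y t.
  move=> df dg dh.
  have dm k (q : R -> R -> R -> C) : cdiff q -> cdiff (cmul (ccst k) q).
    by move=> dq; apply: cdiff_mul => //; apply: cdiff_cst.
  rewrite -[X in cD d X]/(cadd (cadd (cmul (ccst b) f) (cmul (ccst c) g)) (cmul (ccst e) h)).
  rewrite !cD_add ?cD_mul ?cD_cst ?mul0r ?add0r //; try exact: cdiff_cst; try exact: dm.
  by apply: cdiff_add; apply: dm.
have entE z : ent (mD z F) i j = (fun x y t => z dX * cD dX (ent F i j) x y t
    + z dY * cD dY (ent F i j) x y t + z dT * cD dT (ent F i j) x y t).
  by apply: funext3 => ? ? ?; rewrite /ent mxE.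
have dd d := cgood_diffD d (gF i j).
rewrite /vD !entE !cE // (cD_comm dY dX) // (cD_comm dT dX) // (cD_comm dT dY) //.
move: (cD dX (cD dX _) x y t) (cD dX (cD dY _) x y t) (cD dX (cD dT _) x y t)
  (cD dY (cD dY _) x y t) (cD dY (cD dT _) x y t) (cD dT (cD dT _) x y t) => *.
by ring.
Qed.

Lemma mD_lin (b c : C) xi eta F x y t :
  mD (fun d => b * xi d + c * eta d) F x y t = b *: mD xi F x y t + c *: mD eta F x y t.
Proof.
apply/matrixP => i j; rewrite !mxE /vD.
by move: (cD dX _ x y t) (cD dY _ x y t) (cD dT _ x y t) => *; ring.
Qed.

End MOps.

Lemma mgood_line_proj n (Q : R -> R -> R -> 'cV[C]_n) :
  (forall x y t, Q x y t != 0) -> mgood Q -> mgood (fun x y t => line_proj (Q x y t)).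
Proof.
move=> Q0 gQ.
apply: (@mgood_scale _ _ (cinv (ent (mmul (madj Q) Q) 0 0)) (mmul Q (madj Q))).
  apply: cgood_inv; last by apply: mgood_mul => //; apply: mgood_adj.
  by move=> x y t; rewrite -[ent _ _ _ _ _ _]/(sqn (Q x y t)) sqn_eq0.
by apply: mgood_mul => //; apply: mgood_adj.
Qed.

End MatrixFields.

(** * One Bäcklund step for one Lax operator *)

Section DressingStep.
Context {R : realType} {n : nat}.
Notation C := R[i].
Implicit Types (A B J : R -> R -> R -> 'M[C]_n) (Q : R -> R -> R -> 'cV[C]_n).

(** The direction of lam d_xi - d_eta. The choices (x, u) and (v, x) for (xi, eta) give the two
    halves of the Lax pair, so each lemma here is used twice. *)
Definition lax (lam : C) (xi eta : dir -> C) : dir -> C :=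
  fun d => lam * xi d + (-1) * eta d.

Lemma mD_lax lam xi eta m p (F : R -> R -> R -> 'M[C]_(m, p)) x y t :
  mD (lax lam xi eta) F x y t = lam *: mD xi F x y t - mD eta F x y t.
Proof. by rewrite mD_lin scaleN1r. Qed.

Variables (xi eta : dir -> C).
Hypotheses (xi_real : forall d, (xi d)^* = xi d) (eta_real : forall d, (eta d)^* = eta d).
Variables (z : C) (A : R -> R -> R -> 'M[C]_n) (Q : R -> R -> R -> 'cV[C]_n).
Hypotheses (A_skew : forall x y t, (A x y t)^t* = - A x y t)
  (Q_neq0 : forall x y t, Q x y t != 0) (Q_good : mgood Q)
  (Q_lax : forall x y t, mD (lax z xi eta) Q x y t = A x y t *m Q x y t).

Variable P : R -> R -> R -> 'M[C]_n.
Hypothesis P_def : forall x y t, P x y t = line_proj (Q x y t).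

Let P_adj x y t : (P x y t)^t* = P x y t.
Proof. by rewrite P_def line_proj_adj. Qed.

Let dP : mdiff P.
Proof. by rewrite (funext3 P_def); apply/mgood_diff/mgood_line_proj. Qed.

Let mD_herm (zeta : dir -> C) x y t : (forall d, (zeta d)^* = zeta d) ->
  (mD zeta P x y t)^t* = mD zeta P x y t.
Proof.
move=> hz.
have {1}-> : P = madj P by apply: funext3 => ? ? ?; rewrite /madj P_adj.
rewrite mD_adj // adjK; congr (mD _ P x y t).
by apply/funext => d; rewrite hz.
Qed.

Let mD_idem zeta x y t :
  mD zeta P x y t = mD zeta P x y t *m P x y t + P x y t *m mD zeta P x y t.
Proof.
rewrite -mD_mul //; congr (mD zeta _ x y t).
by apply: funext3 => ? ? ?; rewrite /mmul !P_def line_proj_idem.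
Qed.

(* Differentiating [P Q = Q] gives the part of [L P] right of [P]; its adjoint
   gives the part left of [P] up to [(L - L^* ) P = (z - z^* ) D_xi P]. *)
Lemma dressing_identity x y t : mD (lax z xi eta) P x y t =
  A x y t *m P x y t - P x y t *m A x y t
  + (z - z^*) *: (P x y t *m mD xi P x y t).
Proof.
have PDP : mD (lax z xi eta) P x y t *m P x y t =
    A x y t *m P x y t - P x y t *m A x y t *m P x y t.
  have : mD (lax z xi eta) Q x y t = mD (lax z xi eta) P x y t *m Q x y t
      + P x y t *m mD (lax z xi eta) Q x y t.
    rewrite -mD_mul //; last exact: mgood_diff.
    by congr (mD _ _ x y t); apply: funext3 => ? ? ?; rewrite /mmul P_def line_proj_id.
  rewrite Q_lax => /eqP; rewrite -subr_eq => /eqP DQ.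
  (* [P] is [Q] times a row vector; multiplying [DQ] by that row turns an identity on [Q] into one
     on [P]. *)
  have PE : P x y t = Q x y t *m ((sqn (Q x y t))^-1 *: (Q x y t)^t*).
    by rewrite P_def line_projE.
  rewrite {1 2 4}PE !mulmxA -DQ -mulmxBl.
  by rewrite !mulmxA.
have PDP' : P x y t *m (z^* *: mD xi P x y t - mD eta P x y t) =
    - (P x y t *m A x y t) + P x y t *m A x y t *m P x y t.
  move/(congr1 (fun M => M^t*)): PDP.
  rewrite mD_lax !(adjM, adjD, adjN, adjZ) !mD_herm // A_skew !P_adj => ->.
  by rewrite mulmxN mulNmx mulmxN opprK mulmxA.
have -> : mD (lax z xi eta) P x y t = mD (lax z xi eta) P x y t *m P x y t
    + P x y t *m mD (lax z xi eta) P x y t by exact: mD_idem.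
rewrite PDP mD_lax.
(* In the summand with [P] on the left, z is traded for z^* so that the adjoint identity [PDP']
   applies. *)
have -> : z *: mD xi P x y t - mD eta P x y t =
    (z^* *: mD xi P x y t - mD eta P x y t) + (z - z^*) *: mD xi P x y t.
  by rewrite scalerBl [RHS]addrC addrA subrK.
rewrite mulmxDr PDP' -scalemxAr addrA; congr (_ + _).
by rewrite [- _ + _]addrC addrA subrK.
Qed.

Definition dressed x y t : 'M[C]_n := A x y t + (z^* - z) *: mD xi P x y t.

Lemma dressed_skew x y t : (dressed x y t)^t* = - dressed x y t.
Proof.
rewrite /dressed adjD adjZ A_skew mD_herm // rmorphB /= conjCK opprD.
by rewrite -scaleNr opprB.
Qed.

Lemma dressed_lax lam (Q' : R -> R -> R -> 'cV[C]_n) x y t : lam != z^* ->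
  mdiff Q' -> mD (lax lam xi eta) Q' x y t = A x y t *m Q' x y t ->
  mD (lax lam xi eta) (fun x y t => h_factor z (P x y t) lam *m Q' x y t) x y t
  = dressed x y t *m (h_factor z (P x y t) lam *m Q' x y t).
Proof.
move=> lz dQ' hQ'; set nu := (z^* - z) / (lam - z^*).
have -> : (fun x y t => h_factor z (P x y t) lam *m Q' x y t) =
    madd Q' (mscale (ccst nu) (mmul P Q')).
  apply: funext3 => x' y' t'.
  by rewrite h_factorE // /madd /mscale /ccst /mmul mulmxDl mul1mx scalemxAl.
rewrite mD_add ?mD_scale ?mD_mul ?vD_cst ?scale0r ?add0r //; first 1 last.
- exact: cdiff_cst.
- exact: mdiff_mul.
- by apply: mdiff_scale; [exact: cdiff_cst|exact: mdiff_mul].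
rewrite h_factorE // -/nu hQ' /ccst.
(* The operators at [lam] and at [z] differ by a multiple of d_xi, so the identity at [z] serves for
   every [lam]. *)
have -> : mD (lax lam xi eta) P x y t =
    mD (lax z xi eta) P x y t + (lam - z) *: mD xi P x y t.
  by rewrite !mD_lax addrAC -scalerDl [z + _]addrC subrK.
rewrite dressing_identity /dressed.
have := mD_idem xi x y t; move: (mD xi P x y t) (P x y t) (A x y t) (Q' x y t).
move=> X p a q XE.
have {}XE : X *m p *m q = X *m q - p *m X *m q by rewrite {2}XE mulmxDl addrK.
rewrite !(mulmxDl, mulmxDr, mulNmx, mulmxN, mul1mx).
do ?rewrite -?scalemxAl -?scalemxAr ?mulmxA.
rewrite XE.
move: (a *m p *m q) (p *m a *m q) (p *m X *m q) (X *m q) (a *m q) => m1 m2 m3 m4 m5.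
(* This relation matches the coefficients of the terms in the xi-derivative of [P], and fixes the
   constant z^* - z in [dressed]. *)
have nuE : nu * (lam - z) = (z^* - z) * (1 + nu).
  by rewrite /nu; rewrite -subr_eq0 in lz; field.
apply/matrixP => i j; rewrite !mxE.
move: (m1 i j) (m2 i j) (m3 i j) (m4 i j) (m5 i j) => {}m1 {}m2 {}m3 {}m4 {}m5.
move: nuE; move: (z^*) (nu) => zs k kE.
transitivity (m5 + k * (m1 + (z - zs) * m3) + (k * (lam - z)) * m4); first by ring.
by rewrite kE; ring.
Qed.

(** The matrix multiplying [J] is inverse to [h_factor z P 0], so this is the Lax equation at lambda
    = 0 read on J = psi(0)^-1. It is checked on [J] directly, and psi(0) need not be followed. *)
Lemma dressed_log J c x y t : z != 0 -> mdiff J ->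
  mD eta J x y t = J x y t *m A x y t ->
  mD eta (fun x y t => c *: (J x y t *m ((z^* / z) *: P x y t + (1%:M - P x y t)))) x y t
  = (c *: (J x y t *m ((z^* / z) *: P x y t + (1%:M - P x y t)))) *m dressed x y t.
Proof.
move=> z0 dJ hJ; set k := (z^* - z) / z.
have KE x' y' t' : (z^* / z) *: P x' y' t' + (1%:M - P x' y' t') = 1%:M + k *: P x' y' t'.
  rewrite addrCA; congr (_ + _); rewrite -scaleN1r -scalerDl; congr (_ *: _).
  by rewrite /k; field.
have -> : (fun x y t => c *: (J x y t *m ((z^* / z) *: P x y t + (1%:M - P x y t)))) =
    mscale (ccst c) (madd J (mscale (ccst k) (mmul J P))).
  apply: funext3 => x' y' t'; rewrite KE.
  by rewrite /mscale /madd /mmul /ccst mulmxDr mulmx1 -scalemxAr.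
have dJP := mdiff_mul dJ dP.
have dkJP : mdiff (mscale (ccst k) (mmul J P)).
  by apply: mdiff_scale => //; apply: cdiff_cst.
rewrite mD_scale ?vD_cst ?scale0r ?add0r //; [|exact: cdiff_cst|exact: mdiff_add].
rewrite mD_add // mD_scale ?vD_cst ?scale0r ?add0r //; last exact: cdiff_cst.
rewrite mD_mul // hJ KE /ccst -scalemxAl; congr (_ *: _).
have := dressing_identity x y t; rewrite mD_lax /dressed.
move: (mD xi P x y t) (mD eta P x y t) (P x y t) (A x y t) (J x y t).
move=> X Y p a j /eqP; rewrite subr_eq => /eqP YE.
have {}YE : Y = z *: X - (a *m p - p *m a + (z - z^*) *: (p *m X)) by rewrite YE addrC addKr.
rewrite {}YE.
rewrite !(mulmxDl, mulmxDr, mulNmx, mulmxN, mul1mx, mulmx1, opprD).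
do ?rewrite -?scalemxAl -?scalemxAr ?mulmxA ?mulmxN.
have kE : k * z = z^* - z by rewrite /k; field.
move: (j *m a) (j *m p *m X) (j *m a *m p) (j *m p *m a) (j *m X) => m1 m2 m3 m4 m5.
apply/matrixP => i i'; rewrite !mxE.
move: (m1 i i') (m2 i i') (m3 i i') (m4 i i') (m5 i i') => {}m1 {}m2 {}m3 {}m4 {}m5.
move: kE; move: (z^*) (k) => zs l kE.
transitivity (m1 + l * m4 + (l * z) * m5 - l * (z - zs) * m2); first by ring.
by rewrite kE; ring.
Qed.

End DressingStep.

(** * From the Lax pair to the Ward equation, and the iteration *)

Section WardFromLax.
Context {R : realType} {n : nat}.
Notation C := R[i].
Implicit Types (A B J : R -> R -> R -> 'M[C]_n).

Definition eX : dir -> C := ccoef 1 0 0.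
Definition eY : dir -> C := ccoef 0 1 0.
Definition eT : dir -> C := ccoef 0 0 1.
(* Since t = u + v and y = u - v, d/du = d/dt + d/dy and d/dv = d/dt - d/dy. *)
Definition eU : dir -> C := ccoef 0 1 1.
Definition eV : dir -> C := ccoef 0 (-1) 1.

Lemma DxE J : Dx J = mD eX J.
Proof.
apply: funext3 => x y t; apply/matrixP => i j; rewrite !mxE /vD /eX /ccoef.
by rewrite mul1r !mul0r !addr0.
Qed.

Lemma DyE J : Dy J = mD eY J.
Proof.
apply: funext3 => x y t; apply/matrixP => i j; rewrite !mxE /vD /eY /ccoef.
by rewrite mul1r !mul0r add0r addr0.
Qed.

Lemma DtE J : Dt J = mD eT J.
Proof.
apply: funext3 => x y t; apply/matrixP => i j; rewrite !mxE /vD /eT /ccoef.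
by rewrite mul1r !mul0r !add0r.
Qed.

Lemma mD_eU J x y t : mD eU J x y t = mD eT J x y t + mD eY J x y t.
Proof.
have -> : eU = (fun d => 1 * eT d + 1 * eY d).
  by apply/funext; case; rewrite /eU /eT /eY /= !mul1r ?addr0 ?add0r.
by rewrite mD_lin !scale1r.
Qed.

Lemma mD_eV J x y t : mD eV J x y t = mD eT J x y t - mD eY J x y t.
Proof.
have -> : eV = (fun d => 1 * eT d + (-1) * eY d).
  by apply/funext; case; rewrite /eV /eT /eY /= !mul1r !mulN1r ?oppr0 ?addr0 ?add0r.
by rewrite mD_lin scale1r scaleN1r.
Qed.

Lemma mgood_smooth J : mgood J -> smooth J.
Proof. by move=> gJ i j k; have [[hr _] [hi _]] := gJ i j; split. Qed.

(** Zero curvature of J^-1 dJ: the two mixed derivatives of [J] are expanded and [J] is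
    cancelled. *)
Lemma flat_connection J T Y x y t : mgood J -> mdiff T -> mdiff Y ->
  mD eT J = mmul J T -> mD eY J = mmul J Y -> (J x y t)^t* *m J x y t = 1%:M ->
  mD eT Y x y t - mD eY T x y t = - comm (T x y t) (Y x y t).
Proof.
move=> gJ dT dY JT JY JJ; have dJ := mgood_diff gJ.
have /(congr1 (fun f => f x y t)) := mD_comm eT eY gJ.
rewrite JT JY (mD_mul _ _ _ _ dJ dY) (mD_mul _ _ _ _ dJ dT) JT JY /mmul -!mulmxA -!mulmxDr.
move/(congr1 (mulmx ((J x y t)^t*))); rewrite !(mulmxA _ (J x y t)) JJ !mul1mx /comm opprB.
move: (mD eT _ x y t) (mD eY _ x y t) (T x y t *m _) (Y x y t *m _) => a b c d E.
by apply/eqP; rewrite subr_eq addrAC eq_sym subr_eq -E addrC.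
Qed.

(** With T = J^-1 J_t and Y = J^-1 J_y one has A = T + Y, so A_v = B_x reads T_t - B_x - Y_y = T_y -
    Y_t, and flatness identifies the right side with [T, Y]. *)
Lemma ward_equation J A B : mgood J -> (forall x y t, J x y t \is unitarymx) ->
  (forall x y t, mD eU J x y t = J x y t *m A x y t) ->
  (forall x y t, mD eX J x y t = J x y t *m B x y t) ->
  (forall x y t, mD eV A x y t = mD eX B x y t) ->
  forall x y t, Dt (At J) x y t - Dx (Ax J) x y t - Dy (Ay J) x y t
        - comm (At J x y t) (Ay J x y t) = 0.
Proof.
move=> gJ uJ hA hB hAB x y t.
have JJ x' y' t' : madj J x' y' t' *m J x' y' t' = 1%:M.
  have := mulmxKtV 1%:M (uJ x' y' t') erefl.
  by rewrite mul1mx.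
have uJJ x' y' t' : J x' y' t' *m madj J x' y' t' = 1%:M by apply/unitarymxP/uJ.
have AtE : At J = mmul (madj J) (mD eT J).
  by apply: funext3 => x' y' t'; rewrite /At (invmx_unitary (uJ _ _ _)) DtE.
have AyE : Ay J = mmul (madj J) (mD eY J).
  by apply: funext3 => x' y' t'; rewrite /Ay (invmx_unitary (uJ _ _ _)) DyE.
have AxE : Ax J = B.
  apply: funext3 => x' y' t'; rewrite /Ax (invmx_unitary (uJ _ _ _)) DxE hB.
  by rewrite mulmxA JJ mul1mx.
have dT : mdiff (At J).
  rewrite AtE; apply: mdiff_mul; last exact: mdiff_mD.
  exact/mdiff_adj/mgood_diff.
have dY : mdiff (Ay J).
  rewrite AyE; apply: mdiff_mul; last exact: mdiff_mD.
  exact/mdiff_adj/mgood_diff.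
have AE : A = madd (At J) (Ay J).
  apply: funext3 => x' y' t'; rewrite /madd AtE AyE /mmul -mulmxDr -mD_eU hA.
  by rewrite mulmxA JJ mul1mx.
have JT : mD eT J = mmul J (At J).
  by apply: funext3 => x' y' t'; rewrite AtE /mmul mulmxA uJJ mul1mx.
have JY : mD eY J = mmul J (Ay J).
  by apply: funext3 => x' y' t'; rewrite AyE /mmul mulmxA uJJ mul1mx.
have dJ := mgood_diff gJ.
have flat := flat_connection gJ dT dY JT JY (JJ x y t).
have alg (a b c d : 'M[C]_n) : a - (a + b - (c + d)) - d + (b - c) = 0.
  apply/matrixP => i j; rewrite !mxE.
  by move: (a i j) (b i j) (c i j) (d i j) => *; ring.
have := hAB x y t; rewrite mD_eV AE !(mD_add _ _ _ _ dT dY) DtE DxE DyE AxE.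
move/eqP; rewrite eq_sym => /eqP ->.
have <- := flat.
exact: alg.
Qed.

(** The invariant after [k] of [K] steps. Of the extended solution it keeps only the vectors
    psi(z_s) q_s of the steps still to come, which is all that those steps read. *)
Record lax_data (z : nat -> C) (K k : nat) (J A B : R -> R -> R -> 'M[C]_n)
    (Q : nat -> R -> R -> R -> 'cV[C]_n) : Prop := LaxData {
  lax_good : mgood J;
  lax_A : forall x y t, mD eU J x y t = J x y t *m A x y t;
  lax_B : forall x y t, mD eX J x y t = J x y t *m B x y t;
  lax_skewA : forall x y t, (A x y t)^t* = - A x y t;
  lax_skewB : forall x y t, (B x y t)^t* = - B x y t;
  lax_diffA : mdiff A;
  lax_diffB : mdiff B;
  lax_AB : forall x y t, mD eV A x y t = mD eX B x y t;
  lax_Q : forall s, (k < s <= K)%N -> [/\ mgood (Q s),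
      forall x y t, Q s x y t != 0,
      forall x y t, mD (lax (z s) eX eU) (Q s) x y t = A x y t *m Q s x y t
    & forall x y t, mD (lax (z s) eV eX) (Q s) x y t = B x y t *m Q s x y t] }.

(** The case r = s of the first inequality says that [z s] is not real. *)
Definition generic (z : nat -> C) (K : nat) : Prop :=
  (forall s, (1 <= s <= K)%N -> z s != 0) /\
  (forall s r, (1 <= s <= K)%N -> (1 <= r <= K)%N ->
     z s != (z r)^* /\ (s != r -> z s != z r)).

Definition lax_vectors (z : nat -> C) (q : nat -> R -> R -> R -> 'cV[C]_n)
    (psi : R -> R -> R -> C -> 'M[C]_n) : nat -> R -> R -> R -> 'cV[C]_n :=
  fun s x y t => psi x y t (z s) *m q s x y t.

Lemma lax_data_step z K k J A B c q psi : generic z K -> (k < K)%N ->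
  lax_data z K k J A B (lax_vectors z q psi) ->
  exists A' B', lax_data z K k.+1 (backlund_ward c (z k.+1) (q k.+1) psi J) A' B'
    (lax_vectors z q (backlund_ext (z k.+1) (q k.+1) psi)).
Proof.
move=> [z0 zd] kK [gJ hA hB sA sB dA dB AB hQ].
have k1 : (1 <= k.+1 <= K)%N by rewrite kK.
have /hQ[gQ nQ lQ1 lQ2] : (k < k.+1 <= K)%N by rewrite ltnSn kK.
pose P := fun x y t => line_proj (lax_vectors z q psi k.+1 x y t).
have PE x y t : P x y t = line_proj (lax_vectors z q psi k.+1 x y t) by [].
have gP : mgood P by apply: mgood_line_proj.
have rX d : (eX d)^* = eX d by case: d; rewrite /= ?rmorph1 ?rmorph0.
have rU d : (eU d)^* = eU d by case: d; rewrite /= ?rmorph1 ?rmorph0.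
have rV d : (eV d)^* = eV d by case: d; rewrite /= ?rmorphN ?rmorph1 ?rmorph0.
have dJ := mgood_diff gJ.
exists (dressed eX (z k.+1) A P), (dressed eV (z k.+1) B P).
have dscale xi : mdiff (mscale (ccst ((z k.+1)^* - z k.+1)) (mD xi P)).
  by apply: mdiff_scale; [exact: cdiff_cst|exact: mdiff_mD].
have dAB xi eta (D : R -> R -> R -> 'M[C]_n) x y t : mdiff D ->
    mD eta (dressed xi (z k.+1) D P) x y t =
    mD eta D x y t + ((z k.+1)^* - z k.+1) *: mD eta (mD xi P) x y t.
  move=> dD; rewrite -[dressed _ _ D _]/(madd D (mscale (ccst ((z k.+1)^* - z k.+1)) (mD xi P))).
  rewrite (mD_add _ _ _ _ dD (dscale xi)) mD_scale ?vD_cst ?scale0r ?add0r //.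
    exact: cdiff_cst.
  exact: mdiff_mD.
have dD xi D : mdiff D -> mdiff (dressed xi (z k.+1) D P).
  by move=> hD; apply: (mdiff_add hD (dscale xi)).
split.
- apply: (@mgood_scale _ _ _ (ccst c)); first exact: cgood_cst.
  apply: (@mgood_mul _ _ _ _ J (madd (mscale (ccst ((z k.+1)^* / z k.+1)) P)
    (madd (mcst 1%:M) (fun x y t => - P x y t)))) => //.
  apply: mgood_add; first by apply: mgood_scale => //; apply: cgood_cst.
  apply: mgood_add; first exact: mgood_cst.
  have -> : (fun x y t => - P x y t) = mscale (ccst (-1)) P.
    by apply: funext3 => x y t; rewrite /mscale /ccst scaleN1r.
  by apply: mgood_scale => //; apply: cgood_cst.
- move=> x y t.
  exact: (dressed_log rX rU sA nQ gQ lQ1 PE c (z0 _ k1) dJ (hA x y t)).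
- move=> x y t.
  exact: (dressed_log rV rX sB nQ gQ lQ2 PE c (z0 _ k1) dJ (hB x y t)).
- by move=> x y t; apply: (dressed_skew rX).
- by move=> x y t; apply: (dressed_skew rV).
- exact: dD.
- exact: dD.
- by move=> x y t; rewrite (dAB eX eV A _ _ _ dA) (dAB eV eX B _ _ _ dB) AB (mD_comm eV eX gP).
- move=> s /andP[ks sK].
  have s1 : (1 <= s <= K)%N by rewrite sK (leq_trans _ ks).
  have /hQ[gs ns ls1 ls2] : (k < s <= K)%N by rewrite sK (leq_trans _ ks).
  have [zs1 /(_ _) zs2] := zd s k.+1 s1 k1.
  have {}zs2 : z s != z k.+1 by apply: zs2; rewrite neq_ltn ks orbT.
  have -> : lax_vectors z q (backlund_ext (z k.+1) (q k.+1) psi) s =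
      fun x y t => h_factor (z k.+1) (P x y t) (z s) *m lax_vectors z q psi s x y t.
    by apply: funext3 => x y t; rewrite /lax_vectors /backlund_ext mulmxA.
  split.
  + have -> : (fun x y t => h_factor (z k.+1) (P x y t) (z s) *m lax_vectors z q psi s x y t)
      = madd (lax_vectors z q psi s) (mscale (ccst (((z k.+1)^* - z k.+1) / (z s - (z k.+1)^*)))
          (mmul P (lax_vectors z q psi s))).
      apply: funext3 => x y t; rewrite h_factorE // /madd /mscale /ccst /mmul.
      by rewrite mulmxDl mul1mx scalemxAl.
    apply: mgood_add => //; apply: mgood_scale; first exact: cgood_cst.
    exact: mgood_mul.
  (* The factor is invertible at [z s] by [h_factor_unitary], so the later vectors stay nonzero. *)
  + move=> x y t; apply: contraNneq (ns x y t) => h0.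
    have := h_factor_unitary (line_proj_idem (lax_vectors z q psi k.+1 x y t))
      (line_proj_adj _) zs2 zs1.
    move/(congr1 (fun M => M *m lax_vectors z q psi s x y t)).
    by rewrite -mulmxA h0 mulmx0 mul1mx => <-.
  + move=> x y t.
    exact: (dressed_lax rX rU sA nQ gQ lQ1 PE zs1 (mgood_diff gs) (ls1 x y t)).
  + move=> x y t.
    exact: (dressed_lax rV rX sB nQ gQ lQ2 PE zs1 (mgood_diff gs) (ls2 x y t)).
Qed.

Lemma lax_data_iter z K k J A B c q psi : generic z K -> (k <= K)%N ->
  lax_data z K 0 J A B (lax_vectors z q psi) ->
  exists A' B', lax_data z K k (backlund_iter c z q psi J k).2 A' B'
    (lax_vectors z q (backlund_iter c z q psi J k).1).
Proof.
move=> gz; elim: k => [|k IH] kK h0; first by exists A, B.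
have [A' [B' hk]] := IH (ltnW kK) h0.
exact: lax_data_step gz kK hk.
Qed.

End WardFromLax.

(** * Limits and little-o estimates along a filter *)

Section Limits.
Context {R : realType} {T : Type} (F : set_system T) {FF : Filter F}.
Notation C := R[i].
Implicit Types (f g : T -> C) (a b : C).

(** The tolerance is real, as in [tends_to]; [tendsto_cvg] connects this with convergence in
    [R[i]]. *)
Definition tendsto f a := forall e : R, 0 < e -> \forall p \near F, `|f p - a| < e%:C.

Let K : numFieldType := C.

Lemma tendsto_cvg f a : tendsto f a <-> (f : T -> K) @ F --> (a : K).
Proof.
split=> [h|h].
  apply/(@cvgrPdist_lt K) => e e0.
  have [er e0'] : e = (complex.Re e)%:C /\ 0 < complex.Re e.
    move: e0; case: (e) => u v; rewrite ltcE /= => /andP[/eqP -> u0].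
    by split.
  have := h _ e0'; apply: filterS => p; rewrite -er distrC; apply.
move=> e e0; have e0' : (0 : K) < e%:C by rewrite (ltcR 0).
move/(@cvgrPdist_lt K): h => /(_ _ e0'); apply: filterS => p.
by rewrite distrC.
Qed.

Lemma tendsto_cst a : tendsto (fun=> a) a.
Proof. by move=> e e0; apply: nearW => p; rewrite subrr normr0 (ltcR 0). Qed.

Lemma tendstoD f g a b : tendsto f a -> tendsto g b ->
  tendsto (fun p => f p + g p) (a + b).
Proof.
move=> hf hg e e0; have e2 : 0 < e / 2 by rewrite divr_gt0.
near=> p; rewrite opprD addrACA; apply: le_lt_trans (ler_normD _ _) _.
have -> : e%:C = (e / 2)%:C + (e / 2)%:C by rewrite -rmorphD /= -splitr.
by apply: ltrD; near: p; [apply: hf|apply: hg].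
Unshelve. all: by end_near. Qed.

Lemma tendstoM f g a b : tendsto f a -> tendsto g b ->
  tendsto (fun p => f p * g p) (a * b).
Proof. by move=> /tendsto_cvg hf /tendsto_cvg hg; apply/tendsto_cvg; apply: (@cvgM K). Qed.

Lemma tendstoV f a : a != 0 -> tendsto f a -> tendsto (fun p => (f p)^-1) a^-1.
Proof. by move=> a0 /tendsto_cvg hf; apply/tendsto_cvg; apply: (@cvgV K). Qed.

Lemma tendsto_conj f a : tendsto f a -> tendsto (fun p => (f p)^*) a^*.
Proof.
move=> h e e0; have := h e e0; apply: filterS => p.
by rewrite -rmorphB /= norm_conjC.
Qed.

Lemma tendsto_sum (I : Type) (r : seq I) (f : I -> T -> C) (a : I -> C) :
  (forall i, tendsto (f i) (a i)) ->
  tendsto (fun p => \sum_(i <- r) f i p) (\sum_(i <- r) a i).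
Proof.
move=> h; elim: r => [|i r IH].
  rewrite big_nil; under eq_fun do rewrite big_nil; exact: tendsto_cst.
by rewrite big_cons; under eq_fun do rewrite big_cons; exact: tendstoD.
Qed.

Definition mtendsto m n (M : T -> 'M[C]_(m, n)) (L : 'M[C]_(m, n)) :=
  forall i j, tendsto (fun p => M p i j) (L i j).

Lemma mtendsto_cst m n (L : 'M[C]_(m, n)) : mtendsto (fun=> L) L.
Proof. by move=> i j; apply: tendsto_cst. Qed.

Lemma mtendstoD m n (M N : T -> 'M[C]_(m, n)) L L' : mtendsto M L -> mtendsto N L' ->
  mtendsto (fun p => M p + N p) (L + L').
Proof.
move=> h h' i j; rewrite mxE; under eq_fun do rewrite mxE; exact: tendstoD.
Qed.

Lemma mtendstoZ m n f a (M : T -> 'M[C]_(m, n)) L : tendsto f a -> mtendsto M L ->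
  mtendsto (fun p => f p *: M p) (a *: L).
Proof.
move=> h h' i j; rewrite mxE; under eq_fun do rewrite mxE; exact: tendstoM.
Qed.

Lemma mtendstoM m n q (M : T -> 'M[C]_(m, n)) (N : T -> 'M[C]_(n, q)) L L' :
  mtendsto M L -> mtendsto N L' -> mtendsto (fun p => M p *m N p) (L *m L').
Proof.
move=> h h' i j; rewrite mxE; under eq_fun do rewrite mxE.
by apply: tendsto_sum => k; apply: tendstoM.
Qed.

Lemma mtendsto_adj m n (M : T -> 'M[C]_(m, n)) L : mtendsto M L ->
  mtendsto (fun p => (M p)^t*) (L^t*).
Proof.
move=> h i j; rewrite !mxE; under eq_fun do rewrite !mxE; exact: tendsto_conj.
Qed.

Lemma mtendsto_line_proj n (v : T -> 'cV[C]_n) (w : 'cV[C]_n) : w != 0 ->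
  mtendsto v w -> mtendsto (fun p => line_proj (v p)) (line_proj w).
Proof.
move=> w0 h; apply: mtendstoZ; last by apply: mtendstoM => //; apply: mtendsto_adj.
apply: tendstoV; first by rewrite -[_ 0 0]/(sqn w) sqn_eq0.
by apply: mtendstoM => //; apply: mtendsto_adj.
Qed.

Definition smallo (eps : T -> R) f :=
  forall e : R, 0 < e -> \forall p \near F, `|f p| <= (e * eps p)%:C.

Definition bigo (eps : T -> R) f := exists2 k : R, 0 < k & \forall p \near F, `|f p| <= (k * eps p)%:C.

Lemma smallo0 eps : (forall p, 0 <= eps p) -> smallo eps (fun=> 0).
Proof. by move=> h e e0; apply: nearW => p; rewrite normr0 (lecR 0) mulr_ge0 // ltW. Qed.

Lemma smalloD eps f g : smallo eps f -> smallo eps g -> smallo eps (fun p => f p + g p).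
Proof.
move=> hf hg e e0; have e2 : 0 < e / 2 by rewrite divr_gt0.
near=> p; apply: le_trans (ler_normD _ _) _.
have -> : (e * eps p)%:C = (e / 2 * eps p)%:C + (e / 2 * eps p)%:C.
  by rewrite -rmorphD /= -mulrDl -splitr.
by apply: lerD; near: p; [apply: hf|apply: hg].
Unshelve. all: by end_near. Qed.

Lemma smallo_sum eps (I : eqType) (r : seq I) (f : I -> T -> C) : (forall p, 0 <= eps p) ->
  (forall i, i \in r -> smallo eps (f i)) -> smallo eps (fun p => \sum_(i <- r) f i p).
Proof.
move=> e0 h; elim: r h => [|i r IH] h.
  under eq_fun do rewrite big_nil; exact: smallo0.
under eq_fun do rewrite big_cons; apply: smalloD; first by apply: h; rewrite mem_head.
by apply: IH => j jr; apply: h; rewrite in_cons jr orbT.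
Qed.

Lemma bigo_smallo eps f g : bigo eps f -> tendsto g 0 -> smallo eps (fun p => f p * g p).
Proof.
move=> [k k0 hf] hg e e0; have ek : 0 < e / k by rewrite divr_gt0.
near=> p; rewrite normrM.
have h1 : `|f p| <= (k * eps p)%:C by near: p.
have h2 : `|g p| <= (e / k)%:C.
  by apply: ltW; near: p; have := hg _ ek; apply: filterS => p; rewrite subr0.
have -> : (e * eps p)%:C = (k * eps p)%:C * (e / k)%:C.
  by rewrite -rmorphM /=; congr (_%:C); field; rewrite gt_eqF.
exact: ler_pM.
Unshelve. all: by end_near. Qed.

Lemma smalloZ eps c f : smallo eps f -> smallo eps (fun p => c * f p).
Proof.
move=> hf e e0.
have [nc ncE] : {r : R | `|c| = r%:C} by exists (Num.sqrt (complex.Re c ^+ 2 + complex.Im c ^+ 2)); rewrite normc_def.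
have nc0 : 0 <= nc by rewrite -lecR -ncE normr_ge0.
near=> p; rewrite normrM.
have h : `|f p| <= (e / (nc + 1) * eps p)%:C.
  by near: p; apply: hf; rewrite divr_gt0 // ltr_wpDl.
rewrite ncE; apply: le_trans (ler_wpM2l _ h) _; first by rewrite (lecR 0).
have e1 : 0 <= e / (nc + 1) * eps p by rewrite -lecR; apply: le_trans (normr_ge0 _) h.
rewrite -rmorphM lecR /=.
have -> : e * eps p = (nc + 1) * (e / (nc + 1) * eps p) by field; rewrite gt_eqF // ltr_wpDl.
by rewrite ler_wpM2r // lerDl.
Unshelve. all: by end_near. Qed.

Lemma smalloN eps f : smallo eps f -> smallo eps (fun p => - f p).
Proof. by move=> h e e0; have := h e e0; apply: filterS => p; rewrite normrN. Qed.

Lemma smallo_conj eps f : smallo eps f -> smallo eps (fun p => (f p)^*).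
Proof. by move=> h e e0; have := h e e0; apply: filterS => p; rewrite norm_conjC. Qed.

Lemma bigo_conj eps f : bigo eps f -> bigo eps (fun p => (f p)^*).
Proof. by move=> [k k0 h]; exists k => //; move: h; apply: filterS => p; rewrite norm_conjC. Qed.

Lemma eq_smallo eps f g : f =1 g -> smallo eps f -> smallo eps g.
Proof. by move=> /funext ->. Qed.

End Limits.

(** * Lagrange interpolation *)

Section Lagrange.
Context {K : fieldType}.

Lemma lagrange_interpolation (a : nat -> K) (N : nat) (q : {poly K}) (x : K) :
  (forall r s, (1 <= r <= N)%N -> (1 <= s <= N)%N -> a r = a s -> r = s) ->
  (size q <= N)%N ->
  q.[x] = \sum_(1 <= s < N.+1) q.[a s]
    * \prod_(1 <= r < N.+1 | r != s) ((x - a r) / (a s - a r)).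
Proof.
move=> a_inj sq.
have {}a_inj r s : r \in index_iota 1 N.+1 -> s \in index_iota 1 N.+1 ->
    a r = a s -> r = s by rewrite !mem_index_iota !ltnS; apply: a_inj.
pose L s : {poly K} := \prod_(r <- [seq r <- index_iota 1 N.+1 | r != s]) ('X - (a r)%:P).
pose c s := \prod_(1 <= r < N.+1 | r != s) (a s - a r)^-1.
pose p := \sum_(1 <= s < N.+1) (q.[a s] * c s) *: L s.
have pE y : p.[y] = \sum_(1 <= s < N.+1) q.[a s]
    * \prod_(1 <= r < N.+1 | r != s) ((y - a r) / (a s - a r)).
  rewrite /p horner_sum; apply: eq_bigr => s _.
  rewrite hornerZ /L horner_prod big_filter -mulrA; congr (_ * _).
  rewrite /c -big_split /=; apply: eq_bigr => r _.
  by rewrite hornerXsubC mulrC.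
rewrite -pE; suff -> : p = q by [].
apply/eqP; rewrite -subr_eq0; apply/eqP.
(* The difference has size at most N and vanishes at N distinct nodes. Each [L s] leaves out the
   node s, whence its size. *)
apply: (@roots_geq_poly_eq0 _ _ [seq a s | s <- index_iota 1 N.+1]).
- apply/allP => _ /mapP[s sI ->]; rewrite /root !hornerE pE subr_eq0.
  rewrite (bigD1_seq s) ?iota_uniq //= [X in _ + X]big1_seq ?addr0; last first.
    move=> r /andP[rs rI]; rewrite big_mkcond (bigD1_seq s) ?iota_uniq //=.
    by rewrite eq_sym rs subrr mul0r mul0r mulr0.
  rewrite big_seq_cond big1 ?mulr1 // => r /andP[rI rs]; rewrite divff // subr_eq0.
  by apply: contra rs => /eqP E; rewrite (a_inj _ _ sI rI E).
- by rewrite map_inj_in_uniq ?iota_uniq.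
- rewrite size_map size_iota subn1 /=.
  rewrite (leq_trans (size_polyD _ _)) // geq_max size_polyN sq andbT.
  apply: (leq_trans (size_sum _ _ _)); apply/bigmax_leqP_seq => s sI _.
  rewrite (leq_trans (size_scale_leq _ _)) // /L size_prod_XsubC size_filter.
  have := count_predC (fun r => r != s) (index_iota 1 N.+1).
  rewrite size_iota subn1 /= => E.
  rewrite -[X in (_ <= X)%N]E -[X in (X < _)%N]addn0 ltn_add2l -has_count.
  by apply/hasP; exists s => //=; rewrite negbK.
Qed.

End Lagrange.

(** * The dressing product with its poles cleared *)

Section PolynomialDressing.
Context {R : realType}.
Notation C := R[i].

(* [dress] with the poles at the conjugates of the [z s] cleared *)
Fixpoint pdress d (z : nat -> C) (v : nat -> 'cV[C]_d) (k : nat) (lam : C) : 'M[C]_d :=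
  if k is s.+1 then
    ((lam - (z k)^*) *: (1%:M - dproj z v k) + (lam - z k) *: dproj z v k)
      *m pdress z v s lam
  else 1%:M.

Lemma pdressE d z (v : nat -> 'cV[C]_d) k lam :
  (forall s, (1 <= s <= k)%N -> lam != (z s)^*) ->
  pdress z v k lam = \prod_(1 <= s < k.+1) (lam - (z s)^*) *: dress z v k lam.
Proof.
elim: k => [|k IH] h; first by rewrite big_geq // scale1r.
rewrite big_nat_recr //= IH; last first.
  by move=> s /andP[s1 sk]; apply: h; rewrite s1 ltnW.
rewrite -scalemxAr -scalerA; congr (_ *: _); rewrite scalemxAl; congr (_ *m _).
have lz : lam - (z k.+1)^* != 0 by rewrite subr_eq0 h // ltnS leqnn.
rewrite -[line_proj _]/(dproj z v k.+1) /h_factor [RHS]scalerDr.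
by move: (dproj _ _ _) => P; rewrite scalerA mulrCA divff ?mulr1.
Qed.

Lemma pdress_poly d z (v : nat -> 'cV[C]_d) k :
  exists q : 'I_d -> 'I_d -> {poly C}, forall i j, (size (q i j) <= k)%N /\
    forall lam, pdress z v k lam i j =
      (\prod_(1 <= s < k.+1) (lam - (z s)^*)) *+ (i == j) + (q i j).[lam].
Proof.
elim: k => [|k [q hq]].
  exists (fun _ _ => 0) => i j; rewrite size_poly0; split=> // lam.
  by rewrite big_geq // !mxE horner0 addr0.
pose P := dproj z v k.+1; pose S := \prod_(1 <= s < k.+1) ('X - ((z s)^*)%:P).
have SE lam : S.[lam] = \prod_(1 <= s < k.+1) (lam - (z s)^*).
  by rewrite horner_prod; apply: eq_bigr => s _; rewrite hornerXsubC.
have sS : (size S <= k.+1)%N by rewrite size_prod_XsubC size_iota subn1.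
exists (fun i j => ('X - ((z k.+1)^*)%:P) * q i j
  + ((z k.+1)^* - z k.+1) *: (P i j *: S + \sum_l P i l *: q l j)) => i j; split.
  rewrite (leq_trans (size_polyD _ _)) // geq_max; apply/andP; split.
    by rewrite (leq_trans (size_polyMleq _ _)) // size_XsubC /= ltnS; case: (hq i j).
  rewrite (leq_trans (size_scale_leq _ _)) // (leq_trans (size_polyD _ _)) // geq_max.
  rewrite (leq_trans (size_scale_leq _ _)) //=.
  apply: (leq_trans (size_sum _ _ _)); apply/bigmax_leqP => l _.
  by rewrite (leq_trans (size_scale_leq _ _)) // leqW //; case: (hq l j).
move=> lam; rewrite /= -/P; clearbody P S.
have -> : (lam - (z k.+1)^*) *: (1%:M - P) + (lam - z k.+1) *: P =
    (lam - (z k.+1)^*) *: 1%:M + ((z k.+1)^* - z k.+1) *: P.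
  rewrite scalerBr -addrA; congr (_ + _); rewrite addrC -scalerBl; congr (_ *: _).
  by ring.
rewrite mulmxDl -!scalemxAl mul1mx mxE [X in X + _]mxE [X in _ + X]mxE.
rewrite (proj2 (hq i j)) [in RHS]big_nat_recr //= hornerD hornerM hornerXsubC.
rewrite hornerZ hornerD hornerZ SE.
have -> : (P *m pdress z v k lam) i j =
    P i j * \prod_(1 <= s < k.+1) (lam - (z s)^*) + (\sum_l P i l *: q l j).[lam].
  rewrite mxE horner_sum.
  transitivity (\sum_l (P i l * (\prod_(1 <= s < k.+1) (lam - (z s)^*) *+ (l == j))
      + P i l * (q l j).[lam])).
    by apply: eq_bigr => l _; rewrite (proj2 (hq l j)) mulrDr.
  rewrite big_split /=; congr (_ + _); last first.
    by apply: eq_bigr => l _; rewrite hornerZ.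
  by rewrite (bigD1 j) //= eqxx [X in _ + X]big1 ?addr0 // => l /negPf ->; rewrite mulr0.
move: (\prod_(1 <= s < k.+1) _) ((q i j).[lam]) ((\sum_l _).[lam]) (P i j) (z k.+1)^*.
by move=> u w w' w'' zs; case: (i == j); rewrite ?mulr1n ?mulr0n; ring.
Qed.

Lemma pdress_trunc d z (v : nat -> 'cV[C]_d) k s lam (w : 'cV[C]_d) : (s <= k)%N ->
  pdress z v s lam *m w = 0 -> pdress z v k lam *m w = 0.
Proof.
move=> /subnK <- h; elim: (k - s)%N => [|r IH] //.
by rewrite addSn /= -mulmxA IH mulmx0.
Qed.

(** At [z s] the factor of step s becomes a multiple of I - P, where P projects onto the very line
    to which the earlier factors carry [v s]. *)
Lemma pdress_ker d z (v : nat -> 'cV[C]_d) K s : generic z K -> (1 <= s <= K)%N ->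
  pdress z v K (z s) *m v s = 0.
Proof.
move=> [_ gz] /andP[s1 sK]; apply: (@pdress_trunc _ _ _ _ s) => //.
case: s s1 sK => // s _ sK.
rewrite /= pdressE => [|r /andP[r1 rs]]; last first.
  by case: (gz s.+1 r) => //; rewrite r1 (leq_trans rs (ltnW sK)).
rewrite subrr scale0r addr0 -!scalemxAl -!scalemxAr -!scalemxAl -mulmxA.
rewrite mulmxBl mul1mx /dproj /= line_proj_id subrr !scaler0.
by [].
Qed.

(** At the conjugate of [z s] the factor of step s becomes a multiple of P. By [dress_unitary] the
    earlier factors carry a vector orthogonal to [v s] to one orthogonal to the image of P. *)
Lemma pdress_ker_conj d z (v : nat -> 'cV[C]_d) K s (w : 'cV[C]_d) : generic z K ->
  (1 <= s <= K)%N -> (v s)^t* *m w = 0 -> pdress z v K (z s)^* *m w = 0.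
Proof.
move=> [_ gz] /andP[s1 sK] vw; apply: (@pdress_trunc _ _ _ _ s) => //.
case: s s1 sK vw => // s _ sK vw.
have zz r : (1 <= r <= s)%N -> (z s.+1)^* != z r /\ (z s.+1)^* != (z r)^*.
  move=> /andP[r1 rs]; have rK : (1 <= r <= K)%N by rewrite r1 (leq_trans rs (ltnW sK)).
  have sK' : (1 <= s.+1 <= K)%N by rewrite sK.
  split; first by rewrite eq_sym; case: (gz r s.+1).
  rewrite (inj_eq (can_inj conjCK)).
  by case: (gz s.+1 r) => // _; apply; rewrite gtn_eqF.
have Pw : dproj z v s.+1 *m (dress z v s (z s.+1)^* *m w) = 0.
  rewrite /dproj /= line_projE adjM -!mulmxA -scalemxAl -!mulmxA.
  rewrite [(dress _ _ _ _)^t* *m _]mulmxA.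
  have := dress_unitary v zz; rewrite conjCK => ->.
  by rewrite mul1mx vw scaler0 !mulmx0.
rewrite /= pdressE => [|r /zz[]//].
rewrite subrr scale0r add0r; move: (dproj _ _ _) Pw => P Pw.
by rewrite -mulmxA -!scalemxAl -scalemxAr Pw !scaler0.
Qed.

End PolynomialDressing.

(** * First order expansion of the dressing product in the plane *)

Section TwoDim.
Context {R : realType}.
Notation C := R[i].

Lemma sum2 (f : 'I_2 -> C) : \sum_i f i = f 0 + f 1.
Proof.
rewrite !big_ord_recl big_ord0 addr0; congr (f _ + f _); exact: val_inj.
Qed.

Lemma ord2P (i : 'I_2) : i = 0 \/ i = 1.
Proof. by case: i => [[|[|//]] hi]; [left|right]; apply: val_inj. Qed.

(* the line through (d, 1), close to the second coordinate axis for small d *)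
Definition near_axis (d : C) : 'cV[C]_2 := \col_i (if i == 0 then d else 1).

(** The scalar by which the product of [k] factors acts on their line when all the lines
    coincide. *)
Definition blaschke (z : nat -> C) (k : nat) (lam : C) : C :=
  \prod_(1 <= s < k.+1) ((lam - z s) / (lam - (z s)^*)).

(** The Lagrange basis polynomial of the node [z s], evaluated at 0. *)
Definition lagrange0 (z : nat -> C) (K s : nat) : C :=
  \prod_(1 <= r < K.+1 | r != s) ((0 - z r) / (z s - z r)).

(* The coefficient of the s-th mode in the first order expansion of the
   dressing factor at lambda = 0, read off by Lagrange interpolation. *)
Definition mode_coef (z : nat -> C) (K s : nat) : C :=
  \prod_(1 <= r < K.+1) (z s - (z r)^*) * lagrange0 z K s
  / \prod_(1 <= r < K.+1) (0 - (z r)^*).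

Context {T : Type} (F : set_system T) {FF : Filter F}.
Variables (z : nat -> C) (K : nat) (delta : nat -> T -> C).
Hypotheses (gz : generic z K)
  (delta0 : forall s, (1 <= s <= K)%N -> tendsto F (delta s) 0).

Let v (p : T) (s : nat) : 'cV[C]_2 := near_axis (delta s p).
Let E : 'M[C]_2 := delta_mx 1 1.

(** All lines tend to the second axis, so the limit factors are diagonal. The two claims go
    together: the line of step k+1 is moved by the first [k] factors at z_{k+1}, whose limit
    multiplies the axis by a Blaschke product that is nonzero by genericity. *)
Lemma tendsto_dress k lam : (k <= K)%N ->
  mtendsto F (fun p => dress z (v p) k lam) (1%:M + (blaschke z k lam - 1) *: E) /\
  ((k < K)%N -> mtendsto F (fun p => dproj z (v p) k.+1) E).
Proof.
have zz s r : (1 <= s <= K)%N -> (1 <= r <= K)%N -> s != r ->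
    z s - z r != 0 /\ z s - (z r)^* != 0.
  move=> s1 r1 sr; have [_ /(_ s r s1 r1)[h1 h2]] := gz.
  by rewrite !subr_eq0 h1 h2.
have EE : E *m E = E by rewrite mul_delta_mx.
have projE k' : (k' < K)%N -> (forall mu, mtendsto F (fun p => dress z (v p) k' mu)
    (1%:M + (blaschke z k' mu - 1) *: E)) -> mtendsto F (fun p => dproj z (v p) k'.+1) E.
  move=> kK h; pose w : 'cV[C]_2 := near_axis 0.
  have vw : mtendsto F (fun p => v p k'.+1) w.
    move=> i j; rewrite !mxE; under eq_fun do rewrite mxE.
    by case: eqP => _; [apply: delta0|apply: tendsto_cst].
  have wE : w = delta_mx 1 0.
    apply/matrixP => i j; rewrite !mxE ord1 eqxx andbT.
    by case: (ord2P i) => ->.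
  have bw : (1%:M + (blaschke z k' (z k'.+1) - 1) *: E) *m w = blaschke z k' (z k'.+1) *: w.
    rewrite mulmxDl mul1mx -scalemxAl wE mul_delta_mx scalerBl scale1r.
    by rewrite addrC subrK.
  have b0 : blaschke z k' (z k'.+1) != 0.
    rewrite /blaschke prodf_seq_neq0; apply/allP => r; rewrite mem_index_iota => /andP[r1 rk].
    apply/implyP => _; have [h1 h2] : z k'.+1 - z r != 0 /\ z k'.+1 - (z r)^* != 0.
      have rK : (r <= K)%N by rewrite ltnW // (leq_trans rk).
      by apply: zz; rewrite ?kK ?r1 ?rK // gtn_eqF.
    by rewrite mulf_neq0 ?invr_neq0.
  have w0 : w != 0.
    by apply/eqP => /matrixP/(_ 1 0)/eqP; rewrite !mxE /= oner_eq0.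
  have -> : E = line_proj (blaschke z k' (z k'.+1) *: w).
    rewrite line_projZ // line_projE.
    have -> : sqn w = 1 by rewrite sqnE sum2 !mxE /= normr0 normr1 expr0n expr1n add0r.
    rewrite invr1 scale1r; apply/matrixP => i j; rewrite !mxE big_ord1 !mxE.
    by case: (ord2P i) => ->; case: (ord2P j) => -> /=; rewrite ?rmorph0 ?rmorph1 ?mulr0 ?mul0r ?mulr1.
  apply: mtendsto_line_proj; first by rewrite scaler_eq0 negb_or b0.
  by rewrite -bw; apply: mtendstoM.
elim: k lam => [|k IH] lam kK.
  split.
    rewrite /blaschke big_geq // subrr scale0r addr0; exact: mtendsto_cst.
  move=> K0; apply: projE => // mu; rewrite /blaschke big_geq // subrr scale0r addr0.
  exact: mtendsto_cst.
have step mu : mtendsto F (fun p => dress z (v p) k.+1 mu) (1%:M + (blaschke z k.+1 mu - 1) *: E).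
  have [h1 _] := IH mu (ltnW kK); have [_ /(_ kK) h2] := IH mu (ltnW kK).
  have -> : 1%:M + (blaschke z k.+1 mu - 1) *: E =
      h_factor (z k.+1) E mu *m (1%:M + (blaschke z k mu - 1) *: E).
    rewrite /blaschke big_nat_recr //= -/(blaschke z k mu) /h_factor.
    set c := _ / _; set b := blaschke z k mu.
    rewrite mulmxDr mulmx1 -scalemxAr mulmxDl mulmxBl mul1mx -scalemxAl EE subrr add0r.
    by apply/matrixP => i j; rewrite !mxE; ring.
  apply: mtendstoM => //; apply: mtendstoD; last by apply: mtendstoZ => //; exact: tendsto_cst.
  rewrite -scaleN1r; under eq_fun do rewrite -scaleN1r.
  apply: mtendstoD; first exact: mtendsto_cst.
  by apply: mtendstoZ => //; exact: tendsto_cst.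
by split=> // kK'; apply: projE.
Qed.

Lemma tendsto_pdress lam : mtendsto F (fun p => pdress z (v p) K lam)
  (\prod_(1 <= s < K.+1) (lam - (z s)^*) *: (1%:M - E)
   + \prod_(1 <= s < K.+1) (lam - z s) *: E).
Proof.
have EE : E *m E = E by rewrite mul_delta_mx.
suff: forall k, (k <= K)%N -> mtendsto F (fun p => pdress z (v p) k lam)
  (\prod_(1 <= s < k.+1) (lam - (z s)^*) *: (1%:M - E)
   + \prod_(1 <= s < k.+1) (lam - z s) *: E) by apply.
elim=> [|k IH] kK.
  rewrite !big_geq // !scale1r subrK; exact: mtendsto_cst.
have -> : \prod_(1 <= s < k.+2) (lam - (z s)^*) *: (1%:M - E)
   + \prod_(1 <= s < k.+2) (lam - z s) *: E =
   ((lam - (z k.+1)^*) *: (1%:M - E) + (lam - z k.+1) *: E) *m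
   (\prod_(1 <= s < k.+1) (lam - (z s)^*) *: (1%:M - E)
   + \prod_(1 <= s < k.+1) (lam - z s) *: E).
  rewrite ![\prod_(1 <= s < k.+2) _]big_nat_recr //=.
  move: (\prod_(1 <= s < _) _) (\prod_(1 <= s < _) _) => a b.
  have QE : (1%:M - E) *m E = 0 by rewrite mulmxBl mul1mx EE subrr.
  have EQ : E *m (1%:M - E) = 0 by rewrite mulmxBr mulmx1 EE subrr.
  have QQ : (1%:M - E) *m (1%:M - E) = 1%:M - E by rewrite mulmxBr mulmx1 QE subr0.
  rewrite (mulmxDl (_ *: (1%:M - E))) !(mulmxDr _ (_ *: (1%:M - E))).
  rewrite -!scalemxAl -!scalemxAr QQ QE EQ EE !scaler0 addr0 add0r !scalerA.
  by rewrite [a * _]mulrC [b * _]mulrC.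
apply: mtendstoM; last by apply: IH; apply: ltnW.
have [_ /(_ kK) h] := tendsto_dress lam (ltnW kK).
apply: mtendstoD; apply: mtendstoZ; try exact: tendsto_cst; last exact: h.
rewrite -scaleN1r; under eq_fun do rewrite -scaleN1r.
apply: mtendstoD; first exact: mtendsto_cst.
by apply: mtendstoZ => //; exact: tendsto_cst.
Qed.

Lemma pdress_near_axis p s i : (1 <= s <= K)%N ->
  pdress z (v p) K (z s) i 1 = - (delta s p * pdress z (v p) K (z s) i 0) /\
  pdress z (v p) K (z s)^* i 0 = (delta s p)^* * pdress z (v p) K (z s)^* i 1.
Proof.
move=> s1; split.
  have /matrixP/(_ i 0) := pdress_ker (v p) gz s1; rewrite !mxE sum2 !mxE /= mulr1.
  by move/eqP; rewrite addrC addr_eq0 mulrC => /eqP.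
pose w : 'cV[C]_2 := \col_i (if i == 0 then 1 else - (delta s p)^*).
have vw : (v p s)^t* *m w = 0.
  apply/matrixP => a b; rewrite !mxE sum2 !mxE /= rmorph1.
  by rewrite mulr1 mul1r subrr.
have /matrixP/(_ i 0) := pdress_ker_conj gz s1 vw; rewrite !mxE sum2 !mxE /= mulr1.
by move/eqP; rewrite mulrN subr_eq0 mulrC => /eqP.
Qed.

Let nodes_inj r s : (1 <= r <= K)%N -> (1 <= s <= K)%N -> z r = z s -> r = s.
Proof.
move=> r1 s1 zrs; apply/eqP; apply: contraT => rs.
by have [_ /(_ r s r1 s1)[_ /(_ rs)]] := gz; rewrite zrs eqxx.
Qed.

Let nodesC_inj r s : (1 <= r <= K)%N -> (1 <= s <= K)%N -> (z r)^* = (z s)^* -> r = s.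
Proof. by move=> r1 s1 /(can_inj conjCK); apply: nodes_inj. Qed.

Lemma lagrange0_conj s : lagrange0 (fun s => (z s)^*) K s = (lagrange0 z K s)^*.
Proof.
rewrite /lagrange0 rmorph_prod; apply: eq_bigr => r _.
by rewrite fmorph_div !rmorphB rmorph0.
Qed.

Let mem1 s : s \in index_iota 1 K.+1 -> (1 <= s <= K)%N.
Proof. by rewrite mem_index_iota. Qed.

Lemma prod_vanish (f : nat -> C) s : (1 <= s <= K)%N ->
  \prod_(1 <= r < K.+1) (f s - f r) = 0.
Proof.
move=> s1; rewrite (bigD1_seq s) ?mem_index_iota ?iota_uniq //=.
by rewrite subrr mul0r.
Qed.

Lemma pdress0_entries p :
  [/\ pdress z (v p) K 0 0 0 - \prod_(1 <= r < K.+1) (0 - (z r)^*) =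
        \sum_(1 <= s < K.+1) (delta s p)^* *
          (pdress z (v p) K (z s)^* 0 1 * (lagrange0 z K s)^*),
      pdress z (v p) K 0 0 1 = - \sum_(1 <= s < K.+1) delta s p *
          (pdress z (v p) K (z s) 0 0 * lagrange0 z K s),
      pdress z (v p) K 0 1 0 = \sum_(1 <= s < K.+1) (delta s p)^* *
          (pdress z (v p) K (z s)^* 1 1 * (lagrange0 z K s)^*)
    & pdress z (v p) K 0 1 1 - \prod_(1 <= r < K.+1) (0 - z r) =
        - \sum_(1 <= s < K.+1) delta s p *
          (pdress z (v p) K (z s) 1 0 * lagrange0 z K s)].
Proof.
have [q hq] := pdress_poly z (v p) K.
have qz i j lam : pdress z (v p) K lam i j =
    (\prod_(1 <= s < K.+1) (lam - (z s)^*)) *+ (i == j) + (q i j).[lam] by case: (hq i j).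
have sq i j : (size (q i j) <= K)%N by case: (hq i j).
split.
- rewrite {1}qz /= mulr1n addrC addKr (lagrange_interpolation 0 nodesC_inj) //.
  rewrite !big_seq; apply: eq_bigr => s /mem1 s1.
  rewrite -/(lagrange0 (fun s => (z s)^*) K s) lagrange0_conj mulrA; congr (_ * _).
  have [_ <-] := pdress_near_axis p 0 s1.
  by rewrite qz (prod_vanish (fun s => (z s)^*)) // mul0rn add0r.
- rewrite {1}qz /= mulr0n add0r (lagrange_interpolation 0 nodes_inj) // -sumrN.
  rewrite !big_seq; apply: eq_bigr => s /mem1 s1.
  rewrite -/(lagrange0 z K s) mulrA -mulNr; congr (_ * _).
  have [<- _] := pdress_near_axis p 0 s1.
  by rewrite qz mulr0n add0r.
- rewrite {1}qz /= mulr0n add0r (lagrange_interpolation 0 nodesC_inj) //.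
  rewrite !big_seq; apply: eq_bigr => s /mem1 s1.
  rewrite -/(lagrange0 (fun s => (z s)^*) K s) lagrange0_conj mulrA; congr (_ * _).
  have [_ <-] := pdress_near_axis p 1 s1.
  by rewrite qz mulr0n add0r.
- pose S (f : nat -> C) := \prod_(1 <= r < K.+1) ('X - (f r)%:P).
  have SE f lam : (S f).[lam] = \prod_(1 <= r < K.+1) (lam - f r).
    by rewrite horner_prod; apply: eq_bigr => r _; rewrite hornerXsubC.
  (* The entry (1, 1) comes with the product over conjugates, which does not vanish at the [z s].
     Both products are monic of degree K, so exchanging them keeps the degree below K. *)
  pose q' := q 1 1 + (S (fun r => (z r)^*) - S z).
  have q'E lam : pdress z (v p) K lam 1 1 - \prod_(1 <= r < K.+1) (lam - z r) = q'.[lam].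
    rewrite qz /= mulr1n /q' hornerD hornerD hornerN !SE.
    by rewrite addrAC [RHS]addrC.
  have sq' : (size q' <= K)%N.
    rewrite (leq_trans (size_polyD _ _)) // geq_max sq /=.
    have sS f : size (S f) = K.+1 by rewrite size_prod_XsubC size_iota subn1.
    have mS f : (S f)`_K = 1.
      by have := monicP (monic_prod_XsubC (index_iota 1 K.+1) xpredT f); rewrite /lead_coef sS.
    apply/leq_sizeP => i; rewrite leq_eqVlt => /predU1P[<-|Ki].
      by rewrite coefB !mS subrr.
    by rewrite coefB !nth_default ?subrr // sS.
  rewrite q'E (lagrange_interpolation 0 nodes_inj) // -sumrN.
  rewrite !big_seq; apply: eq_bigr => s /mem1 s1.
  rewrite -/(lagrange0 z K s) mulrA -mulNr; congr (_ * _).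
  have [<- _] := pdress_near_axis p 1 s1.
  by rewrite -q'E prod_vanish // subr0.
Qed.

Variable eps : T -> R.
Hypotheses (eps_ge0 : forall p, 0 <= eps p)
  (delta_bigo : forall s, (1 <= s <= K)%N -> bigo F eps (delta s))
  (z_norm : \prod_(1 <= r < K.+1) (0 - z r) = \prod_(1 <= r < K.+1) (0 - (z r)^*)).

(** In the diagonal sums each delta multiplies an off-diagonal entry, which tends to 0, so they are
    o(eps). In the off-diagonal sums it multiplies a diagonal entry, whose limit gives
    [mode_coef]. *)
Lemma dress0_expansion (zeta : T -> C) :
  (forall p, zeta p = \sum_(1 <= s < K.+1) mode_coef z K s * delta s p) ->
  forall i j, smallo F eps (fun p => (dress z (v p) K 0 - 1%:M
    + (zeta p *: delta_mx 0 1 - (zeta p)^* *: delta_mx 1 0)) i j).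
Proof.
move=> zetaE; set Pz := \prod_(1 <= r < K.+1) (0 - (z r)^*).
have Pz0 : Pz != 0.
  rewrite /Pz prodf_seq_neq0; apply/allP => r /mem1 r1; apply/implyP => _.
  by rewrite sub0r oppr_eq0 conjC_eq0; case: gz => /(_ _ r1).
(* Reality of the normalizing product makes the two off-diagonal coefficients conjugate up to
   sign. *)
have PzC : Pz^* = Pz.
  transitivity (\prod_(1 <= r < K.+1) (0 - z r)); last exact: z_norm.
  rewrite /Pz rmorph_prod; apply: eq_bigr => r _.
  by rewrite rmorphB rmorph0 /= conjCK.
have conjP s : (\prod_(1 <= r < K.+1) (z s - (z r)^*))^* =
    \prod_(1 <= r < K.+1) ((z s)^* - z r).
  by rewrite rmorph_prod; apply: eq_bigr => r _; rewrite rmorphB /= conjCK.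
have dE p : dress z (v p) K 0 = Pz^-1 *: pdress z (v p) K 0.
  rewrite pdressE => [|s s1]; first by rewrite scalerA mulVf // scale1r.
  by rewrite eq_sym conjC_eq0; case: gz => /(_ _ s1).
have lim i j lam : tendsto F (fun p => pdress z (v p) K lam i j)
    ((\prod_(1 <= s < K.+1) (lam - (z s)^*) *: (1%:M - E)
      + \prod_(1 <= s < K.+1) (lam - z s) *: E) i j) by apply: tendsto_pdress.
(* Replacing each node value by its limit costs o(eps), because it is multiplied by a delta of order
   eps. *)
have small (c : nat -> C) (g : nat -> T -> C) (a : nat -> C) :
    (forall s, (1 <= s <= K)%N -> tendsto F (g s) (a s)) ->
    smallo F eps (fun p => \sum_(1 <= s < K.+1) delta s p * (c s * (g s p - a s))) /\
    smallo F eps (fun p => \sum_(1 <= s < K.+1) (delta s p)^* * (c s * (g s p - a s))).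
  move=> h; have t0 s : (1 <= s <= K)%N -> tendsto F (fun p => c s * (g s p - a s)) 0.
    move=> s1; rewrite -(mulr0 (c s)) -(subrr (a s)).
    apply: tendstoM; first exact: tendsto_cst.
    by apply: tendstoD; [exact: h|exact: tendsto_cst].
  split; apply: smallo_sum => // s /mem1 s1; apply: bigo_smallo; try exact: t0.
    exact: delta_bigo.
  exact/bigo_conj/delta_bigo.
move=> i j; case: (ord2P i) => ->; case: (ord2P j) => ->.
- apply: (eq_smallo _ (small (fun s => (lagrange0 z K s)^* / Pz)
    (fun s p => pdress z (v p) K (z s)^* 0 1) (fun=> 0) _).2) => [p|s s1]; last first.
    by have := lim 0 1 (z s)^*; rewrite !mxE /= subrr !mulr0 addr0.
  have [h00 _ _ _] := pdress0_entries p.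
  rewrite dE !mxE /= !mulr0 subr0 addr0 -[in RHS](mulVf Pz0) -mulrBr h00 mulr_sumr.
  by apply: eq_bigr => s _; rewrite subr0; ring.
- apply: (eq_smallo _ (small (fun s => - lagrange0 z K s / Pz)
    (fun s p => pdress z (v p) K (z s) 0 0)
    (fun s => \prod_(1 <= r < K.+1) (z s - (z r)^*)) _).1) => [p|s s1]; last first.
    by have := lim 0 0 (z s); rewrite !mxE /= subr0 mulr1 mulr0 addr0.
  have [_ h01 _ _] := pdress0_entries p.
  rewrite dE !mxE /= mulr0 mulr1 !subr0 h01 mulrN mulr_sumr zetaE addrC -sumrB.
  apply: eq_bigr => s _; rewrite /mode_coef -/Pz.
  by move: (\prod_(1 <= r < K.+1) (z s - _)) (Pz^-1) (lagrange0 z K s) => *; ring.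
- apply: (eq_smallo _ (small (fun s => (lagrange0 z K s)^* / Pz)
    (fun s p => pdress z (v p) K (z s)^* 1 1)
    (fun s => \prod_(1 <= r < K.+1) ((z s)^* - z r)) _).2) => [p|s s1]; last first.
    by have := lim 1 1 (z s)^*; rewrite !mxE /= subrr mulr0 mulr1 add0r.
  have [_ _ h10 _] := pdress0_entries p.
  rewrite dE !mxE /= mulr0 mulr1 subr0 add0r h10 mulr_sumr zetaE rmorph_sum -sumrB.
  apply: eq_bigr => s _; rewrite /mode_coef -/Pz !rmorphM fmorphV /= PzC conjP.
  by move: (\prod_(1 <= r < K.+1) (_ - _)) (Pz^-1) ((lagrange0 z K s)^*) => *; ring.
- apply: (eq_smallo _ (small (fun s => - lagrange0 z K s / Pz)
    (fun s p => pdress z (v p) K (z s) 1 0) (fun=> 0) _).1) => [p|s s1]; last first.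
    by have := lim 1 0 (z s); rewrite !mxE /= subrr !mulr0 addr0.
  have [_ _ _ h11] := pdress0_entries p; move: h11; rewrite z_norm -/Pz => h11.
  rewrite dE !mxE /= !mulr0 subr0 addr0 -[in RHS](mulVf Pz0) -mulrBr h11 mulrN mulr_sumr.
  rewrite -sumrN; apply: eq_bigr => s _; rewrite subr0.
  by move: (Pz^-1) => *; ring.
Qed.

End TwoDim.

(** * The spectral parameters z(j, l) *)

Section SpectralPoints.
Context {R : realType} (n : nat) (m : int).
Hypotheses (n_gt0 : (0 < n)%N) (m_neq0 : m != 0).
Notation C := R[i].
Notation h := (nmR n m : R).

(** The rate tau. The radicand equals (h/2)^2 - (j - h/2)^2 - (l - h/2)^2, positive exactly in the
    disc. *)
Definition growth (j l : int) : R :=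
  Num.sqrt (j%:~R * (h - j%:~R) - (l%:~R - h / 2) ^+ 2).

Lemma mR_neq0 : m%:~R != 0 :> R. Proof. by rewrite intr_eq0. Qed.

Lemma nmR_neq0 : h != 0.
Proof. by rewrite /nmR mulf_neq0 ?mR_neq0 // pnatr_eq0 -lt0n. Qed.

Section Disc.
Variables j l : int.
Hypothesis jl : in_disc (R := R) n m j l.
Notation jr := (j%:~R : R).
Notation lr := (l%:~R : R).
Notation sg := (Num.sg (m%:~R : R)).

Lemma disc_gt0 : 0 < jr * (h - jr) - (lr - h / 2) ^+ 2.
Proof.
move: jl; rewrite /in_disc -subr_gt0; congr (_ < _).
by move: (h) => k; field.
Qed.

Lemma growth_gt0 : 0 < growth j l.
Proof. by rewrite sqrtr_gt0 disc_gt0. Qed.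

Lemma growth_sqr : growth j l ^+ 2 = jr * (h - jr) - (lr - h / 2) ^+ 2.
Proof. by rewrite sqr_sqrtr // ltW ?disc_gt0. Qed.

Lemma disc_prod_gt0 : 0 < jr * (h - jr).
Proof. by rewrite (lt_le_trans disc_gt0) // gerBl sqr_ge0. Qed.

Lemma disc_j_neq0 : jr != 0.
Proof. by apply: contraTneq disc_prod_gt0 => ->; rewrite mul0r ltxx. Qed.

Lemma disc_sg : 0 < sg * jr.
Proof.
have h2 : 0 < h * jr.
  have -> : h * jr = jr * (h - jr) + jr ^+ 2 by ring.
  by rewrite ltr_wpDr ?sqr_ge0 ?disc_prod_gt0.
have nR0 : 0 < n%:R :> R by rewrite ltr0n.
move: h2; rewrite /nmR -mulrA (pmulr_rgt0 _ nR0).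
move: mR_neq0; move: (m%:~R : R) => M; case: (ltgtP M 0) => // M0 _.
  by rewrite (nmulr_rgt0 _ M0) ltr0_sg // mulN1r oppr_gt0.
by rewrite (pmulr_rgt0 _ M0) gtr0_sg // mul1r.
Qed.

Lemma sg_sqr : sg * sg = 1.
Proof. by rewrite -expr2 sqr_sg mR_neq0. Qed.

(** With S = sqrt(j (h - j)) the modulus of z is S / |j|, while its cosine and sine carry sgn(m) /
    S. So S cancels, and sgn(m) / |j| = 1 / j because j has the sign of m. *)
Lemma zparE : zpar n m j l = (jr%:C)^-1 * ((lr - h / 2) +i* growth j l).
Proof.
have sg0 : sg != 0 by rewrite sgr_eq0 mR_neq0.
have sgjE : `|jr| = sg * jr.
  have : `|sg * jr| = sg * jr by rewrite gtr0_norm ?disc_sg.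
  by rewrite normrM normr_sg mR_neq0 mul1r.
pose S := Num.sqrt (jr * (h - jr)).
have S0 : 0 < S by rewrite sqrtr_gt0 disc_prod_gt0.
have S2 : S ^+ 2 = jr * (h - jr) by rewrite sqr_sqrtr // ltW ?disc_prod_gt0.
have rootE : Num.sqrt ((h - jr) / jr) = S / (sg * jr).
  have -> : (h - jr) / jr = (S / (sg * jr)) ^+ 2.
    rewrite expr_div_n S2 exprMn [sg ^+ 2]expr2 sg_sqr mul1r.
    by field; exact: disc_j_neq0.
  by rewrite sqrtr_sqr ger0_norm // divr_ge0 // ltW ?disc_sg.
have cosE : cos_theta n m j l = sg * ((lr - h / 2) / S) by [].
have sinE : sin_theta n m j l = sg * (growth j l / S).
  rewrite /sin_theta cosE; congr (_ * _).
  have -> : 1 - (sg * ((lr - h / 2) / S)) ^+ 2 = (growth j l / S) ^+ 2.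
    rewrite exprMn [sg ^+ 2]expr2 sg_sqr mul1r !expr_div_n growth_sqr.
    by rewrite -[X in X - _](divff (lt0r_neq0 (exprn_gt0 2 S0))) {1}S2 -mulrBl.
  by rewrite sqrtr_sqr ger0_norm // divr_ge0 ?ltW ?growth_gt0.
rewrite /zpar rootE cosE sinE.
have S0' : S != 0 by rewrite gt_eqF.
have j0 := disc_j_neq0.
have key u : S / (sg * jr) * (sg * (u / S)) = jr^-1 * u.
  by field; rewrite S0' j0 sg0.
rewrite -[(jr%:C)^-1]fmorphV /=.
by apply/eqP; rewrite eq_complex /=; apply/andP; split; apply/eqP;
  rewrite !mul0r ?subr0 ?addr0 !key.
Qed.

Lemma zpar_Re : complex.Re (zpar n m j l : C) = (lr - h / 2) / jr.
Proof. by rewrite zparE -fmorphV /= mul0r subr0 mulrC. Qed.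

Lemma zpar_Im : complex.Im (zpar n m j l : C) = growth j l / jr.
Proof. by rewrite zparE -fmorphV /= mul0r addr0 mulrC. Qed.

Lemma zpar_neq0 : zpar n m j l != 0 :> C.
Proof.
apply/eqP => /(congr1 (@complex.Im R)); rewrite zpar_Im => /eqP.
by rewrite mulf_eq0 invr_eq0 (negPf disc_j_neq0) orbF gt_eqF ?growth_gt0.
Qed.

Lemma zpar_norm : (zpar n m j l : C) * (zpar n m j l)^* = ((h - jr) / jr)%:C.
Proof.
have -> : zpar n m j l = complex.Re (zpar n m j l) +i* complex.Im (zpar n m j l) :> C.
  by case: (zpar _ _ _ _).
rewrite zpar_Re zpar_Im; apply/eqP; rewrite eq_complex /=.
have j0 := disc_j_neq0; apply/andP; split; apply/eqP; last by ring.
rewrite mulrN opprK -!expr2 !expr_div_n growth_sqr.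
by field.
Qed.

End Disc.

(** The reflection changes the sign of l - h/2, hence of the real part of z, and keeps tau. *)
Lemma zpar_mirror j l : in_disc (R := R) n m j l ->
  in_disc (R := R) n m j (n%:Z * m - l) /\
  zpar n m j (n%:Z * m - l) = - (zpar n m j l)^* :> C.
Proof.
move=> d1.
have lE : (n%:Z * m - l)%:~R - h / 2 = - (l%:~R - h / 2).
  by rewrite rmorphB rmorphM /= /nmR; field.
have d2 : in_disc (R := R) n m j (n%:Z * m - l) by rewrite /in_disc lE sqrrN.
split=> //; rewrite !zparE // lE /growth lE sqrrN.
rewrite -fmorphV; apply/eqP; rewrite eq_complex /=.
by apply/andP; split; apply/eqP; ring.
Qed.

(** The squared modulus h/j - 1 determines j, and then the real part determines l. *)
Lemma zpar_inj j l j' l' : in_disc (R := R) n m j l -> in_disc (R := R) n m j' l' ->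
  zpar n m j l = zpar n m j' l' :> C -> (j, l) = (j', l').
Proof.
move=> d1 d2 E.
have := zpar_norm d1; rewrite E zpar_norm //.
have [j0 j0'] := (disc_j_neq0 d1, disc_j_neq0 d2).
move=> /(congr1 (@complex.Re R)) /= E1.
have jj : j%:~R = j'%:~R :> R.
  have E2 : h / j'%:~R = h / j%:~R.
    by move: E1; rewrite !mulrBl !divff // => /addIr.
  by move/(mulfI nmR_neq0)/invr_inj: E2.
have {jj} jj : j = j' by apply: (@intr_inj R).
have := congr1 (@complex.Re R) E; rewrite !zpar_Re // jj => E3.
have ll : l%:~R = l'%:~R :> R.
  move: E3 => /(congr1 (fun w => w * j'%:~R + h / 2)).
  by rewrite !mulfVK // !subrK.
by rewrite (@intr_inj R _ _ ll).
Qed.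

(** The imaginary part tau / j has the sign of m, so all parameters lie in one open half plane and
    their conjugates in the other. *)
Lemma zpar_nconj j l j' l' : in_disc (R := R) n m j l -> in_disc (R := R) n m j' l' ->
  zpar n m j l != (zpar n m j' l')^* :> C.
Proof.
move=> d1 d2; apply/eqP => /(congr1 (@complex.Im R)).
have -> : complex.Im ((zpar n m j' l')^* : C) = - complex.Im (zpar n m j' l' : C).
  by case: (zpar _ _ _ _).
rewrite !zpar_Im // => E.
have pos j1 l1 : in_disc (R := R) n m j1 l1 -> 0 < Num.sg m%:~R * (growth j1 l1 / j1%:~R).
  move=> d; rewrite mulrCA pmulr_rgt0 ?growth_gt0 //.
  have -> : Num.sg m%:~R / j1%:~R = Num.sg m%:~R * j1%:~R / j1%:~R ^+ 2 :> R.
    by field; exact: disc_j_neq0 d.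
  apply: divr_gt0; first exact: disc_sg d.
  by rewrite exprn_even_gt0 //= (disc_j_neq0 d).
have := pos _ _ d1; rewrite E mulrN oppr_gt0 => /lt_trans/(_ (pos _ _ d2)).
by rewrite ltxx.
Qed.

End SpectralPoints.

(** * The family of 2N parameters: genericity and product identities *)

Section Family.
Context {R : realType} (n N : nat) (m : int) (j l : nat -> int).
Notation C := R[i].
Hypotheses (n_gt0 : (0 < n)%N) (m_neq0 : m != 0)
    (hdisc : forall k : nat, (1 <= k <= N)%N ->
       in_disc (R := R) n m (j (2 * k - 1)%N) (l (2 * k - 1)%N))
    (hl : forall k : nat, (1 <= k <= N)%N ->
       nmR n m / 2 < (l (2 * k - 1)%N)%:~R :> R)
    (hdist : forall k h : nat, (1 <= k)%N -> (k < h)%N -> (h <= N)%N ->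
       (j (2 * k - 1)%N, l (2 * k - 1)%N) <> (j (2 * h - 1)%N, l (2 * h - 1)%N))
    (heven : forall k : nat, (1 <= k <= N)%N ->
       j (2 * k)%N = j (2 * k - 1)%N /\
       l (2 * k)%N = n%:Z * m - l (2 * k - 1)%N).

Notation z := (fun s => zpar n m (j s) (l s) : C).

Lemma indexP s : (1 <= s <= 2 * N)%N ->
  exists2 k, (1 <= k <= N)%N & s = (2 * k - 1)%N \/ s = (2 * k)%N.
Proof.
move=> /andP[s1 sN]; exists (uphalf s).
  rewrite uphalf_gt0 s1 /= leq_uphalf_double -mul2n.
  by [].
rewrite uphalf_half; case: (odd s) (odd_double_half s) => /= E; [left|right];
  rewrite -{1}E -mul2n ?mulnDr ?muln1 ?add0n //.
Qed.

Lemma disc_all s : (1 <= s <= 2 * N)%N -> in_disc (R := R) n m (j s) (l s).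
Proof.
move=> /indexP[k k1 [->|->]]; first exact: hdisc.
by have [-> ->] := heven k1; case: (zpar_mirror n_gt0 m_neq0 (hdisc k1)).
Qed.

(** Odd indices have l above nm/2 and their mirror images lie below, so an odd and an even index
    never share a pair. *)
Lemma key_inj s r : (1 <= s <= 2 * N)%N -> (1 <= r <= 2 * N)%N ->
  (j s, l s) = (j r, l r) -> s = r.
Proof.
have odd_inj k h : (1 <= k <= N)%N -> (1 <= h <= N)%N ->
    (j (2 * k - 1)%N, l (2 * k - 1)%N) = (j (2 * h - 1)%N, l (2 * h - 1)%N) -> k = h.
  move=> /andP[k1 kN] /andP[h1 hN] E; case: (ltngtP k h) => // kh; exfalso.
    exact: (hdist k1 kh hN).
  by apply: (hdist h1 kh kN).
have odd_even k h : (1 <= k <= N)%N -> (1 <= h <= N)%N ->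
    l (2 * k - 1)%N = n%:Z * m - l (2 * h - 1)%N -> False.
  move=> k1 h1 E; have := hl k1; have := hl h1; rewrite E rmorphB rmorphM /= /nmR.
  by move: (l _)%:~R => u; lra.
move=> /indexP[k k1 sk] /indexP[h h1 rh]; case: sk => ->; case: rh => ->.
- by move=> /(odd_inj _ _ k1 h1) ->.
- by have [-> ->] := heven h1 => -[_ /(odd_even _ _ k1 h1)].
- have [-> ->] := heven k1 => -[_] /esym; move=> E; exfalso; exact: (odd_even _ _ h1 k1 E).
- have [-> ->] := heven k1; have [-> ->] := heven h1 => -[E1 E2].
  by rewrite (odd_inj _ _ k1 h1) // E1 (oppr_inj (addrI _ E2)).
Qed.

Lemma generic_z : generic z (2 * N).
Proof.
split=> [s s1|s r s1 r1]; first exact: (zpar_neq0 n_gt0 m_neq0 (disc_all s1)).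
split; first exact: (zpar_nconj n_gt0 m_neq0 (disc_all s1) (disc_all r1)).
apply: contra => /eqP; move=> /(zpar_inj n_gt0 m_neq0 (disc_all s1) (disc_all r1)) E.
by apply/eqP; apply: key_inj.
Qed.

Lemma prod_pairs (f g : nat -> C) :
  (forall k, (1 <= k <= N)%N -> f (2 * k - 1)%N * f (2 * k)%N = g (2 * k - 1)%N * g (2 * k)%N) ->
  \prod_(1 <= s < (2 * N).+1) f s = \prod_(1 <= s < (2 * N).+1) g s.
Proof.
suff H N' : (N' <= N)%N -> (forall k, (1 <= k <= N)%N ->
    f (2 * k - 1)%N * f (2 * k)%N = g (2 * k - 1)%N * g (2 * k)%N) ->
  \prod_(1 <= s < (2 * N').+1) f s = \prod_(1 <= s < (2 * N').+1) g s by exact: H.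
move=> NN fg; elim: N' NN => [|k IH] kN; first by rewrite !big_geq.
have rec (e : nat -> C) : \prod_(1 <= s < (2 * k.+1).+1) e s =
    \prod_(1 <= s < (2 * k).+1) e s * (e (2 * k.+1 - 1)%N * e (2 * k.+1)%N).
  by rewrite mulnS add2n subn1 /= big_nat_recr //= big_nat_recr //= mulrA.
by rewrite (rec f) (rec g) (IH (ltnW kN)) fg.
Qed.

Lemma z_even k : (1 <= k <= N)%N -> z (2 * k)%N = - (z (2 * k - 1)%N)^*.
Proof.
move=> k1; have [-> ->] := heven k1.
by case: (zpar_mirror n_gt0 m_neq0 (hdisc k1)).
Qed.

Lemma prod_z_conj : \prod_(1 <= r < (2 * N).+1) (0 - z r) =
  \prod_(1 <= r < (2 * N).+1) (0 - (z r)^*).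
Proof.
apply: prod_pairs => k k1; rewrite z_even // rmorphN /= conjCK.
by ring.
Qed.

(** The left side is both the determinant of the dressing product at 0 and the n-th power of the
    product of the normalizing constants. *)
Lemma prod_z_div : \prod_(1 <= r < (2 * N).+1) (z r / (z r)^*) = 1.
Proof.
have [z0 _] := generic_z.
rewrite (@prod_pairs _ (fun=> 1)); first by rewrite big1.
move=> k k1; rewrite z_even // rmorphN /= conjCK mulr1.
have : (1 <= 2 * k - 1 <= 2 * N)%N.
  case/andP: k1; case: k => // k _ kN; rewrite mulnS add2n subn1 /= (leq_trans _ (leq_mul (leqnn 2) kN)) //.
  by rewrite mulnS add2n ltnW.
move=> /z0; set w := zpar _ _ _ _ => w0.
have w0' : w^* != 0 by rewrite conjC_eq0.
by move: (w^*) w0' => w' w0'; field; rewrite w0 w0'.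
Qed.

End Family.

(** * The complex exponential *)

Section ComplexExponential.
Context {R : realType}.
Notation C := R[i].

Lemma cexpD (a b : C) : cexp (a + b) = cexp a * cexp b.
Proof.
case: a b => [a a'] [b b']; rewrite /cexp /= expRD cosD sinD.
by apply/eqP; rewrite eq_complex /=; apply/andP; split; apply/eqP; ring.
Qed.

Lemma cexp0 : cexp (0 : C) = 1.
Proof. by rewrite /cexp /= expR0 cos0 sin0 mulr1 mulr0. Qed.

Lemma cexpN (a : C) : cexp (- a) = (cexp a)^-1.
Proof.
have E : cexp (- a) * cexp a = 1 by rewrite -cexpD addNr cexp0.
have a0 : cexp a != 0 by apply/eqP => a0; move/eqP: E; rewrite a0 mulr0 eq_sym oner_eq0.
by rewrite -[RHS]mul1r -E mulfK.
Qed.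

Lemma cexp_neq0 (a : C) : cexp a != 0.
Proof.
have E : cexp (- a) * cexp a = 1 by rewrite -cexpD addNr cexp0.
by apply/eqP => a0; move/eqP: E; rewrite a0 mulr0 eq_sym oner_eq0.
Qed.

Lemma norm_cexp (a : C) : `|cexp a| = (expR (complex.Re a))%:C.
Proof.
rewrite normc_def /cexp /= !exprMn -mulrDr cos2Dsin2 mulr1 sqrtr_sqr.
by rewrite ger0_norm // expR_ge0.
Qed.

Lemma cexp_sum (I : Type) (r : seq I) (f : I -> C) :
  cexp (\sum_(i <- r) f i) = \prod_(i <- r) cexp (f i).
Proof. by elim/big_ind2: _ => [|? ? ? ? <- <-|]; rewrite ?cexp0 // cexpD. Qed.

Lemma imul_real (r : R) : 'i%C * r%:C = 0 +i* r :> C.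
Proof. by apply/eqP; rewrite eq_complex /=; apply/andP; split; apply/eqP; ring. Qed.

Lemma cexp_2pi (k : int) : cexp ('i%C * (k%:~R * (2 * pi))%:C) = 1 :> C.
Proof.
have nat_case (k' : nat) : cexp ('i%C * (k'%:R * (2 * pi))%:C) = 1 :> C.
  elim: k' => [|k' IH]; first by rewrite mul0r mulr0 cexp0.
  rewrite -natr1 mulrDl mul1r rmorphD mulrDr cexpD IH mul1r.
  by rewrite imul_real /cexp /= expR0 !mul1r mulr_natl cos2pi sin2pi.
case: k => k'; first exact: nat_case.
by rewrite NegzE rmorphN /= mulNr rmorphN mulrN cexpN nat_case invr1.
Qed.

End ComplexExponential.

Lemma det_adj {R : realType} n (A : 'M[R[i]]_n) : \det (A^t*) = (\det A)^*.
Proof. by rewrite det_map_mx det_tr. Qed.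

(** * Closed form of the iterated transformation *)

Section IteratedBacklund.
Context {R : realType} {n : nat}.
Notation C := R[i].
Variables (c z : nat -> C) (q : nat -> R -> R -> R -> 'cV[C]_n)
  (psi : R -> R -> R -> C -> 'M[C]_n) (J : R -> R -> R -> 'M[C]_n).

Notation v x y t := (fun s => psi x y t (z s) *m q s x y t).

Lemma backlund_iter_ext k x y t lam :
  (backlund_iter c z q psi J k).1 x y t lam = dress z (v x y t) k lam *m psi x y t lam.
Proof.
elim: k lam => [|k IH] lam; first by rewrite mul1mx.
rewrite -[LHS]/(backlund_ext (z k.+1) (q k.+1) (backlund_iter c z q psi J k).1 x y t lam).
rewrite /backlund_ext /proj_tilde (IH lam) (IH (z k.+1)) dressS /dproj /=.
by rewrite -[_ *m _ *m q _ _ _ _]mulmxA mulmxA.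
Qed.

(** Each step multiplies [J] on the right by the adjoint of its factor at 0; in this order the
    adjoints form the adjoint of the whole product. *)
Lemma backlund_iter_ward k x y t :
  (backlund_iter c z q psi J k).2 x y t =
  \prod_(1 <= s < k.+1) c s *: (J x y t *m (dress z (v x y t) k 0)^t*).
Proof.
elim: k => [|k IH]; first by rewrite big_geq // scale1r /= adj1 mulmx1.
rewrite -[LHS]/(backlund_ward (c k.+1) (z k.+1) (q k.+1) (backlund_iter c z q psi J k).1
  (backlund_iter c z q psi J k).2 x y t).
rewrite /backlund_ward /proj_tilde IH backlund_iter_ext [in RHS]big_nat_recr //=.
rewrite -[_ *m _ *m q _ _ _ _]mulmxA.
rewrite -scalemxAl scalerA [c _ * _]mulrC; congr (_ *: _).
rewrite adjM (mulmxA (J x y t)); congr (_ *m _).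
move: (line_proj_adj (dress z (v x y t) k (z k.+1) *m (psi x y t (z k.+1) *m q k.+1 x y t))).
move: (line_proj _) => P Ph.
rewrite /h_factor adjD adjZ adjD adjN adj1 Ph addrC; congr (_ + _ *: _).
by rewrite !sub0r mulNr invrN mulrN opprK fmorph_div /= conjCK.
Qed.

(** At 0 each factor is a rank-one update of the identity with determinant z / z^*, provided its
    line is not degenerate; [dress_unitary] keeps the vectors nonzero. *)
Lemma det_dress0 (w : nat -> 'cV[C]_n) k K : generic z K -> (k <= K)%N ->
  (forall s, (1 <= s <= K)%N -> w s != 0) ->
  \det (dress z w k 0) = \prod_(1 <= s < k.+1) (z s / (z s)^*).
Proof.
move=> [z0 gz] kK w0; elim: k kK => [|k IH] kK; first by rewrite big_geq // det1.
have k1 : (1 <= k.+1 <= K)%N by rewrite kK.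
have z0' : (z k.+1)^* != 0 by rewrite conjC_eq0 z0.
rewrite dressS det_mulmx (IH (ltnW kK)) [in RHS]big_nat_recr //= [RHS]mulrC.
congr (_ * _); rewrite h_factorE; last by rewrite eq_sym.
rewrite det_line_proj.
  by move: (z0'); move: (z k.+1)^* => u u0; field; rewrite ?sub0r ?oppr_eq0.
apply: contraNneq (w0 _ k1) => h0.
have := @dress_unitary _ _ z w k (z k.+1).
have zz s : (1 <= s <= k)%N -> z k.+1 != z s /\ z k.+1 != (z s)^*.
  move=> /andP[s1 sk]; have sK : (1 <= s <= K)%N by rewrite s1 (leq_trans sk (ltnW kK)).
  have [h1 h2] := gz _ _ k1 sK; split=> //; apply: h2.
  by rewrite gtn_eqF.
move=> /(_ zz) /(congr1 (fun M => M *m w k.+1)).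
by rewrite -mulmxA h0 mulmx0 mul1mx => <-.
Qed.

End IteratedBacklund.

(** * The initial solution and its Lax vectors *)

Section InitialData.
Context {R : realType} (n p : nat) (m : int).
Notation C := R[i].
Notation h := (nmR n m : R).
Notation a := (@a_diag R n p m).
Hypotheses (p_gt0 : (0 < p)%N) (p_ltn : (p < n)%N) (m_neq0 : m != 0).

Let n_gt0 : (0 < n)%N. Proof. exact: leq_trans p_gt0 (ltnW p_ltn). Qed.

Lemma a_diagE i : a 0 i = 'i%C * (if (i < p)%N then (n - p)%:R * m%:~R
  else - (p%:R * m%:~R) : R)%:C.
Proof.
rewrite mxE; case: ifP => _; last first.
  by rewrite rmorphN rmorphM /= rmorph_nat rmorph_int mulrN.
by rewrite rmorphM /= rmorph_nat rmorph_int.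
Qed.

Lemma a_diag_conj i : (a 0 i)^* = - a 0 i.
Proof.
rewrite a_diagE; move: (if _ then _ else _) => r.
by rewrite imul_real; apply/eqP; rewrite eq_complex /= oppr0 !eqxx.
Qed.

Lemma a_diag_trace : \sum_i a 0 i = 0.
Proof.
rewrite (bigID (fun i : 'I_n => (i < p)%N)) /=.
rewrite (eq_bigr (fun=> 'i%C * ((n - p)%:R * m%:~R))); last by move=> i ip; rewrite mxE ip.
rewrite [X in _ + X](eq_bigr (fun=> - ('i%C * (p%:R * m%:~R)))); last first.
  by move=> i /negPf ip; rewrite mxE ip.
have cp : #|[pred i : 'I_n | (i < p)%N]| = p.
  rewrite -sum1_card (eq_bigl (fun i : 'I_n => (i < p)%N)) //.
  by rewrite (big_ord_narrow (ltnW p_ltn)) sum1_card card_ord.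
have cnp : #|[pred i : 'I_n | ~~ (i < p)%N]| = (n - p)%N.
  rewrite -[X in (X - _)%N](card_ord n) -(cardC [pred i : 'I_n | (i < p)%N]) cp addKn.
  by apply: eq_card => i; rewrite !inE.
rewrite !sumr_const cp cnp -[X in X + _]mulr_natr -[X in _ + X]mulr_natr; apply/eqP; rewrite mulNr subr_eq0 -!mulrA; apply/eqP.
by congr (_ * _); rewrite mulrCA [RHS]mulrCA; congr (_ * _); rewrite mulrC.
Qed.

Lemma a_diag_Re i : complex.Re (a 0 i) = 0.
Proof. by rewrite a_diagE imul_real. Qed.

Lemma cexplin_t0 (b1 b2 : C) x y t : cexplin b1 b2 0 x y t = cexplin b1 b2 0 x y 0.
Proof. by rewrite /cexplin /clin !mul0r. Qed.

Lemma J0E x y i k : J0 n p m x y i k =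
  (cexplin (- a 0 i) (- a 0 i) 0 x y 0) *+ (i == k).
Proof.
rewrite /J0 /exp_diag mxE [X in X *+ _]mxE mxE; congr (cexp _ *+ _).
by rewrite /clin mulr0 addr0 rmorphD /= !mulNr mulrDl opprD ![a 0 i * _]mulrC.
Qed.

Lemma J0_unitary x y : J0 n p m x y \is unitarymx (C := C).
Proof.
have adjE (A : 'M[C]_n) i k : (A^t*) i k = (A k i)^* by rewrite !mxE.
apply/unitarymxP/matrixP => i k; rewrite mxE (bigD1 i) //= big1 ?addr0 => [|r ri].
  rewrite adjE !J0E eqxx mulr1n [RHS]mxE eq_sym.
  have [->|ik] := eqVneq i k; last by rewrite mulr0n rmorph0 mulr0.
  rewrite mulr1n -normCK norm_cexp clinE /= /rlin raddfN /= a_diag_Re oppr0.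
  by rewrite !mul0r !addr0 expR0 expr1n.
by rewrite J0E eq_sym (negPf ri) mulr0n mul0r.
Qed.

Lemma J0_det x y : \det (J0 n p m x y) = 1 :> C.
Proof.
rewrite /J0 /exp_diag det_diag.
under eq_bigr => i _ do rewrite mxE.
rewrite -cexp_sum; under eq_bigr => i _ do rewrite mxE.
by rewrite -mulr_sumr a_diag_trace mulr0 cexp0.
Qed.

(** The scalar [w] lets the same facts serve the initial map, w = 1, and the limit map, w =
    omega. *)
Lemma J0_good (w : C) : mgood (stationary (fun x y => w *: J0 n p m x y)).
Proof.
apply: (@mgood_scale _ _ _ (ccst w) (stationary (J0 n p m))); first exact: cgood_cst.
move=> i k.
have -> : ent (stationary (J0 n p m)) i k =
    cmul (ccst ((i == k)%:R)) (cexplin (- a 0 i) (- a 0 i) 0).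
  apply: funext3 => x y t; rewrite /ent /stationary J0E /cmul /ccst mulr_natl.
  by rewrite /cexplin /clin !mul0r.
by apply: cgood_mul; [exact: cgood_cst|exact: cgood_cexplin].
Qed.

Lemma mD_cmul_cst xi (c : C) (f : R -> R -> R -> C) x y t : cdiff f ->
  vD xi (cmul (ccst c) f) x y t = c * vD xi f x y t.
Proof.
by move=> df; rewrite vD_mul ?vD_cst ?mul0r ?add0r //; exact: cdiff_cst.
Qed.

Lemma vD_cexplin xi (b1 b2 b3 : C) x y t : vD xi (cexplin b1 b2 b3) x y t =
  (xi dX * b1 + xi dY * b2 + xi dT * b3) * cexplin b1 b2 b3 x y t.
Proof.
rewrite /vD !cD_cexplin /=; move: (cexplin _ _ _ _ _ _) => e.
by ring.
Qed.

(** [J0] depends only on x + y, so d_x, d_y and d_u all give the logarithmic derivative -a. *)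
Lemma J0_log xi (w : C) x y t : xi dX + xi dY = 1 ->
  mD xi (stationary (fun x y => w *: J0 n p m x y)) x y t =
  stationary (fun x y => w *: J0 n p m x y) x y t *m diag_mx (- a).
Proof.
move=> h1; apply/matrixP => i k; rewrite mul_mx_diag [LHS]mxE [RHS]mxE.
have -> : ent (stationary (fun x y => w *: J0 n p m x y)) i k =
    cmul (ccst (w *+ (i == k))) (cexplin (- a 0 i) (- a 0 i) 0).
  apply: funext3 => x' y' t'; rewrite /ent /stationary mxE J0E /cmul /ccst mulrnAl mulrnAr.
  by rewrite cexplin_t0.
rewrite mD_cmul_cst; last exact/cgood_diff/cgood_cexplin.
rewrite vD_cexplin mulr0 addr0 -mulrDl h1 mul1r /stationary.
rewrite [X in _ = X * _]mxE J0E [(- a) 0 k]mxE cexplin_t0.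
have [<-|ik] := eqVneq i k; last by rewrite !mulr0n !mul0r mulr0 mul0r.
by rewrite !mulr1n -mulrA; congr (w * _); rewrite mulrC.
Qed.

Lemma J0_Dt (w : C) x y t :
  mD eT (stationary (fun x y => w *: J0 n p m x y)) x y t = 0.
Proof.
apply/matrixP => i k; rewrite !mxE.
have -> : ent (stationary (fun x y => w *: J0 n p m x y)) i k =
    cmul (ccst (w *+ (i == k))) (cexplin (- a 0 i) (- a 0 i) 0).
  apply: funext3 => x' y' t'; rewrite /ent /stationary mxE J0E /cmul /ccst mulrnAl mulrnAr.
  by rewrite /cexplin /clin !mul0r.
rewrite mD_cmul_cst; last exact/cgood_diff/cgood_cexplin.
by rewrite vD_cexplin /= !mul0r mulr0 !addr0 mul0r mulr0.
Qed.

Lemma a_skew : (diag_mx (- a))^t* = - diag_mx (- a) :> 'M[C]_n.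
Proof.
apply/matrixP => i k; rewrite 2!mxE [RHS]mxE ![diag_mx _ _ _]mxE ![(- a) 0 _]mxE.
rewrite eq_sym; have [->|_] := eqVneq i k; last by rewrite !mulr0n rmorph0 oppr0.
by rewrite !mulr1n rmorphN /= a_diag_conj.
Qed.

Lemma scaleJ0_unitary (w : C) x y : `|w| = 1 -> w *: J0 n p m x y \is unitarymx (C := C).
Proof.
move=> w1; apply/unitarymxP; rewrite adjZ -scalemxAl -scalemxAr scalerA -normCK w1.
by rewrite expr1n scale1r; apply/unitarymxP/J0_unitary.
Qed.

Lemma cexplin_2pi (b1 b2 b3 : C) (k1 k2 : int) x y t :
  b1 = 'i%C * (k1%:~R)%:C -> b2 = 'i%C * (k2%:~R)%:C ->
  cexplin b1 b2 b3 (x + 2 * pi) y t = cexplin b1 b2 b3 x y t /\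
  cexplin b1 b2 b3 x (y + 2 * pi) t = cexplin b1 b2 b3 x y t.
Proof.
move=> E1 E2; split.
- have -> : cexplin b1 b2 b3 (x + 2 * pi) y t =
      cexplin b1 b2 b3 x y t * cexp ('i%C * (k1%:~R * (2 * pi))%:C).
    rewrite /cexplin -cexpD; congr cexp; rewrite /clin rmorphD rmorphM /= E1.
    by move: ('i%C) ((2 * pi : R)%:C) => *; ring.
  by rewrite cexp_2pi mulr1.
- have -> : cexplin b1 b2 b3 x (y + 2 * pi) t =
      cexplin b1 b2 b3 x y t * cexp ('i%C * (k2%:~R * (2 * pi))%:C).
    rewrite /cexplin -cexpD; congr cexp; rewrite /clin rmorphD rmorphM /= E2.
    by move: ('i%C) ((2 * pi : R)%:C) => *; ring.
  by rewrite cexp_2pi mulr1.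
Qed.

Lemma J0_periodic x y :
  J0 n p m (x + 2 * pi) y = J0 n p m x y :> 'M[C]_n /\
  J0 n p m x (y + 2 * pi) = J0 n p m x y :> 'M[C]_n.
Proof.
have aE i : exists k : int, - a 0 i = 'i%C * (k%:~R)%:C.
  rewrite a_diagE; case: ifP => _.
    exists (- ((n - p)%:Z * m)); rewrite -mulrN -rmorphN /=; congr (_ * _%:C).
    by rewrite rmorphN rmorphM.
  exists (p%:Z * m); rewrite rmorphN mulrN opprK; congr (_ * _%:C).
  by rewrite rmorphM.
split; apply/matrixP => i k; rewrite [LHS]J0E [RHS]J0E; congr (_ *+ _); have [r E] := aE i.
  by case: (cexplin_2pi 0 x y 0 E E).
by case: (cexplin_2pi 0 x y 0 E E).
Qed.

Lemma J0_ward (w : C) : `|w| = 1 -> w ^+ n = 1 ->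
  ward_map_T2 (stationary (fun x y => w *: J0 n p m x y)).
Proof.
move=> w1 wn; split; last first.
  by move=> x y t; rewrite /stationary; have [-> ->] := J0_periodic x y.
split; first exact/mgood_smooth/J0_good.
  by move=> x y t; split; [exact: scaleJ0_unitary|rewrite detZ J0_det mulr1].
apply: (@ward_equation _ _ _ (mcst (diag_mx (- a))) (mcst (diag_mx (- a)))).
- exact: J0_good.
- by move=> x y t; apply: scaleJ0_unitary.
- by move=> x y t; apply: J0_log; rewrite /eU /= add0r.
- by move=> x y t; apply: J0_log; rewrite /eX /= addr0.
- by move=> x y t; rewrite !mD_cst.
Qed.

(** The ratio of the two block entries of psi0(z) q, by [psi0_qvec]. The choice of z and of the
    exponent in f is what makes it a plane wave with integer frequencies, hence periodic. *)
Definition gmode (j l : int) : R -> R -> R -> C :=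
  cexplin (- ('i%C * (j%:~R)%:C)) (- ('i%C * (l%:~R)%:C))
    ((growth n m j l)%:C - 'i%C * (h / 2)%:C).

Definition svec (j l : int) (x y t : R) : 'cV[C]_n :=
  \col_(i < n) (if (i < p)%N then 1 else gmode j l x y t).

Definition a0 : C := 'i%C * ((n - p)%:R * m%:~R).

(** The entry of psi0(z) q on the first block. It is kept because the Lax equations hold for psi0(z)
    q, not for the rescaled [svec]. *)
Definition alpha (z : C) : R -> R -> R -> C :=
  cexplin ((1 - z) * a0) (((1 + z - z ^+ 2) + 1) / 2 * a0)
    (((1 + z - z ^+ 2) - 1) / 2 * a0).

Lemma a_diag_alt (i : 'I_n) : a 0 i = a0 - (if (i < p)%N then 0 else 'i%C * h%:C).
Proof.
rewrite mxE /a0; case: ifP => _; first by rewrite subr0.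
rewrite /nmR rmorphM /= rmorph_nat rmorph_int natrB ?(ltnW p_ltn) //.
by ring.
Qed.

Definition phase (lam : C) (x y t : R) : C :=
  (1 - lam) * x%:C + (1 + lam - lam ^+ 2) * (ucoord y t)%:C - (vcoord y t)%:C.

Lemma psi0_mulE x y t (lam : C) (v : 'cV[C]_n) i k :
  (psi0 n p m x y t lam *m v) i k =
  cexp (phase lam x y t * (a0 - (if (i < p)%N then 0 else 'i%C * h%:C))) * v i k.
Proof.
rewrite -a_diag_alt.
rewrite /psi0 /exp_diag mul_diag_mx mxE; congr (_ * _).
by rewrite [LHS]mxE; congr cexp; rewrite [LHS]mxE.
Qed.

Lemma svecE j l x y t i k :
  svec j l x y t i k = if (i < p)%N then 1 else gmode j l x y t.
Proof. by rewrite mxE. Qed.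

Lemma qvecE j l x y t i k : qvec n p m j l x y t i k =
  if (i < p)%N then 1 else fpar n m j l (wcoord (zpar n m j l) x y t) :> C.
Proof. by rewrite mxE. Qed.

(** The comparison of exponents behind [psi0_qvec], over opaque variables: the relations satisfied
    by z and 1/z enter as hypotheses, and the rest is left to [field]. *)
Lemma exponent_identity (Z Zi X Y T J H L G I U V HJ H2 : C) :
  J * Z = L - H / 2 + I * G -> (H - J) * Zi = L - H / 2 - I * G -> Z * Zi = 1 ->
  I * I = -1 -> U = (T + Y) / 2 -> V = (T - Y) / 2 -> HJ = H - J -> H2 = H / 2 ->
  - (((1 - Z) * X + (1 + Z - Z ^+ 2) * U - V) * (I * H))
    + I * (HJ - H * Z) * (X + Z * U + Zi * V)
  = - (I * J) * X + - (I * L) * Y + (G - I * H2) * T.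
Proof.
move=> r1 r3 r4 r5 -> -> -> ->.
transitivity (I * (- J * X - (J * Z + H) * ((T + Y) / 2) + ((H - J) * Zi) * ((T - Y) / 2)
  + H * (1 - Z * Zi) * ((T - Y) / 2))); first by field.
rewrite r1 r3 r4 subrr mulr0 mul0r addr0.
transitivity (- (I * J) * X - I * L * Y - (I * I) * G * T - I * (H / 2) * T); first by field.
by rewrite r5; field.
Qed.

Section Disc.
Variables j l : int.
Hypothesis jl : in_disc (R := R) n m j l.
Notation z := (zpar n m j l : C).
Notation jc := ((j%:~R : R)%:C).
Notation lc := ((l%:~R : R)%:C).
Notation hc := (h%:C).
Notation gc := ((growth n m j l)%:C).

Lemma disc_rel1 : jc * z = lc - hc / 2 + 'i%C * gc.
Proof.
have j0 : jc != 0 by rewrite (inj_eq (@complexI R)) (disc_j_neq0 jl).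
rewrite (zparE n_gt0 m_neq0 jl) mulrA divff // mul1r.
have -> : lc - hc / 2 = (l%:~R - h / 2)%:C by rewrite rmorphB /= fmorph_div /= rmorph_nat.
rewrite imul_real; apply/eqP; rewrite eq_complex /=.
by rewrite addr0 add0r !eqxx.
Qed.

(** The conjugate of [disc_rel1] multiplied by z, with |z|^2 = (h - j) / j. *)
Lemma disc_rel2 : z * (lc - hc / 2 - 'i%C * gc) = hc - jc.
Proof.
have j0 : jc != 0 by rewrite (inj_eq (@complexI R)) (disc_j_neq0 jl).
have -> : lc - hc / 2 - 'i%C * gc = jc * z^*.
  have <- : jc^* = jc by exact: conjc_real.
  rewrite -rmorphM /= disc_rel1.
  have -> : lc - hc / 2 = (l%:~R - h / 2)%:C by rewrite rmorphB /= fmorph_div /= rmorph_nat.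
  rewrite imul_real; apply/eqP; rewrite eq_complex /=.
  by rewrite ?(addr0, add0r, oppr0, eqxx).
rewrite mulrCA zpar_norm // -rmorphM /= mulrC mulfVK ?(disc_j_neq0 jl) //.
by rewrite rmorphB.
Qed.

Lemma psi0_qvec x y t : psi0 n p m x y t z *m qvec n p m j l x y t =
  alpha z x y t *: svec j l x y t.
Proof.
have z0 : z != 0 by exact: (zpar_neq0 n_gt0 m_neq0 jl).
apply/matrixP => i k; rewrite [LHS]psi0_mulE [RHS]mxE.
rewrite [X in _ * X = _]qvecE [X in _ = _ * X]svecE.
have alphaE : alpha z x y t = cexp (phase z x y t * a0).
  rewrite /alpha /cexplin; congr cexp; rewrite /phase /clin /ucoord /vcoord.
  rewrite !fmorph_div /= rmorphD rmorphB /= rmorph_nat.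
  by move: (z) (x%:C) (y%:C) (t%:C) a0 => Z X Y T A; field.
case: ifP => _; first by rewrite subr0 !mulr1 alphaE.
rewrite alphaE /fpar -cexpD /gmode /cexplin -cexpD; congr cexp.
rewrite mulrBr -addrA; congr (_ + _).
have r3 : (hc - jc) * z^-1 = lc - hc / 2 - 'i%C * gc by rewrite -disc_rel2 mulrC mulKf.
have r4 : z * z^-1 = 1 by rewrite divff.
have r5 : 'i%C * 'i%C = -1 :> C by rewrite -expr2 sqr_i.
have UE : (ucoord y t)%:C = (t%:C + y%:C) / 2 by rewrite fmorph_div /= rmorphD rmorph_nat.
have VE : (vcoord y t)%:C = (t%:C - y%:C) / 2 by rewrite fmorph_div /= rmorphB rmorph_nat.
have HE : (h - j%:~R)%:C = hc - jc by rewrite rmorphB.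
have H2 : (h / 2)%:C = hc / 2 by rewrite fmorph_div /= rmorph_nat.
exact: (@exponent_identity z z^-1 x%:C y%:C t%:C jc hc lc gc 'i%C (ucoord y t)%:C
  (vcoord y t)%:C (h - j%:~R)%:C (h / 2)%:C disc_rel1 r3 r4 r5 UE VE HE H2).
Qed.

Lemma alpha_neq0 x y t : alpha z x y t != 0.
Proof. exact: cexp_neq0. Qed.

Lemma svec_neq0 x y t : svec j l x y t != 0.
Proof.
pose i0 : 'I_n := Ordinal n_gt0.
by apply/eqP => /matrixP/(_ i0 0)/eqP; rewrite !mxE p_gt0 oner_eq0.
Qed.

Let Qv : R -> R -> R -> 'cV[C]_n := fun x y t => psi0 n p m x y t z *m qvec n p m j l x y t.

Let ent_Q i k : ent Qv i k = if (i < p)%N then alpha z else cmul (alpha z) (gmode j l).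
Proof.
apply: funext3 => x y t; rewrite /ent /Qv psi0_qvec mxE svecE.
by case: ifP => _; rewrite ?mulr1.
Qed.

Lemma psi0_qvec_good : mgood Qv.
Proof.
move=> i k; rewrite ent_Q; case: ifP => _; first exact: cgood_cexplin.
by apply: cgood_mul; exact: cgood_cexplin.
Qed.

Lemma psi0_qvec_neq0 x y t : Qv x y t != 0.
Proof. by rewrite /Qv psi0_qvec scaler_eq0 negb_or alpha_neq0 svec_neq0. Qed.

(** The two eigenvalues of -a differ by i h, which the mode has to supply on the second block. *)
Let lax_entry xi x y t :
  (forall x y t, vD xi (alpha z) x y t = - a0 * alpha z x y t) ->
  (forall x y t, vD xi (gmode j l) x y t = 'i%C * hc * gmode j l x y t) ->
  mD xi Qv x y t = diag_mx (- a) *m Qv x y t.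
Proof.
move=> h1 h2; apply/matrixP => i k; rewrite mul_diag_mx [LHS]mxE [RHS]mxE.
rewrite -/(ent Qv i k x y t) ent_Q [(- a) 0 i]mxE a_diag_alt.
case: ifP => _; first by rewrite h1 subr0.
rewrite vD_mul; [|exact/cgood_diff/cgood_cexplin..].
by rewrite h1 h2 /cmul; move: (alpha _ _ _ _) (gmode _ _ _ _ _) => *; ring.
Qed.

Lemma psi0_qvec_laxA x y t : mD (lax z eX eU) Qv x y t = mcst (diag_mx (- a)) x y t *m Qv x y t.
Proof.
apply: lax_entry => x' y' t'.
  rewrite vD_cexplin /lax /=; congr (_ * _).
  by move: (z) a0 => Z A; field.
rewrite vD_cexplin /lax /=; congr (_ * _).
have r1 := disc_rel1; have r5 : 'i%C * 'i%C = -1 :> C by rewrite -expr2 sqr_i.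
rewrite fmorph_div /= rmorph_nat.
move: r1 r5; move: (z) jc hc lc gc ('i%C : C) => Z J H L G I r1 r5.
transitivity (- I * (J * Z) + I * L - G + I * H / 2); first by field.
rewrite r1; transitivity (I * H - (1 + I * I) * G); first by field.
by rewrite r5 subrr mul0r subr0.
Qed.

Lemma psi0_qvec_laxB x y t : mD (lax z eV eX) Qv x y t = mcst (diag_mx (- a)) x y t *m Qv x y t.
Proof.
apply: lax_entry => x' y' t'.
  rewrite vD_cexplin /lax /=; congr (_ * _).
  by move: (z) a0 => Z A; field.
rewrite vD_cexplin /lax /=; congr (_ * _).
have r1 := disc_rel2; have r5 : 'i%C * 'i%C = -1 :> C by rewrite -expr2 sqr_i.
rewrite fmorph_div /= rmorph_nat.
move: r1 r5; move: (z) jc hc lc gc ('i%C : C) => Z J H L G I r1 r5.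
transitivity (I * (Z * (L - H / 2 - I * G)) + I * J + (1 + I * I) * Z * G); first by field.
by rewrite r1 r5 subrr !mul0r addr0; ring.
Qed.

End Disc.

Definition bsize (b : bool) : nat := if b then p else (n - p)%N.
Definition rootsize (b : bool) : R := Num.sqrt (bsize b)%:R.

Lemma rootsize_gt0 b : 0 < rootsize b.
Proof. by rewrite sqrtr_gt0 ltr0n /bsize; case: b => //; rewrite subn_gt0. Qed.

(* Orthonormal frame of the plane spanned by the indicators of the two blocks;
   the second vector is the indicator of the block singled out by [b]. *)
Definition frame (b : bool) : 'M[C]_(n, 2) := \matrix_(i, k)
  if ((i < p)%N == b) then (k == 1)%:R * ((rootsize b)^-1)%:C
  else (k == 0)%:R * ((rootsize (~~ b))^-1)%:C.

Lemma card_block b : #|[pred i : 'I_n | (i < p)%N == b]| = bsize b.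
Proof.
have cp : #|[pred i : 'I_n | (i < p)%N]| = p.
  rewrite -sum1_card (eq_bigl (fun i : 'I_n => (i < p)%N)) //.
  by rewrite (big_ord_narrow (ltnW p_ltn)) sum1_card card_ord.
case: b; first by rewrite -[RHS]cp; apply: eq_card => i; rewrite !inE eqb_id.
rewrite /bsize -[X in (X - _)%N](card_ord n) -(cardC [pred i : 'I_n | (i < p)%N]) cp addKn.
by apply: eq_card => i; rewrite !inE eqbF_neg.
Qed.

Lemma frame_isometry b : (frame b)^t* *m frame b = 1%:M.
Proof.
have rr b' : (bsize b')%:R * (((rootsize b')^-1)%:C * ((rootsize b')^-1)%:C) = 1 :> C.
  rewrite -rmorphM /= -(rmorph_nat (@real_complex R)) -rmorphM /=.
  rewrite -invfM -expr2 sqr_sqrtr ?ler0n // divff // pnatr_eq0.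
  by have := rootsize_gt0 b'; rewrite sqrtr_gt0 ltr0n lt0n.
apply/matrixP => k k'; rewrite [LHS]mxE [RHS]mxE.
rewrite (eq_bigr (fun i : 'I_n => if (i < p)%N == b
    then ((k == 1) && (k' == 1))%:R * (((rootsize b)^-1)%:C * ((rootsize b)^-1)%:C)
    else ((k == 0) && (k' == 0))%:R * (((rootsize (~~ b))^-1)%:C * ((rootsize (~~ b))^-1)%:C))).
  rewrite (bigID (fun i : 'I_n => (i < p)%N == b)) /=.
  rewrite (eq_bigr (fun=> ((k == 1) && (k' == 1))%:R
    * (((rootsize b)^-1)%:C * ((rootsize b)^-1)%:C))) => [|i ->//].
  rewrite [X in _ + X](eq_bigr (fun=> ((k == 0) && (k' == 0))%:R
    * (((rootsize (~~ b))^-1)%:C * ((rootsize (~~ b))^-1)%:C))) => [|i /negPf ->//].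
  rewrite !sumr_const card_block.
  have -> : #|(fun i : 'I_n => ~~ ((i < p)%N == b))| = bsize (~~ b).
    by rewrite -card_block; apply: eq_card => i; rewrite /in_mem /=; case: (i < p)%N; case: (b).
  have rr' b' : ((rootsize b')^-1)%:C * (((rootsize b')^-1)%:C * (bsize b')%:R) = 1 :> C.
    by rewrite -[RHS](rr b') mulrA mulrC.
  rewrite -[X in X + _]mulr_natr -[X in _ + X]mulr_natr -!mulrA !rr'.
  by case: (ord2P k) => ->; case: (ord2P k') => -> /=; rewrite ?mulr1 ?addr0 ?add0r.
have cR (r : R) : (r%:C)^* = r%:C :> C by exact: conjc_real.
move=> i _; rewrite !mxE; case: ifP => _; rewrite rmorphM /= rmorph_nat cR.
  by rewrite -mulnb natrM mulrACA.
by rewrite -mulnb natrM mulrACA.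
Qed.

(** The slope of [svec] in the frame. For [b = true] it is proportional to the mode, small as t ->
    -oo; for [b = false] to its inverse, small as t -> +oo. The root sizes come from normalizing the
    frame. *)
Definition deltab (b : bool) (j l : int) (x y t : R) : C :=
  if b then (rootsize false / rootsize true)%:C * gmode j l x y t
  else (rootsize true / rootsize false)%:C * (gmode j l x y t)^-1.

Lemma svec_frame b j l x y t : exists2 k : C, k != 0 &
  svec j l x y t = k *: (frame b *m near_axis (deltab b j l x y t)).
Proof.
have r0 b' : (rootsize b')%:C != 0 by rewrite (inj_eq (@complexI R)) gt_eqF ?rootsize_gt0.
have g0 : gmode j l x y t != 0 by exact: cexp_neq0.
exists (if b then (rootsize true)%:C else (rootsize false)%:C * gmode j l x y t).
  by case: b; rewrite ?mulf_neq0.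
apply/matrixP => i k; rewrite ord1 !mxE sum2 !mxE /deltab.
have := r0 true; have := r0 false; move: g0.
by case: b; rewrite !fmorph_div /= !fmorphV /=;
  move: (gmode _ _ _ _ _) (rootsize true)%:C (rootsize false)%:C => g u w g0 w0 u0;
  case: ifP => _ /=; rewrite ?(mul0r, mul1r, addr0, add0r, mulr1); field;
  rewrite ?g0 ?u0 ?w0.
Qed.

End InitialData.

(** * Linear independence of the characters of the torus *)

Section FourierIndependence.
Context {R : realType}.
Notation C := R[i].

Definition chi (k : int * int) (x y : R) : C :=
  cexp ('i%C * (k.1%:~R * x + k.2%:~R * y)%:C).

Lemma chiD k x y x' y' : chi k (x + x') (y + y') = chi k x y * chi k x' y'.
Proof.
rewrite /chi -cexpD -mulrDr -rmorphD; congr (cexp (_ * _%:C)).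
by rewrite !mulrDr addrACA.
Qed.

Lemma chi_pi k k' x y : k.1%:~R * x + k.2%:~R * y = k'.1%:~R * x + k'.2%:~R * y + pi ->
  chi k x y != chi k' x y.
Proof.
move=> E; rewrite /chi E rmorphD mulrDr cexpD.
have -> : cexp ('i%C * pi%:C) = -1 :> C.
  rewrite imul_real /cexp /= expR0 !mul1r cospi sinpi.
  by apply/eqP; rewrite eq_complex /= oppr0 !eqxx.
rewrite mulrN1 -subr_eq0 -opprD oppr_eq0 -mulr2n mulrn_eq0 /=.
exact: cexp_neq0.
Qed.

(** On an axis where the frequencies differ, the point is chosen so that the two phases differ by
    exactly pi. *)
Lemma chi_sep k k' : k != k' -> exists x y, chi k x y != chi k' x y.
Proof.
move=> kk; have [E1|n1] := eqVneq k.1 k'.1; last first.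
  have d0 : k.1%:~R - k'.1%:~R != 0 :> R by rewrite subr_eq0 eqr_int.
  exists (pi / (k.1%:~R - k'.1%:~R)), 0; apply: chi_pi.
  by rewrite !mulr0 !addr0; field.
have n2 : k.2 != k'.2.
  by apply: contra kk => /eqP E2; move: E1 E2; case: (k) (k') => ? ? [? ?] /= -> ->.
have d0 : k.2%:~R - k'.2%:~R != 0 :> R by rewrite subr_eq0 eqr_int.
exists 0, (pi / (k.2%:~R - k'.2%:~R)); apply: chi_pi.
by rewrite !mulr0 !add0r; field.
Qed.

(* Dedekind's argument for the independence of distinct characters. *)
Lemma fourier_independence (S : seq (int * int)) (kap : int * int -> C) : uniq S ->
  (forall x y, \sum_(k <- S) kap k * chi k x y = 0) -> forall k, k \in S -> kap k = 0.
Proof.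
elim: S kap => [|k0 S IH] kap //= /andP[k0S uS] h.
have rest k : k \in S -> kap k = 0.
  move=> kS; have k0k : k != k0 by apply: contraNneq k0S => <-.
  have [x0 [y0 sep]] := chi_sep k0k.
  suff H x y : \sum_(k <- S) kap k * (chi k x0 y0 - chi k0 x0 y0) * chi k x y = 0.
    have /eqP := IH _ uS H k kS.
    by rewrite mulf_eq0 subr_eq0 (negPf sep) orbF => /eqP.
  have h1 := h (x + x0) (y + y0); have h2 := h x y.
  rewrite !big_cons in h1 h2.
  transitivity (\sum_(k <- S) kap k * chi k (x + x0) (y + y0)
     - chi k0 x0 y0 * \sum_(k <- S) kap k * chi k x y).
    rewrite mulr_sumr -sumrB; apply: eq_bigr => k' _; rewrite chiD.
    by move: (chi _ _ _) (chi k' x y) (chi k' x0 y0) => *; ring.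
  move/eqP: h1; rewrite addr_eq0 => /eqP h1; move/eqP: h2; rewrite addr_eq0 => /eqP h2.
  rewrite -[X in X - _]opprK -h1 -[X in _ - _ * X]opprK -h2 chiD.
  by move: (chi k0 x y) (chi k0 x0 y0) (kap k0) => *; ring.
move=> k; rewrite in_cons => /predU1P[->|]; last exact: rest.
have := h 0 0; rewrite big_cons big1_seq ?addr0 => [|k' /andP[_ /rest ->]]; last by rewrite mul0r.
by rewrite /chi !mulr0 addr0 mulr0 cexp0 mulr1.
Qed.

End FourierIndependence.

(** * Fourier modes of the linearized equation *)

Section Modes.
Context {R : realType} (n p : nat) (m : int).
Notation C := R[i].
Notation h := (nmR n m : R).
Notation a := (@a_diag R n p m).
Hypotheses (p_gt0 : (0 < p)%N) (p_ltn : (p < n)%N) (m_neq0 : m != 0).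

(** At this stationary map J^-1 J_x = J^-1 J_y = -a and J^-1 J_t = 0, so on an eigenvector of the
    commutator with [a] the linearized operator is multiplication by a scalar, the left side of the
    last hypothesis. *)
Lemma fourier_linearized (w gamma theta : C) (k : int * int) (M : 'M[C]_n) : `|w| = 1 ->
  comm (diag_mx a) M = theta *: M ->
  gamma ^+ 2 - 'i%C * (k.1%:~R)%:C * ('i%C * (k.1%:~R)%:C - theta)
    - 'i%C * (k.2%:~R)%:C * ('i%C * (k.2%:~R)%:C - theta) - gamma * theta = 0 ->
  linearized_ward (stationary (fun x y => w *: J0 n p m x y)) (fourier_mode gamma k M).
Proof.
move=> w1 aM disp.
pose b1 : C := 'i%C * (k.1%:~R)%:C; pose b2 : C := 'i%C * (k.2%:~R)%:C.
pose u0 := stationary (fun x y => w *: J0 n p m x y : 'M[C]_n).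
pose E (c : C) : R -> R -> R -> 'M[C]_n := mscale (cmul (ccst c) (cexplin b1 b2 gamma)) (mcst M).
have unit_u0 x y t : u0 x y t \in unitmx by apply/unitarymx_unit/scaleJ0_unitary.
have AxE : Ax u0 = mcst (diag_mx (- a)).
  apply: funext3 => x y t; rewrite /Ax DxE J0_log.
    exact: (mulKmx (unit_u0 x y t)).
  by rewrite /eX /= addr0.
have AyE : Ay u0 = mcst (diag_mx (- a)).
  apply: funext3 => x y t; rewrite /Ay DyE J0_log.
    exact: (mulKmx (unit_u0 x y t)).
  by rewrite /eY /= add0r.
have AtE : At u0 = mcst 0.
  by apply: funext3 => x y t; rewrite /At DtE J0_Dt mulmx0.
have fE : fourier_mode gamma k M = E 1.
  apply: funext3 => x y t; rewrite /fourier_mode /E /mscale /cmul /ccst /mcst mul1r.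
  congr (cexp _ *: _); rewrite /clin /b1 /b2 rmorphD !rmorphM /=.
  by rewrite mulrDr !mulrA.
have dE (xi : dir -> C) c : mD xi (E c) = E ((xi dX * b1 + xi dY * b2 + xi dT * gamma) * c).
  have dg : cdiff (cmul (ccst c) (cexplin b1 b2 gamma)).
    by apply: cdiff_mul; [exact: cdiff_cst|exact/cgood_diff/cgood_cexplin].
  apply: funext3 => x y t; rewrite /E mD_scale ?mD_cst ?scaler0 ?addr0 //; last first.
    exact/mgood_diff/mgood_cst.
  rewrite /mscale mD_cmul_cst; last exact/cgood_diff/cgood_cexplin.
  rewrite vD_cexplin /cmul /ccst; congr (_ *: _).
  by rewrite mulrCA mulrA.
have cE c x y t : comm (diag_mx (- a)) (E c x y t) = E (- theta * c) x y t.
  rewrite /E /mscale /mcst /comm -scalemxAr -scalemxAl -scalerBr.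
  have -> : diag_mx (- a) *m M - M *m diag_mx (- a) = - (theta *: M).
    have -> : diag_mx (- a) = - diag_mx a by rewrite linearN.
    by rewrite -aM /comm mulNmx mulmxN opprB opprK addrC.
  by rewrite -scaleNr scalerA; congr (_ *: _); rewrite /cmul /ccst; ring.
have EB c c' x y t : E c x y t + E c' x y t = E (c + c') x y t.
  by rewrite /E /mscale /cmul /ccst -scalerDl -mulrDl.
have BxE : (fun x y t => Dx (E 1) x y t + comm (Ax u0 x y t) (E 1 x y t)) = E (b1 - theta).
  apply: funext3 => x y t; rewrite DxE dE AxE cE EB; congr (E _ x y t).
  by rewrite /eX /=; ring.
have ByE : (fun x y t => Dy (E 1) x y t + comm (Ay u0 x y t) (E 1 x y t)) = E (b2 - theta).
  apply: funext3 => x y t; rewrite DyE dE AyE cE EB; congr (E _ x y t).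
  by rewrite /eY /=; ring.
have BtE : (fun x y t => Dt (E 1) x y t + comm (At u0 x y t) (E 1 x y t)) = E gamma.
  apply: funext3 => x y t; rewrite DtE dE AtE /comm /mcst mul0mx mulmx0 subr0 addr0.
  by congr (E _ x y t); rewrite /eT /=; ring.
have final x y t : Dt (E gamma) x y t - Dx (E (b1 - theta)) x y t - Dy (E (b2 - theta)) x y t
    - comm (E gamma x y t) (Ay u0 x y t) - comm (At u0 x y t) (E (b2 - theta) x y t) = 0.
  rewrite DtE DxE DyE !dE AyE AtE.
  have -> : comm (mcst 0 x y t) (E (b2 - theta) x y t) = 0 by rewrite /comm /mcst mul0mx mulmx0 subr0.
  have -> : comm (E gamma x y t) (mcst (diag_mx (- a)) x y t) = E (theta * gamma) x y t.
    have -> : comm (E gamma x y t) (mcst (diag_mx (- a)) x y t) = - comm (diag_mx (- a)) (E gamma x y t).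
      by rewrite /comm opprB.
    by rewrite cE /E /mscale -scaleNr; congr (_ *: _); rewrite /cmul /ccst; ring.
  rewrite subr0 /E /mscale /mcst -!scalerBl.
  have disp' : gamma ^+ 2 - b1 * (b1 - theta) - b2 * (b2 - theta) - gamma * theta = 0.
    exact: disp.
  have zero (e : C) : e = 0 -> e *: M = 0 by move=> ->; rewrite scale0r.
  apply: zero; rewrite /cmul /ccst /eT /eX /eY /=.
  move: (cexplin _ _ _ _ _ _) => e.
  transitivity ((gamma ^+ 2 - b1 * (b1 - theta) - b2 * (b2 - theta) - gamma * theta) * e).
    by rewrite /GRing.scale /=; move: (b1) (b2) => *; ring.
  by rewrite disp' mul0r.
move: final; rewrite fE -BtE -BxE -ByE => final.
exact: final.
Qed.

Lemma frameE b i k : frame n p b i k = if ((i < p)%N == b) then (k == 1)%:R * ((rootsize n p b)^-1)%:C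
  else (k == 0)%:R * ((rootsize n p (~~ b))^-1)%:C :> C.
Proof. by rewrite mxE. Qed.

Definition mode_mx (b : bool) : 'M[C]_n := frame n p b *m delta_mx 0 1 *m (frame n p b)^t*.

Lemma mode_mxE b i k : mode_mx b i k = frame n p b i 0 * (frame n p b k 1)^*.
Proof.
rewrite /mode_mx mxE sum2 !mxE !sum2 !mxE /=.
by rewrite !mulr0 !addr0 mulr1 mul0r add0r.
Qed.

Lemma mode_mx_trace b : \tr (mode_mx b) = 0.
Proof.
rewrite /mxtrace big1 // => i _; rewrite mode_mxE !frameE.
by case: ifP => _ /=; rewrite !mul0r ?rmorph0 ?mulr0.
Qed.

(** The eigenvalue of the commutator with [a] on [mode_mx b]: up to sign, the gap between the two
    eigenvalues of [a]. *)
Definition theta (b : bool) : C := if b then - ('i%C * h%:C) else 'i%C * h%:C.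

Lemma mode_mx_comm b : comm (diag_mx a) (mode_mx b) = theta b *: mode_mx b.
Proof.
apply/matrixP => i k; rewrite /comm mul_diag_mx mul_mx_diag.
have -> : forall A B : 'M[C]_n, (A - B) i k = A i k - B i k by move=> A B; rewrite !mxE.
rewrite [X in X - _]mxE [X in _ - X]mxE [RHS]mxE.
rewrite [mode_mx b i k * _]mulrC -mulrBl (a_diag_alt m p_ltn i) (a_diag_alt m p_ltn k) mode_mxE !frameE.
case: b; rewrite /theta; case: (i < p)%N; case: (k < p)%N => /=;
  rewrite ?mul0r ?rmorph0 ?mulr0 //; congr (_ * _); ring.
Qed.

Lemma exp_small (c rate : R) (s : R -> R) (F : set_system R) : Filter F ->
  0 < c -> 0 < rate -> (forall M, \forall t \near F, M < s t) ->
  forall e, 0 < e -> \forall t \near F, c * expR (- (rate * s t)) < e.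
Proof.
move=> FF c0 r0 hs e e0; near=> t.
(* Sufficient because 1 + x <= exp x. *)
have h1 : c / e < rate * s t.
  by rewrite -ltr_pdivrMl //; near: t; apply: hs.
rewrite expRN ltr_pdivrMr ?expR_gt0 // mulrC -ltr_pdivrMr //.
by apply: lt_le_trans h1 _; apply: le_trans (expR_ge1Dx _); rewrite lerDr.
Unshelve. all: by end_near. Qed.

End Modes.

(** * Assembly: the Ward map, its limits and its tangent modes *)

Section Main.
Context {R : realType} (n p N : nat) (m : int) (j l : nat -> int).
Notation C := R[i].
Notation h := (nmR n m : R).
Notation K := (2 * N)%N.
Notation z := (fun s => zpar n m (j s) (l s) : C).
Notation tau s := (growth n m (j s) (l s) : R).
Hypotheses (p_gt0 : (0 < p)%N) (p_ltn : (p < n)%N) (m_neq0 : m != 0) (N_gt0 : (0 < N)%N)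
  (gz : generic z K)
  (jl : forall s, (1 <= s <= K)%N -> in_disc (R := R) n m (j s) (l s))
  (key_inj : forall s r, (1 <= s <= K)%N -> (1 <= r <= K)%N ->
     (j s, l s) = (j r, l r) -> s = r)
  (z_conj : \prod_(1 <= r < K.+1) (0 - z r) = \prod_(1 <= r < K.+1) (0 - (z r)^*))
  (z_div : \prod_(1 <= r < K.+1) (z r / (z r)^*) = 1).

Let n_gt0 : (0 < n)%N. Proof. exact: leq_trans p_gt0 (ltnW p_ltn). Qed.

Definition vecs (x y t : R) (s : nat) : 'cV[C]_n :=
  psi0 n p m x y t (z s) *m qvec n p m (j s) (l s) x y t.

Definition Dmx (x y t : R) : 'M[C]_n := dress z (vecs x y t) K 0.

Definition axes (b : bool) (q : R * R * R) (s : nat) : C :=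
  deltab n p m b (j s) (l s) q.1.1 q.1.2 q.2.

Definition dmx (b : bool) (q : R * R * R) : 'M[C]_2 :=
  dress z (fun s => near_axis (axes b q s)) K 0.

Lemma J2NE c x y t : J2N n p m N j l c x y t =
  \prod_(1 <= s < K.+1) c s *: (J0 n p m x y *m (Dmx x y t)^t*).
Proof. exact: backlund_iter_ward. Qed.

Lemma Dmx_frame b x y t : Dmx x y t =
  1%:M + frame n p b *m (dmx b (x, y, t) - 1%:M) *m (frame n p b)^t*.
Proof.
rewrite /dmx -dress_isom; last exact: frame_isometry.
apply: eq_dress => s s1.
have [k k0 kE] := svec_frame m p_gt0 p_ltn b (j s) (l s) x y t.
have -> : vecs x y t s = (alpha n p m (z s) x y t * k) *: (frame n p b *m
    near_axis (deltab n p m b (j s) (l s) x y t)).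
  by rewrite -scalerA -kE; exact: (psi0_qvec p_gt0 p_ltn m_neq0 (jl s1)).
by rewrite -scalemxAr line_projZ // mulf_neq0 // cexp_neq0.
Qed.

Lemma Dmx_unitary x y t : (Dmx x y t)^t* *m Dmx x y t = 1%:M.
Proof.
have := @dress_unitary R n z (vecs x y t) K 0; rewrite rmorph0; apply=> s s1.
have [z0 _] := gz; rewrite !(eq_sym 0) conjC_eq0.
by split; apply: z0.
Qed.

Lemma Dmx_det x y t : \det (Dmx x y t) = 1.
Proof.
rewrite /Dmx (det_dress0 gz (leqnn _)) // => s s1.
exact: (psi0_qvec_neq0 p_gt0 p_ltn m_neq0 (jl s1)).
Qed.

(** The vectors [vecs] are not periodic, because of [alpha], but their lines are; the
    two-dimensional form sees only the periodic slopes. *)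
Lemma Dmx_periodic x y t :
  Dmx (x + 2 * pi) y t = Dmx x y t /\ Dmx x (y + 2 * pi) t = Dmx x y t.
Proof.
have gE s : gmode n m (j s) (l s) (x + 2 * pi) y t = gmode n m (j s) (l s) x y t :> C /\
    gmode n m (j s) (l s) x (y + 2 * pi) t = gmode n m (j s) (l s) x y t :> C.
  apply: (@cexplin_2pi R _ _ _ (- j s) (- l s)); by rewrite rmorphN /= rmorphN /= mulrN.
have aE s : axes true (x + 2 * pi, y, t) s = axes true (x, y, t) s /\
    axes true (x, y + 2 * pi, t) s = axes true (x, y, t) s.
  by rewrite /axes /deltab /=; have [-> ->] := gE s.
have E1 : (fun s => near_axis (axes true (x + 2 * pi, y, t) s)) =
    (fun s => near_axis (axes true (x, y, t) s)) by apply/funext => s; case: (aE s) => -> _.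
have E2 : (fun s => near_axis (axes true (x, y + 2 * pi, t) s)) =
    (fun s => near_axis (axes true (x, y, t) s)) by apply/funext => s; case: (aE s) => _ ->.
split.
  by rewrite (Dmx_frame true (x + 2 * pi) y t) (Dmx_frame true x y t) /dmx E1.
by rewrite (Dmx_frame true x (y + 2 * pi) t) (Dmx_frame true x y t) /dmx E2.
Qed.

Lemma lax_data_J2N c : exists A B, lax_data z K K (J2N n p m N j l c) A B
  (lax_vectors z (fun s => qvec n p m (j s) (l s)) (backlund_iter c z
     (fun s => qvec n p m (j s) (l s)) (psi0 n p m) (stationary (J0 n p m)) K).1).
Proof.
apply: (lax_data_iter (A := mcst (diag_mx (- a_diag n p m)))
  (B := mcst (diag_mx (- a_diag n p m))) c gz (leqnn _)).
have J1 : stationary (J0 n p m) = stationary (fun x y => 1 *: J0 n p m x y) :> (R -> R -> R -> 'M[C]_n).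
  by apply: funext3 => x y t; rewrite /stationary scale1r.
split.
- by rewrite J1; apply: J0_good.
- by move=> x y t; rewrite J1; apply: J0_log; rewrite /eU /= add0r.
- by move=> x y t; rewrite J1; apply: J0_log; rewrite /eX /= addr0.
- by move=> x y t; apply: a_skew.
- by move=> x y t; apply: a_skew.
- exact/mgood_diff/mgood_cst.
- exact/mgood_diff/mgood_cst.
- by move=> x y t; rewrite !mD_cst.
- move=> s s1; split.
  + exact: (psi0_qvec_good p_gt0 p_ltn m_neq0 (jl s1)).
  + exact: (psi0_qvec_neq0 p_gt0 p_ltn m_neq0 (jl s1)).
  + exact: (psi0_qvec_laxA p_gt0 p_ltn m_neq0 (jl s1)).
  + exact: (psi0_qvec_laxB p_gt0 p_ltn m_neq0 (jl s1)).
Qed.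

Section Constants.
Variable c : nat -> C.
Hypothesis hc : normalizing n m N j l c.
Notation omega := (\prod_(1 <= s < K.+1) c s).

Lemma omega_n : omega ^+ n = 1.
Proof.
rewrite -prodrXl; transitivity (\prod_(1 <= r < K.+1) (z r / (z r)^*)); last exact: z_div.
rewrite big_seq [RHS]big_seq; apply: eq_bigr => s; rewrite mem_index_iota => s1.
exact: hc.
Qed.

Lemma omega_norm : `|omega| = 1.
Proof.
have /(congr1 Num.norm) := omega_n; rewrite normrX normr1 => /eqP.
by rewrite pexpr_eq1 // => /eqP.
Qed.

Lemma J2N_unitary x y t : J2N n p m N j l c x y t \is unitarymx.
Proof.
rewrite J2NE scalemxAl; apply: mul_unitarymx.
  by apply: scaleJ0_unitary; exact: omega_norm.
by apply/unitarymxP; rewrite adjK Dmx_unitary.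
Qed.

Lemma J2N_ward : ward_map_T2 (J2N n p m N j l c).
Proof.
have [A [B [gJ hA hB _ _ _ _ AB _]]] := lax_data_J2N c.
split; last first.
  move=> x y t; rewrite !J2NE; have [-> ->] := Dmx_periodic x y t.
  by have [-> ->] := J0_periodic n p m x y.
split; first exact: mgood_smooth.
  move=> x y t; split; first exact: J2N_unitary.
  rewrite J2NE detZ omega_n mul1r det_mulmx J0_det // mul1r det_adj Dmx_det.
  exact: rmorph1.
exact: (ward_equation gJ (fun x y t => J2N_unitary x y t) hA hB AB).
Qed.

Lemma J2N_quotient x y t :
  invmx (omega *: J0 n p m x y) *m J2N n p m N j l c x y t = (Dmx x y t)^t*.
Proof.
rewrite J2NE scalemxAl mulKmx //; apply: unitarymx_unit.
by apply: scaleJ0_unitary; exact: omega_norm.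
Qed.

End Constants.

Lemma mode_mx_adj b : frame n p b *m delta_mx 1 0 *m (frame n p b)^t* = (mode_mx n p b)^t* :> 'M[C]_n.
Proof.
rewrite /mode_mx (adjM (frame n p b *m _)) adjK (adjM (frame n p b)) mulmxA.
congr (_ *m _ *m _).
by rewrite trmx_delta; apply/matrixP => r d; rewrite !mxE rmorph_nat.
Qed.

(** Uniformity in (x, y) is encoded as a filter on triples, so that the limit lemmas apply as they
    stand. *)
Definition unif (F : set_system R) : set_system (R * R * R) :=
  [set A | \forall t \near F, forall x y, A (x, y, t)].

Global Instance unif_filter (F : set_system R) : Filter F -> Filter (unif F).
Proof.
move=> FF; split.
- exact: nearW.
- by move=> A B hA hB; rewrite /unif /=; near=> t => x y; split; move: x y; near: t.
- by move=> A B AB hA; apply: (@filterS _ F FF _ _ _ hA) => t ht x y; apply: AB.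
Unshelve. all: by end_near. Qed.

(** Time oriented towards the end under study, so that both ends share one argument. *)
Definition flow (b : bool) (t : R) : R := if b then - t else t.

Lemma norm_axes b s : exists2 k : R, 0 < k & forall q,
  `|axes b q s| = (k * expR (- (tau s * flow b q.2)))%:C.
Proof.
have r0 b' : 0 < rootsize n p b' :> R by exact: rootsize_gt0.
have gN x y t : `|gmode n m (j s) (l s) x y t| = (expR (tau s * t))%:C :> C.
  rewrite norm_cexp clinE /= /rlin; congr (expR _)%:C.
  by rewrite !mul0r !mul1r; ring.
have rN (r : R) : 0 < r -> `|r%:C| = r%:C :> C by move=> r1; rewrite ger0_norm // (lecR 0) ltW.
case: b; [exists (rootsize n p false / rootsize n p true)|exists (rootsize n p true / rootsize n p false)];
  rewrite ?divr_gt0 // => q; rewrite /axes /deltab /flow.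
  by rewrite normrM gN rN ?divr_gt0 // -rmorphM /= mulrN opprK.
by rewrite normrM normfV gN rN ?divr_gt0 // -fmorphV /= -rmorphM /= expRN.
Qed.

Section Asymptotics.
Variables (b : bool) (F : set_system R) (s0 : nat).
Hypotheses (FF : Filter F) (hF : forall M, \forall t \near F, M < flow b t)
  (s0K : (1 <= s0 <= K)%N) (s0_min : forall s, (1 <= s <= K)%N -> tau s0 <= tau s).

Definition eps (q : R * R * R) : R := expR (- (tau s0 * flow b q.2)).

Lemma eps_ge0 q : 0 <= eps q. Proof. exact: expR_ge0. Qed.

Lemma axes_tendsto s : (1 <= s <= K)%N -> tendsto (unif F) (fun q => axes b q s) 0.
Proof.
move=> s1 e e0; have [k k0 kE] := norm_axes b s.
have := exp_small FF k0 (growth_gt0 (jl s1)) hF e0.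
by apply: filterS => t ht x y; rewrite subr0 kE ltcR.
Qed.

Lemma axes_bigo s : (1 <= s <= K)%N -> bigo (unif F) eps (fun q => axes b q s).
Proof.
move=> s1; have [k k0 kE] := norm_axes b s; exists k => //.
have := hF 0; apply: filterS => t ht x y; rewrite kE lecR ler_wpM2l ?(ltW k0) //.
by rewrite ler_expR lerN2 ler_wpM2r ?(ltW ht) // s0_min.
Qed.

Lemma axes_smallo s : (1 <= s <= K)%N -> tau s != tau s0 ->
  smallo (unif F) eps (fun q => axes b q s).
Proof.
move=> s1 ts e e0; have [k k0 kE] := norm_axes b s.
have rate : 0 < tau s - tau s0 by rewrite subr_gt0 lt_neqAle eq_sym ts s0_min.
have := exp_small FF k0 rate hF e0; apply: filterS => t ht x y.
rewrite kE lecR /eps /=.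
have -> : - (tau s * flow b t) = - ((tau s - tau s0) * flow b t) + - (tau s0 * flow b t) by ring.
by rewrite expRD mulrA ler_wpM2r ?expR_ge0 // ltW.
Qed.

Definition zmin (q : R * R * R) : C :=
  \sum_(1 <= s < K.+1 | tau s == tau s0) mode_coef z K s * axes b q s.

Definition two_mx (w : C) : 'M[C]_2 := w *: delta_mx 0 1 - w^* *: delta_mx 1 0.

Lemma dmx_expansion i k : smallo (unif F) eps (fun q => (dmx b q - 1%:M + two_mx (zmin q)) i k).
Proof.
pose zfull q := \sum_(1 <= s < K.+1) mode_coef z K s * axes b q s.
have hfull := @dress0_expansion R _ (unif F) _ z K (fun s q => axes b q s) gz
  axes_tendsto eps eps_ge0 axes_bigo z_conj zfull (fun=> erefl).
(* Modes with a strictly larger rate are o(eps), so only the slowest ones survive. *)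
have hd : smallo (unif F) eps (fun q => zfull q - zmin q).
  apply: (@eq_smallo _ _ _ _ (fun q => \sum_(s <- [seq s <- index_iota 1 K.+1 | tau s != tau s0])
      mode_coef z K s * axes b q s)).
    move=> q; rewrite big_filter /zfull /zmin.
    by rewrite [X in _ = X - _](bigID (fun s => tau s == tau s0)) /= [RHS]addrC addKr.
  apply: smallo_sum => [|s]; first exact: eps_ge0.
  rewrite mem_filter mem_index_iota => /andP[ts s1].
  by apply: smalloZ; apply: axes_smallo.
have e2 : smallo (unif F) eps (fun q => (zfull q - zmin q) * (delta_mx 0 1 : 'M[C]_2) i k
    - (zfull q - zmin q)^* * (delta_mx 1 0 : 'M[C]_2) i k).
  apply: smalloD.
    by apply: (@eq_smallo _ _ _ _ (fun q => (delta_mx 0 1 : 'M[C]_2) i k * (zfull q - zmin q)));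
      [move=> q; rewrite mulrC|apply: smalloZ].
  apply: smalloN.
  by apply: (@eq_smallo _ _ _ _ (fun q => (delta_mx 1 0 : 'M[C]_2) i k * (zfull q - zmin q)^*));
    [move=> q; rewrite mulrC|apply: smalloZ; apply: smallo_conj].
have fU : Filter (unif F) by exact: unif_filter.
have H := smalloD (hfull fU i k) (smalloN e2).
move=> e e0; have := H fU fU e e0; apply: filterS => q hq.
suff -> : (dmx b q - 1%:M + two_mx (zmin q)) i k =
    (dmx b q - 1%:M + (zfull q *: delta_mx 0 1 - (zfull q)^* *: delta_mx 1 0)) i k
    - ((zfull q - zmin q) * (delta_mx 0 1 : 'M[C]_2) i k
       - (zfull q - zmin q)^* * (delta_mx 1 0 : 'M[C]_2) i k) by exact: hq.
have mxE4 (A B X Y : 'M[C]_2) (u v : C) : (A - B + (u *: X - v *: Y)) i k =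
  A i k - B i k + (u * X i k - v * Y i k) by rewrite !mxE.
rewrite /two_mx !mxE4 rmorphB /=.
by move: (dmx b q i k) (1%:M i k) (delta_mx 0 1 i k) (delta_mx 1 0 i k) => *; ring.
Qed.

Definition mode (x y t : R) : 'M[C]_n :=
  frame n p b *m two_mx (zmin (x, y, t)) *m (frame n p b)^t*.

Lemma smallo_conj_frame (X : R * R * R -> 'M[C]_2) :
  (forall i k, smallo (unif F) eps (fun q => X q i k)) ->
  forall i k, smallo (unif F) eps (fun q => (frame n p b *m X q *m (frame n p b)^t*) i k).
Proof.
move=> hX i k.
apply: (@eq_smallo _ _ _ _ (fun q => \sum_(c <- enum 'I_2) \sum_(d <- enum 'I_2)
   (frame n p b i d * (frame n p b)^t* c k) * X q d c)).
  move=> q; rewrite big_enum [RHS]mxE; apply: eq_bigr => c _.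
  rewrite big_enum [(_ *m X q) i c]mxE mulr_suml; apply: eq_bigr => d _.
  by rewrite mulrAC.
apply: smallo_sum => [|c _]; first exact: eps_ge0.
apply: smallo_sum => [|d _]; first exact: eps_ge0.
exact: smalloZ.
Qed.

Lemma two_mx_adj w : (two_mx w)^t* = - two_mx w.
Proof.
rewrite /two_mx adjD adjN !adjZ conjCK opprB.
have dE (i k : 'I_2) : (delta_mx i k : 'M[C]_2)^t* = delta_mx k i.
  by rewrite trmx_delta; apply/matrixP => r c; rewrite !mxE rmorph_nat.
by rewrite !dE addrC.
Qed.

(** [two_mx] is skew-Hermitian, so the adjoint exchanges + mode and - mode. *)
Lemma quotient_mode x y t : (Dmx x y t)^t* - 1%:M - mode x y t =
  (frame n p b *m (dmx b (x, y, t) - 1%:M + two_mx (zmin (x, y, t))) *m (frame n p b)^t*)^t*.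
Proof.
have -> : frame n p b *m (dmx b (x, y, t) - 1%:M + two_mx (zmin (x, y, t))) *m (frame n p b)^t*
    = frame n p b *m (dmx b (x, y, t) - 1%:M) *m (frame n p b)^t* + mode x y t.
  by rewrite (mulmxDr _ (dmx b (x, y, t) - 1%:M)) mulmxDl.
rewrite (Dmx_frame b); move: (frame n p b *m (dmx b _ - _) *m _) => A.
rewrite (adjD 1%:M A) adj1 (adjD A) [1%:M + _]addrC addrK; congr (_ + _).
by rewrite /mode !adjM adjK two_mx_adj mulNmx mulmxN mulmxA.
Qed.

Lemma quotient_smallo i k :
  smallo (unif F) eps (fun q => ((Dmx q.1.1 q.1.2 q.2)^t* - 1%:M - mode q.1.1 q.1.2 q.2) i k).
Proof.
apply: (eq_smallo _ (smallo_conj (smallo_conj_frame dmx_expansion k i))) => -[[x y] t].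
by rewrite quotient_mode !mxE.
Qed.

Lemma quotient_tendsto i k :
  tendsto (unif F) (fun q => ((Dmx q.1.1 q.1.2 q.2)^t* - 1%:M) i k) 0.
Proof.
have [h1 _] := @tendsto_dress R _ (unif F) _ z K (fun s q => axes b q s) gz
  axes_tendsto K 0 (leqnn _).
have bl : blaschke z K 0 = 1.
  rewrite /blaschke prodf_div z_conj divff // prodf_seq_neq0; apply/allP => s.
  rewrite mem_index_iota => s1; apply/implyP => _; rewrite sub0r oppr_eq0 conjC_eq0.
  by have [z0 _] := gz; apply: z0.
rewrite bl subrr scale0r addr0 in h1.
have h2 : mtendsto (unif F) (fun q => frame n p b *m (dmx b q - 1%:M) *m (frame n p b)^t*)
    (frame n p b *m (1%:M - 1%:M) *m (frame n p b)^t*).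
  apply: mtendstoM; last exact: mtendsto_cst.
  apply: mtendstoM; first exact: mtendsto_cst.
  by apply: mtendstoD; [exact: h1|exact: mtendsto_cst].
have E0 : ((0 : 'M[C]_n)^t*) i k = 0 by rewrite !mxE rmorph0.
have := mtendsto_adj h2 i k; rewrite subrr mulmx0 mul0mx E0 => H.
suff -> : (fun q : R * R * R => ((Dmx q.1.1 q.1.2 q.2)^t* - 1%:M) i k) =
    (fun q => ((frame n p b *m (dmx b q - 1%:M) *m (frame n p b)^t*)^t*) i k) by exact: H.
apply/funext => -[[x y] t] /=; rewrite (Dmx_frame b) (adjD 1%:M) adj1.
by rewrite [1%:M + _]addrC addrK.
Qed.

Variable c : nat -> C.
Hypothesis hc : normalizing n m N j l c.
Notation omega := (\prod_(1 <= s < K.+1) c s).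
Notation u0 := (fun x y => omega *: J0 n p m x y).

Lemma J2N_tends_to : tends_to F (J2N n p m N j l c) u0.
Proof.
move=> e e0.
have h1 : \forall t \near F, forall ik : 'I_n * 'I_n, forall x y,
    `|((Dmx x y t)^t* - 1%:M) ik.1 ik.2 - 0| < e%:C.
  apply: filter_forall => -[i k]; exact: (quotient_tendsto i k e0).
move: h1; apply: filterS => t ht x y i k; have := ht (i, k) x y; rewrite /= subr0.
have -> : J2N n p m N j l c x y t - omega *: J0 n p m x y =
    omega *: (J0 n p m x y *m ((Dmx x y t)^t* - 1%:M)).
  by rewrite J2NE mulmxBr mulmx1 scalerBr.
(* [omega] and the diagonal entries of [J0] have modulus 1, so the entrywise bound carries over
   unchanged. *)
rewrite [X in _ -> `|X| < _]mxE normrM (omega_norm hc) mul1r /J0 /exp_diag mul_diag_mx.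
rewrite [X in _ -> `|X| < _]mxE normrM.
suff -> : `|map_mx cexp (- (x + y)%:C *: a_diag n p m) 0 i| = 1 :> C by rewrite mul1r.
rewrite mxE norm_cexp [X in complex.Re X]mxE a_diagE imul_real /=.
by rewrite !mulr0 oppr0 mul0r subrr expR0.
Qed.

(** The imaginary part does not depend on s, so modes with equal tau share the whole time factor, as
    [linear_mode] requires. *)
Definition rate : C := if b then (tau s0)%:C - 'i%C * (h / 2)%:C
  else - ((tau s0)%:C - 'i%C * (h / 2)%:C).

Lemma rate_Re t : complex.Re rate * t = - (tau s0 * flow b t).
Proof.
rewrite /rate imul_real /flow; case: b => /=; rewrite ?oppr0 ?addr0.
  by rewrite mulrN opprK.
by rewrite mulNr.
Qed.

Lemma J2N_tangent_to : tangent_to F (J2N n p m N j l c) u0 rate mode.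
Proof.
move=> e e0.
have h1 : \forall t \near F, forall ik : 'I_n * 'I_n, forall x y,
    `|((Dmx x y t)^t* - 1%:M - mode x y t) ik.1 ik.2| <= (e * expR (- (tau s0 * flow b t)))%:C.
  apply: filter_forall => -[i k]; exact: (quotient_smallo i k e0).
move: h1; apply: filterS => t ht x y i k.
by rewrite (J2N_quotient hc) rate_Re; exact: (ht (i, k)).
Qed.

Definition key (s : nat) : int * int := if b then (- j s, - l s) else (j s, l s).

Lemma key_injective s r : (1 <= s <= K)%N -> (1 <= r <= K)%N -> key s = key r -> s = r.
Proof.
move=> s1 r1 E; apply: key_inj => //; move: E; rewrite /key; case: b => // -[].
by move=> /oppr_inj -> /oppr_inj ->.
Qed.

Definition weight (s : nat) : C := mode_coef z K s *
  (if b then (rootsize n p false / rootsize n p true)%:C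
   else (rootsize n p true / rootsize n p false)%:C).

Lemma mode_coef_neq0 s : (1 <= s <= K)%N -> mode_coef z K s != 0.
Proof.
move=> s1; have [z0 zz] := gz; have mem r : r \in index_iota 1 K.+1 -> (1 <= r <= K)%N.
  by rewrite mem_index_iota.
rewrite /mode_coef /lagrange0 !mulf_neq0 ?invr_neq0 // prodf_seq_neq0; apply/allP => r /mem r1;
  apply/implyP => rs.
- by rewrite subr_eq0; case: (zz s r s1 r1).
- rewrite mulf_neq0 ?invr_neq0 ?sub0r ?oppr_eq0 ?z0 // subr_eq0.
  by case: (zz s r s1 r1) => _; apply; rewrite eq_sym.
- by rewrite sub0r oppr_eq0 conjC_eq0 z0.
Qed.

Lemma weight_neq0 s : (1 <= s <= K)%N -> weight s != 0.
Proof.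
have r0 b' : 0 < rootsize n p b' :> R by exact: rootsize_gt0.
move=> s1; rewrite mulf_neq0 ?mode_coef_neq0 //.
by case: b; rewrite (inj_eq (@complexI R)) gt_eqF // divr_gt0.
Qed.

Lemma mode_weight s x y t : tau s = tau s0 ->
  mode_coef z K s * axes b (x, y, t) s =
  weight s * cexp ('i%C * ((key s).1%:~R * x + (key s).2%:~R * y)%:C + rate * t%:C).
Proof.
move=> ts; rewrite /weight -mulrA; congr (_ * _); rewrite /axes /deltab /key /rate /=.
case: b => /=; rewrite /gmode /cexplin ?ts -?cexpN; congr (_ * cexp _);
  rewrite /clin rmorphD !rmorphM /= ?rmorphN /=;
  by move: ('i%C) (x%:C) (y%:C) (t%:C) => *; ring.
Qed.

Lemma zminE x y t : zmin (x, y, t) = \sum_(1 <= s < K.+1 | tau s == tau s0)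
  weight s * cexp ('i%C * ((key s).1%:~R * x + (key s).2%:~R * y)%:C + rate * t%:C).
Proof. by apply: eq_bigr => s /eqP ts; apply: mode_weight. Qed.

Definition slow_keys : seq (int * int) :=
  [seq key s | s <- [seq s <- index_iota 1 K.+1 | tau s == tau s0]].

(** [linear_mode] indexes coefficients by frequency. As [key] is injective on the steps, the sum has
    one term at each slow frequency. *)
Definition key_weight (k : int * int) : C :=
  \sum_(1 <= s < K.+1 | (tau s == tau s0) && (key s == k)) weight s.

Lemma key_weightE s : (1 <= s <= K)%N -> tau s = tau s0 -> key_weight (key s) = weight s.
Proof.
move=> s1 ts; rewrite /key_weight big_mkcond (bigD1_seq s) ?mem_index_iota ?iota_uniq //=.
rewrite ts !eqxx /= big1_seq ?addr0 // => r /andP[rs]; rewrite mem_index_iota => r1.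
case: ifP => // /andP[_ /eqP E].
by rewrite (key_injective r1 s1 E) eqxx in rs.
Qed.

Lemma slow_keysP k : k \in slow_keys ->
  exists s, [/\ (1 <= s <= K)%N, tau s = tau s0 & k = key s].
Proof.
move=> /mapP[s]; rewrite mem_filter mem_index_iota => /andP[/eqP ts s1] ->.
by exists s.
Qed.

Lemma zmin_keys x y t (V : lmodType C) (M : V) : \sum_(k <- slow_keys)
  cexp ('i%C * (k.1%:~R * x + k.2%:~R * y)%:C + rate * t%:C) *: (key_weight k *: M)
  = zmin (x, y, t) *: M.
Proof.
rewrite /slow_keys big_map big_filter zminE scaler_suml.
rewrite big_seq_cond [RHS]big_seq_cond; apply: eq_bigr => s.
rewrite mem_index_iota => /andP[s1 /eqP ts]; rewrite key_weightE // scalerA.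
by rewrite mulrC.
Qed.

Lemma zmin_neq0 : exists x y, zmin (x, y, 0) != 0.
Proof.
apply: contrapT => hno.
have h0 x y : \sum_(k <- slow_keys) key_weight k * chi k x y = 0.
  transitivity (zmin (x, y, 0)).
    rewrite zminE /slow_keys big_map big_filter big_seq_cond [RHS]big_seq_cond.
    apply: eq_bigr => s; rewrite mem_index_iota => /andP[s1 /eqP ts].
    by rewrite key_weightE // mulr0 addr0.
  apply/eqP; apply: contrapT => /negP hxy; apply: hno; exists x, y.
  exact: hxy.
have uS : uniq slow_keys.
  rewrite map_inj_in_uniq ?filter_uniq ?iota_uniq // => s r.
  rewrite !mem_filter !mem_index_iota => /andP[_ s1] /andP[_ r1].
  exact: key_injective.
(* At t = 0 the sum has distinct frequencies, and its weight at the frequency of [s0] is nonzero. *)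
have := fourier_independence uS h0.
move=> /(_ (key s0)); rewrite key_weightE // => H.
have /eqP := weight_neq0 s0K; apply; apply: H.
by apply: map_f; rewrite mem_filter eqxx mem_index_iota.
Qed.

(** Once i^2 = -1 is used, this is the formula for tau^2 in [growth_sqr]. *)
Lemma dispersion s : (1 <= s <= K)%N -> tau s = tau s0 ->
  rate ^+ 2 - 'i%C * ((key s).1%:~R)%:C * ('i%C * ((key s).1%:~R)%:C - theta n m b)
    - 'i%C * ((key s).2%:~R)%:C * ('i%C * ((key s).2%:~R)%:C - theta n m b)
    - rate * theta n m b = 0.
Proof.
move=> s1 ts; have := growth_sqr (jl s1); rewrite ts => gs.
have {}gs : (tau s0)%:C ^+ 2 = ((j s)%:~R)%:C * (h%:C - ((j s)%:~R)%:C)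
    - (((l s)%:~R)%:C - h%:C / 2) ^+ 2 :> C.
  rewrite -rmorphXn /= gs rmorphB rmorphM rmorphXn /= !rmorphB /= fmorph_div /=.
  by rewrite rmorph_nat.
have r5 : 'i%C * 'i%C = -1 :> C by rewrite -expr2 sqr_i.
rewrite /rate /theta /key fmorph_div /= rmorph_nat.
case: b => /=; rewrite ?rmorphN /= ?rmorphN /=; move: gs r5;
  move: ((tau s0)%:C) (h%:C) (((j s)%:~R)%:C) (((l s)%:~R)%:C) ('i%C : C) => T H J L I gs r5;
  (transitivity (T ^+ 2 + (I * I) * (- (H ^+ 2 / 4) - J ^+ 2 + J * H - L ^+ 2 + L * H));
    first by field);
  by rewrite gs r5; field.
Qed.

Lemma mode_linear : linear_mode u0 rate mode.
Proof.
exists slow_keys, (fun k => key_weight k *: mode_mx n p b); split.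
- move=> k /slow_keysP[s [s1 ts ->]]; split; first by rewrite mxtraceZ mode_mx_trace mulr0.
  apply: fourier_linearized; try exact: (dispersion s1 ts); try exact: (omega_norm hc); try assumption.
  by rewrite /comm -scalemxAl -scalemxAr -scalerBr -/(comm _ _) mode_mx_comm // scalerA mulrC -scalerA.
- move=> x y t; rewrite /fourier_mode (zmin_keys x y t) /mode /two_mx.
  rewrite mulmxBr mulmxBl -!scalemxAr -!scalemxAl -/(mode_mx n p b) mode_mx_adj.
  by move: (mode_mx n p b) => A; rewrite adjZ.
- have [x [y zxy]] := zmin_neq0; exists x, y, 0.
  (* [mode_mx b] is supported on a single off-diagonal block; at a position inside it the adjoint
     term vanishes. *)
  pose i0 : 'I_n := if b then Ordinal p_ltn else Ordinal n_gt0.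
  pose k0 : 'I_n := if b then Ordinal n_gt0 else Ordinal p_ltn.
  apply/eqP => /matrixP/(_ i0 k0)/eqP.
  have -> : mode x y 0 i0 k0 = zmin (x, y, 0) * mode_mx n p b i0 k0
      - (zmin (x, y, 0))^* * (mode_mx n p b k0 i0)^*.
    rewrite /mode /two_mx mulmxBr mulmxBl -!scalemxAr -!scalemxAl -/(mode_mx n p b).
    rewrite mode_mx_adj.
    by move: (mode_mx n p b) => A; rewrite !mxE.
  have r0 b' : (rootsize n p b')^-1 != 0 :> R by rewrite invr_neq0 // gt_eqF // rootsize_gt0.
  have cR (r : R) : (r%:C)^* = r%:C :> C by exact: conjc_real.
  rewrite [X in _ == X]mxE !mode_mxE !frameE /i0 /k0.
  by case: b; rewrite /= ?ltnn ?p_gt0 /= ?(mul0r, mul1r, rmorph0, mulr0, subr0) cR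
    !mulf_eq0 (negPf zxy) ?(inj_eq (@complexI R)) ?(negPf (r0 _)).
Qed.

End Asymptotics.

Lemma slowest : exists2 s0, (1 <= s0 <= K)%N & forall s, (1 <= s <= K)%N -> tau s0 <= tau s.
Proof.
have : (0 < K)%N by rewrite muln_gt0.
elim: K => // k IH _; have [k0|k1] := posnP k.
  exists 1%N; rewrite ?k0 // => s; rewrite -eqn_leq => /eqP <-.
  exact: lexx.
have [s0 /andP[s1 sk] smin] := IH k1; have [ht|ht] := lerP (tau s0) (tau k.+1).
  exists s0; first by rewrite s1 ltnW.
  move=> s /andP[s2]; rewrite leq_eqVlt => /predU1P[->//|sk'].
  by apply: smin; rewrite s2.
exists k.+1; first by rewrite leqnn.
move=> s /andP[s2]; rewrite leq_eqVlt => /predU1P[->//|sk'].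
by apply: le_trans (ltW ht) (smin _ _); rewrite s2.
Qed.

Lemma flow_pinfty M : \forall t \near +oo, M < flow false t.
Proof. by apply: nbhs_pinfty_gt; rewrite num_real. Qed.

Lemma flow_ninfty M : \forall t \near -oo, M < flow true t.
Proof.
have := @nbhs_ninfty_lt R (- M) (num_real _); apply: filterS => t.
by rewrite /flow ltrNr.
Qed.

Lemma J2N_homoclinic (c : nat -> C) : normalizing n m N j l c ->
  let omega := \prod_(1 <= s < K.+1) c s in
  [/\ homoclinic (J2N n p m N j l c), omega ^+ n = 1,
      tends_to +oo (J2N n p m N j l c) (fun x y => omega *: J0 n p m x y)
    & tends_to -oo (J2N n p m N j l c) (fun x y => omega *: J0 n p m x y)].
Proof.
move=> hc omega; have [s0 s0K s0min] := slowest.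
have Fp : Filter (pinfty_nbhs R) by exact _.
have Fm : Filter (ninfty_nbhs R) by exact _.
have tp := @J2N_tends_to false (pinfty_nbhs R) Fp (fun M => flow_pinfty M) c hc.
have tm := @J2N_tends_to true (ninfty_nbhs R) Fm (fun M => flow_ninfty M) c hc.
have t0 := growth_gt0 (jl s0K).
split; [|exact: (omega_n hc)|exact: tp|exact: tm].
split; first exact: (J2N_ward hc).
exists (fun x y => omega *: J0 n p m x y); split; [|exact: tp|exact: tm| |].
- by apply: J0_ward; first [exact: p_ltn|exact: (omega_norm hc)|exact: (omega_n hc)].
- exists (rate false s0), (mode false s0); split.
  + by rewrite /rate imul_real /= oppr0 addr0 oppr_lt0.
  + exact: mode_linear.
  + exact: (@J2N_tangent_to false _ s0 Fp (fun M => flow_pinfty M) s0min c hc).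
- exists (rate true s0), (mode true s0); split.
  + by rewrite /rate imul_real /= oppr0 addr0.
  + exact: mode_linear.
  + exact: (@J2N_tangent_to true _ s0 Fm (fun M => flow_ninfty M) s0min c hc).
Qed.

(** For nN even, (-1)^N is an n-th root of unity, so its quotient by the product of any admissible
    constants is one too, and can be absorbed into the first constant. *)
Lemma normalizing_sign : ~~ odd (n * N) ->
  exists2 c : nat -> C, normalizing n m N j l c & \prod_(1 <= s < K.+1) c s = (-1) ^+ N.
Proof.
move=> even_nN.
pose c0 s : C := n.-root (z s / (z s)^*).
have hc0 : normalizing n m N j l c0 by move=> s _; rewrite rootCK.
pose w0 := \prod_(1 <= s < K.+1) c0 s.
have w0n : w0 ^+ n = 1 by exact: omega_n hc0.
have w00 : w0 != 0.
  by apply: contra_eq_neq w0n => ->; rewrite expr0n gtn_eqF // eq_sym oner_eq0.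
pose w := (-1) ^+ N / w0.
have wn : w ^+ n = 1.
  rewrite /w expr_div_n w0n divr1 -exprM mulnC -signr_odd (negPf even_nN).
  exact: expr0.
exists (fun s => if s == 1%N then w * c0 s else c0 s).
  by move=> s s1; case: ifP => _; [rewrite exprMn wn mul1r|]; exact: hc0.
have K1 : 1%N \in index_iota 1 K.+1 by rewrite mem_index_iota; have : (0 < K)%N by rewrite muln_gt0.
rewrite (bigD1_seq 1%N) ?iota_uniq //= -mulrA.
have -> : \prod_(1 <= s < K.+1 | s != 1%N) (if s == 1%N then w * c0 s else c0 s)
    = \prod_(1 <= s < K.+1 | s != 1%N) c0 s by apply: eq_bigr => s /negPf ->.
have <- : w0 = c0 1%N * \prod_(1 <= s < K.+1 | s != 1%N) c0 s.
  by rewrite /w0 (bigD1_seq 1%N) ?iota_uniq.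
by rewrite /w mulfVK.
Qed.

End Main.

Lemma block_bounds n p : (1 <= p <= n - 1)%N -> (0 < p)%N /\ (p < n)%N.
Proof.
case: n => [|n] /andP[p1]; first by rewrite sub0n leqn0 => /eqP p0; rewrite p0 in p1.
by rewrite subn1 /= => pn.
Qed.

Theorem corollary4p3 (R : realType) (n p N : nat) (m : int) (j l : nat -> int)
    (hm : m != 0) (hp : (1 <= p <= n - 1)%N) (hN : (1 <= N)%N)
    (hdisc : forall k : nat, (1 <= k <= N)%N ->
       in_disc (R := R) n m (j (2 * k - 1)%N) (l (2 * k - 1)%N))
    (hl : forall k : nat, (1 <= k <= N)%N ->
       nmR n m / 2 < (l (2 * k - 1)%N)%:~R :> R)
    (hdist : forall k h : nat, (1 <= k)%N -> (k < h)%N -> (h <= N)%N ->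
       (j (2 * k - 1)%N, l (2 * k - 1)%N) <> (j (2 * h - 1)%N, l (2 * h - 1)%N))
    (heven : forall k : nat, (1 <= k <= N)%N ->
       j (2 * k)%N = j (2 * k - 1)%N /\
       l (2 * k)%N = n%:Z * m - l (2 * k - 1)%N) :
  (forall c : nat -> R[i], normalizing n m N j l c ->
     let omega := \prod_(1 <= s < (2 * N).+1) c s in
     [/\ homoclinic (J2N n p m N j l c),
         omega ^+ n = 1,
         tends_to +oo (J2N n p m N j l c) (fun x y => omega *: J0 n p m x y)
       & tends_to -oo (J2N n p m N j l c) (fun x y => omega *: J0 n p m x y)]) /\
  (~~ odd (n * N) ->
     exists2 c : nat -> R[i], normalizing n m N j l c &
       tends_to +oo (J2N n p m N j l c) (fun x y => (-1) ^+ N *: J0 n p m x y) /\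
       tends_to -oo (J2N n p m N j l c) (fun x y => (-1) ^+ N *: J0 n p m x y)).
Proof.
have [p_gt0 p_ltn] := block_bounds hp.
have n_gt0 : (0 < n)%N := leq_trans p_gt0 (ltnW p_ltn).
have jl s : (1 <= s <= 2 * N)%N -> in_disc (R := R) n m (j s) (l s).
  exact: (disc_all n_gt0 hm hdisc heven).
have gz := generic_z n_gt0 hm hdisc hl hdist heven.
have kinj := key_inj hl hdist heven.
have zc := prod_z_conj n_gt0 hm hdisc heven.
have zd := prod_z_div n_gt0 hm hdisc hl hdist heven.
have main := J2N_homoclinic p_gt0 p_ltn hm hN gz jl kinj zc zd.
split; first exact: main.
move=> even_nN; have [c hc cE] := normalizing_sign p_gt0 p_ltn hN zd even_nN.
by exists c => //; have [_ _ tp tm] := main c hc; rewrite -cE.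
Qed.
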